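(* Consider the sequence of systems described in the context, and let $\pi_n$ denote the unique stationary distribution of the Markov chain $\boldsymbol{q}_n$ if the load balancing policy is JLMU, and of the Markov chain $(\boldsymbol{q}_n,\boldsymbol{r}_n)$ if the load balancing policy is SLTA. If the load balancing policy is JLMU, then $\{\pi_n:n\geq1\}$ is tight in $\ell_1$. If the load balancing policy is SLTA, then $\{\pi_n:n\geq1\}$ is tight in $\ell_1\times\mathbb{N}$.
   Context: Ranking. Let $\mathbb{N}=\{0,1,2,\dots\}$ and $m\geq 1$. For $i=1,\dots,m$ let $u_i:[0,\infty)\to\mathbb{R}$ be a concave function (only its values on $\mathbb{N}$ matter) and $\Delta(i,j)=u_i(j+1)-u_i(j)$ for $j\in\mathbb{N}$. Let $\mathcal{I}=\{1,\dots,m\}\times\mathbb{N}$ and $\mathcal{I}_+=\{(i,j)\in\mathcal{I}:j\geq 1\}$. Define a total order $\vartriangleleft$ on $\mathcal{I}_+$ by: $(i,j)\vartriangleleft(i',j')$ iff either $\Delta(i,j-1)<\Delta(i',j'-1)$, or $\Delta(i,j-1)=\Delta(i',j'-1)$ and $(i,j)$ is strictly larger than $(i',j')$ in the lexicographic order. Write $\vartriangleright$ for the reverse order and $\trianglerighteq$ for its non-strict version. Every nonempty subset of $\mathcal{I}_+$ has a largest element for $\vartriangleleft$; $(i_k,j_k)$, $k\geq 1$, denotes the $k$-th largest element of $\mathcal{I}_+$. Systems. $\lambda,\mu>0$, $\rho=\lambda/\mu$. The $n$-th system has $n$ server pools divided into $m$ classes, $A_n(i)$ of them of class $i$, and $\alpha_n(i)=A_n(i)/n$.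 Tasks arrive as a Poisson process of rate $n\lambda$ and have independent exponential service times with mean $1/\mu$; all tasks are executed in parallel. The occupancy state is $q=(q(i,j))_{(i,j)\in\mathcal{I}}$, where $q(i,j)$ is the number of server pools of class $i$ with at least $j$ tasks divided by $n$. $\ell_1$ is the space of absolutely summable elements of $\mathbb{R}^{\mathcal{I}}$ with its usual norm; $Q_n$ is the set of $q\in\ell_1$ with $nq(i,j)\in\mathbb{N}$ and $q(i,j+1)\leq q(i,j)\leq q(i,0)=\alpha_n(i)$ for all $(i,j)\in\mathcal{I}$. Departures: in state $q$, for each $(i,j)\in\mathcal{I}_+$, $q(i,j)$ decreases by $1/n$ at rate $n\mu j[q(i,j)-q(i,j+1)]$. Arrivals occur at rate $n\lambda$; a task assigned to coordinates $(i,j)\in\mathcal{I}_+$ (a pool of class $i$ with exactly $j-1$ tasks) increases $q(i,j)$ by $1/n$. JLMU: an arrival in state $q$ is assigned to coordinates $\sigma(q)=\max\{(i,j)\in\mathcal{I}_+:q(i,j-1)>q(i,j)\}$, the maximum being with respect to $\vartriangleleft$. The state space of the Markov chain $\boldsymbol{q}_n$ is the set of states in $Q_n$ reachable from the empty occupancy state. SLTA, with parameter $\beta_n>0$: the state is $(q,r)$ with $q\in Q_n$ and $r\geq 1$ an integer. Let $\ell_i(r)=\max\{j\geq 0: j=0\text{ or }(i,j)\vartriangleright(i_r,j_r)\}$. A server pool of class $i$ with exactly $j-1$ tasks has a green token if $j-1<\ell_i(r)$, and a yellow token if $i=i_r$ and $j-1\leq\ell_i(r)$ (it can have both). When a task arrives: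 if there are green tokens of classes $i\neq i_{r-1}$, one of these is picked uniformly at random and the task is sent to the corresponding pool; if the only green tokens are of class $i_{r-1}$, one of these is picked uniformly at random; if there are only yellow tokens, a yellow token is picked uniformly at random; if there are no tokens, the task is sent to a pool chosen uniformly at random. In addition, depending on the state right before the arrival, after the task is dispatched: $r$ is decreased by one if $r>1$, there are at least $n\beta_n$ green tokens and at least one of them belongs to a pool of class $i_{r-1}$; $r$ is increased by one if there are no green tokens and at most one yellow token; otherwise $r$ is unchanged. The state space of the Markov chain $(\boldsymbol{q}_n,\boldsymbol{r}_n)$ is the set of states reachable from the empty occupancy state with $r=1$. Stationary distributions. It is established separately that, for each $n$, each of the two Markov chains is irreducible and positive-recurrent, and hence has a unique stationary distribution $\pi_n$. Standing assumptions. $\alpha_n(i)\to\alpha(i)\in(0,1)$ for all $i$. For SLTA also: with $\sigma_*$ the unique element of $\mathcal{I}_+$ such that $\sum_{(i,j)\vartriangleright\sigma_*}\alpha(i)\leq\rho<\sum_{(i,j)\trianglerighteq\sigma_*}\alpha(i)$, the first inequality is strict; and there is $\gamma_0\in(0,1/2)$ with $\lim_n\beta_n=0$ and $\liminf_nn^{\gamma_0}\beta_n>0$. *)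

(* Defs.v *)
From HB Require Import structures.
From mathcomp Require Import all_boot all_order all_algebra.
From mathcomp Require Import all_classical all_reals all_analysis.

Set Implicit Arguments.
Unset Strict Implicit.
Unset Printing Implicit Defensive.

Import Order.TTheory GRing.Theory Num.Theory.
Import numFieldNormedType.Exports.

Local Open Scope classical_set_scope.
Local Open Scope ring_scope.

Section Ell1.
Context (I : choiceType) (R : realType).
Implicit Types f g : I -> R.

Definition ell1_pred : {pred I -> R} :=
  fun f => `[< summable [set: I] (EFin \o f) >].

Definition ell1_sum f : \bar R := (\esum_(i in [set: I]) `|(f i)%:E|)%E.

Lemma ell1_predE f : (f \in ell1_pred) = (ell1_sum f < +oo)%E.
Proof. by apply/asboolP/idP. Qed.

Lemma ell1_sum_ge0 f : (0 <= ell1_sum f)%E.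
Proof. by apply: esum_ge0 => i _; exact: abse_ge0. Qed.

Lemma ell1_sum_fin f : f \in ell1_pred -> ell1_sum f \is a fin_num.
Proof. by rewrite ell1_predE ge0_fin_numE ?ell1_sum_ge0. Qed.

Lemma ell1_sumD f g : (ell1_sum (f + g)%R <= ell1_sum f + ell1_sum g)%E.
Proof.
rewrite /ell1_sum -esumD; [|by move=> *; exact: abse_ge0..].
by apply: le_esum => i _; by rewrite /= -EFinD lee_fin ler_normD.
Qed.

Lemma ell1_sumZ (a : R) f : ell1_sum (a *: f) = (`|a|%:E * ell1_sum f)%E.
Proof.
rewrite /ell1_sum.
rewrite /esum -ereal_supZl ?normr_ge0//; last first.
  apply/set0P; exists 0%E; exists set0; [exact: fsets_set0|].
  by rewrite fsbig_set0.
congr ereal_sup; apply/seteqP; split => [_ [F hF <-]|_ [_ [F hF <-] <-]].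
  exists (\sum_(i \in F) `|(f i)%:E|)%E; first by exists F.
  rewrite ge0_mule_fsumr; last by move=> i; exact: abse_ge0.
  by apply: eq_fsbigr => i _; rewrite /= normrM.
exists F => //; rewrite ge0_mule_fsumr; last by move=> i; exact: abse_ge0.
by apply: eq_fsbigr => i _; rewrite /= normrM.
Qed.

Lemma ell1_submod_closed : submod_closed ell1_pred.
Proof.
split.
  by rewrite ell1_predE /ell1_sum esum1// => i _; rewrite /= normr0.
move=> a f g; rewrite !ell1_predE => f1 g1.
apply: le_lt_trans (ell1_sumD _ _) _; rewrite ell1_sumZ.
by rewrite lte_add_pinfty// lte_mul_pinfty.
Qed.

HB.instance Definition _ :=
  GRing.isSubmodClosed.Build R (I -> R) ell1_pred ell1_submod_closed.

Record ell1 := Ell1 { ell1_val :> I -> R ; ell1_valP : ell1_val \in ell1_pred }.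

HB.instance Definition _ := [isSub for ell1_val].
HB.instance Definition _ := [Choice of ell1 by <:].
HB.instance Definition _ := [SubChoice_isSubLmodule of ell1 by <:].

Definition ell1_norm (x : ell1) : R := fine (ell1_sum x).

Lemma ler_ell1_normD (x y : ell1) :
  ell1_norm (x + y) <= ell1_norm x + ell1_norm y.
Proof.
rewrite /ell1_norm -lee_fin EFinD !fineK ?ell1_sum_fin ?ell1_valP//.
exact: ell1_sumD.
Qed.

Lemma ell1_normZ (a : R) (x : ell1) : ell1_norm (a *: x) = `|a| * ell1_norm x.
Proof.
apply: EFin_inj; rewrite /ell1_norm EFinM !fineK ?ell1_sum_fin ?ell1_valP//.
exact: ell1_sumZ.
Qed.

Lemma ell1_norm0_eq0 (x : ell1) : ell1_norm x = 0 -> x = 0.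
Proof.
move=> x0; apply: val_inj; apply/funext => i /=; apply/eqP.
rewrite -normr_eq0 eq_le normr_ge0 andbT -lee_fin -x0 /ell1_norm.
rewrite fineK ?ell1_sum_fin ?ell1_valP//.
apply: esum_ge; exists [set i]; first by split => //; exact: finite_set1.
by rewrite fsbig_set1.
Qed.

HB.instance Definition _ := Lmodule_isNormed.Build R ell1
  ler_ell1_normD ell1_normZ ell1_norm0_eq0.

Lemma ell1_delta_subproof (i : I) :
  (fun j => (j == i)%:R : R) \in ell1_pred.
Proof.
rewrite ell1_predE /ell1_sum (esumID [set i])//.
rewrite setTI esum_set1// esum1 ?adde0 ?ltry//.
by move=> j [_ /eqP/negPf]/= ->; rewrite normr0.
Qed.

Definition ell1_delta (i : I) : ell1 := Ell1 (ell1_delta_subproof i).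

End Ell1.

HB.instance Definition _ (T U : ptopologicalType) := Pointed.on (T * U)%type.

Section Tightness.
Context (R : realType).

Definition borel (T : ptopologicalType) := g_sigma_algebraType (@open T).

Definition tight (T : ptopologicalType) (J : Type) (D : set J)
    (P : J -> probability (borel T) R) :=
  forall eps : R, 0 < eps -> exists K : set T,
    compact K /\ forall j, D j -> (P j (~` K) <= eps%:E)%E.

End Tightness.

(* Continuous-time Markov chains with (off-diagonal) jump rates [rate x y].
   All exit rates are assumed finite. *)
Section MarkovChain.
Context (R : realType) (T : ptopologicalType) (rate : T -> T -> R).

Inductive reachable (x0 : T) : T -> Prop :=
| reachable_refl : reachable x0 x0
| reachable_step x y : reachable x0 x -> 0 < rate x y -> reachable x0 y.

Variable S : set T.

Definition exit_rate (x : T) : R :=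
  fine (\esum_(y in S `\ x) (rate x y)%:E)%E.

(* Probability that the chain started at [x] makes exactly [k] jumps during
   [0, t] and is at [y] at time [t], computed by conditioning on the time [s]
   of the last jump and on the state [z] just before it. *)
Fixpoint jump_prob (k : nat) (x y : T) (t : R) : \bar R :=
  match k with
  | 0 => ((x == y)%:R * expR (- exit_rate y * t))%:E
  | k.+1 => (\int[lebesgue_measure]_(s in `[0%R, t])
       \esum_(z in S `\ y)
         (jump_prob k x z s *
          (rate z y * expR (- exit_rate y * (t - s)))%:E))%E
  end.

Definition transition (x y : T) (t : R) : \bar R :=
  (\sum_(0 <= k <oo) jump_prob k x y t)%E.

(* The law is a Borel measure carried by the state space [S]. *)
Definition stationary (P : probability (borel T) R) :=
  P S = 1%E /\
  forall t : R, 0 <= t -> forall y, S y ->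
    P [set y] = (\esum_(x in S) (P [set x] * transition x y t))%E.

End MarkovChain.

(* There are [m.+1] server-pool classes. *)
Notation coords m := ('I_m.+1 * nat)%type.

Definition coord_pos m : set (coords m) := [set p | (0 < p.2)%N].
Arguments coord_pos {m}.

Definition below m (p : coords m) : coords m := (p.1, p.2.-1).
Definition above m (p : coords m) : coords m := (p.1, p.2.+1).

Section Ranking.
Context (R : realType) (m : nat) (u : 'I_m.+1 -> R -> R).
Implicit Types p q : coords m.

Definition concave_on_nneg (f : R -> R) :=
  convex_function ([set x | 0 <= x] : set R^o) ((fun x => - f x) : R^o -> R^o).

Definition Delta (i : 'I_m.+1) (j : nat) : R := u i j.+1%:R - u i j%:R.

Definition lex_lt p q : bool :=
  (p.1 < q.1)%N || (p.1 == q.1) && (p.2 < q.2)%N.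

(* The order on [coord_pos]; ties are broken by the reverse of [lex_lt]. *)
Definition rank_lt p q : bool :=
  (Delta p.1 p.2.-1 < Delta q.1 q.2.-1) ||
  (Delta p.1 p.2.-1 == Delta q.1 q.2.-1) && lex_lt q p.

Definition is_largest (C : set (coords m)) p :=
  C p /\ forall q, C q -> q = p \/ rank_lt q p.

(* Junk value of the choices below when there is no suitable coordinate. *)
Let dflt : coords m := (ord0, 1%N).

(* The [k]-th largest coordinate, for [k >= 1]. *)
Definition kth_largest (k : nat) : coords m :=
  xget dflt [set p | coord_pos p /\
    ([set q | coord_pos q /\ rank_lt p q] #= `I_k.-1)%card].

Definition token_level (i : 'I_m.+1) (r : nat) : nat :=
  let L := [set j | j = 0%N \/
    coord_pos (i, j) /\ rank_lt (kth_largest r) (i, j)] in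
  xget 0%N [set j | L j /\ forall j', L j' -> (j' <= j)%N].

Definition jlmu_target (x : ell1 (coords m) R) : coords m :=
  xget dflt (is_largest [set p | coord_pos p /\ x p < x (below p)]).

Definition is_sigma_star (alpha : 'I_m.+1 -> R) (rho : R) (s : coords m) :=
  [/\ coord_pos s,
      (\esum_(p in [set p | coord_pos p /\ rank_lt s p]) (alpha p.1)%:E
         <= rho%:E)%E &
      (rho%:E < \esum_(p in [set p | coord_pos p /\ (p = s \/ rank_lt s p)])
                   (alpha p.1)%:E)%E].

End Ranking.

Section Systems.
Context (R : realType) (m : nat) (u : 'I_m.+1 -> R -> R).
Variables (lam mu : R) (n : nat) (A : 'I_m.+1 -> nat).

Local Notation state := (ell1 (coords m) R).
Implicit Types (x y : state) (p : coords m) (r : nat).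

Definition class_frac (i : 'I_m.+1) : R := (A i)%:R / n%:R.

Definition occupancy_states : set state := [set x | forall i j,
  [/\ n%:R * x (i, j) \is a Num.nat,
      x (i, j.+1) <= x (i, j),
      x (i, j) <= x (i, 0%N) &
      x (i, 0%N) = class_frac i]].

Definition empty_state : state :=
  \sum_i class_frac i *: ell1_delta R ((i, 0%N) : coords m).

Definition add_task x p : state := x + n%:R^-1 *: ell1_delta R p.
Definition remove_task x p : state := x - n%:R^-1 *: ell1_delta R p.

(* At most one [p] contributes to the sum. *)
Definition departure_rate x y : R :=
  \sum_(p \in [set p | coord_pos p /\ y = remove_task x p])
    n%:R * mu * p.2%:R * (x p - x (above p)).

Definition jlmu_rate x y : R :=
  n%:R * lam * (y == add_task x (jlmu_target u x))%:R + departure_rate x y.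

Definition jlmu_states : set state :=
  [set x | occupancy_states x /\ reachable jlmu_rate empty_state x].

(* Number of pools of class [p.1] with exactly [p.2.-1] tasks; it vanishes for
   all but finitely many [p] when [x] is in [occupancy_states], so that
   [pools_in x C] is a true sum even for infinite [C]. *)
Definition pools_at x p : R := n%:R * (x (below p) - x p).
Definition pools_in x (C : set (coords m)) : R := \sum_(p \in C) pools_at x p.

(* A pool of class [i] with exactly [j.-1] tasks is recorded at [(i, j)]; it has
   a green (yellow) token iff [(i, j)] is in [green r] ([yellow r]). *)
Definition green r : set (coords m) :=
  [set p | coord_pos p /\ (p.2.-1 < token_level u p.1 r)%N].

Definition yellow r : set (coords m) :=
  [set p | [/\ coord_pos p, p.1 = (kth_largest u r).1 &
               (p.2.-1 <= token_level u p.1 r)%N]].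

(* The class i_(r-1); it is irrelevant for [r = 1], as [green 1] is empty. *)
Definition prev_class r : 'I_m.+1 := (kth_largest u r.-1).1.

Definition green_in r : set (coords m) := green r `&` [set p | p.1 = prev_class r].
Definition green_out r : set (coords m) := green r `&` [set p | p.1 <> prev_class r].

(* The coordinates of the pools among which the destination is drawn. *)
Definition slta_candidates x r : set (coords m) :=
  if 0 < pools_in x (green_out r) then green_out r
  else if 0 < pools_in x (green r) then green_in r
  else if 0 < pools_in x (yellow r) then yellow r
  else coord_pos.

Definition slta_prob x r p : R :=
  \1_(slta_candidates x r) p * pools_at x p / pools_in x (slta_candidates x r).

Variable beta : R.

Definition slta_next x r : nat :=
  if [&& (1 < r)%N, n%:R * beta <= pools_in x (green r) &
         1 <= pools_in x (green_in r)] then r.-1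
  else if (pools_in x (green r) == 0) && (pools_in x (yellow r) <= 1) then r.+1
  else r.

Definition slta_rate (s t : state * nat) : R :=
  (t.2 == slta_next s.1 s.2)%:R *
    (\sum_(p \in [set p | coord_pos p /\ t.1 = add_task s.1 p])
       n%:R * lam * slta_prob s.1 s.2 p)
  + (t.2 == s.2)%:R * departure_rate s.1 t.1.

Definition slta_states : set (state * nat) :=
  [set s | [/\ occupancy_states s.1, (1 <= s.2)%N &
               reachable slta_rate (empty_state, 1%N) s]].

End Systems.

(* Main.v *)
Require Import Defs.
From HB Require Import structures.
From mathcomp Require Import all_boot all_order all_algebra finmap.
From mathcomp Require Import all_classical all_reals all_analysis.
From mathcomp Require Import measurable_realfun ring lra.
Import Order.TTheory GRing.Theory Num.Theory.
Import numFieldNormedType.Exports.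
Local Open Scope classical_set_scope.
Local Open Scope ring_scope.

(** In a stationary law, the mean of [h] is at most that of [g] whenever some
    Lyapunov function has drift at most [g - h].  Conditioning on the last jump
    in [[0, t]] and letting [t] tend to [0] turns the invariance of the law
    under the transition function into the global balance equations, which
    give this bound.  All estimates are uniform in [n] once the class fractions
    are bounded below by some [c > 0]; each of the remaining finitely many laws
    is carried by a countable set, hence tight by itself.

    The number of tasks [N] behaves as in an infinite-server queue: its mean is
    at most [n rho], and [(N - k)^+] gives geometric tails.  The total mass of
    the coordinates of level at least [J] has mean at most [rho] times the
    probability that an arrival is sent to such a level, so that it remains to
    show that this probability is small when [J] is large.
    - JLMU sends a task to level [j] of a class only if all pools of this class
      have at least [j - 1] tasks, whence [N >= n c (j - 1)].
    - SLTA sends a task beyond level [r] only if there are no tokens; it is then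
      sent to a uniformly random pool, which has at least [J - 1] tasks with
      probability at most [N / (n (J - 1))].  So it suffices that [r] is tight.
      If [r] is large and [N] is not exceptionally large, then there are many
      green tokens, so [r] cannot increase.  Either some of them belong to class
      [i_(r-1)] and the next arrival decreases [r], or this class receives no
      arrivals and its pools, all of them occupied, keep emptying.  The sum of a
      multiple of [(r - r0)^+] and of the mass of the low levels of class
      [i_(r-1)] therefore has negative drift outside an event whose probability
      decays geometrically in [n]. *)

Set Implicit Arguments.
Unset Strict Implicit.
Unset Printing Implicit Defensive.

(** * Countable sums *)

Section EsumExtra.
Context (R : realType).
Local Open Scope ereal_scope.

Lemma esumZl (T : choiceType) (D : set T) (c : R) (a : T -> \bar R) :
  (0 <= c)%R -> (forall i, D i -> 0 <= a i) ->
  \esum_(i in D) (c%:E * a i) = c%:E * \esum_(i in D) a i.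
Proof.
move=> c0 a0; rewrite /esum -ereal_supZl//; last first.
  by apply/set0P; exists 0; exists set0; [exact: fsets_set0|rewrite fsbig_set0].
have aux F : fsets D F ->
    \sum_(i \in F) (c%:E * a i) = c%:E * \sum_(i \in F) a i.
  move=> [finF FD]; rewrite !fsbig_finite//= big_seq [in RHS]big_seq.
  by rewrite ge0_sume_distrr// => i; rewrite in_fset_set// inE => /FD/a0.
congr ereal_sup; apply/seteqP; split => [_ [F hF <-]|_ [_ [F hF <-] <-]].
  by exists (\sum_(i \in F) a i); [exists F|rewrite aux].
by exists F => //; rewrite aux.
Qed.

Lemma exchange_esum (T U : choiceType) (D : set T) (E : set U)
    (a : T -> U -> \bar R) :
  (forall i j, D i -> E j -> 0 <= a i j) ->
  \esum_(i in D) \esum_(j in E) a i j = \esum_(j in E) \esum_(i in D) a i j.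
Proof.
move=> a0; rewrite !esum_esum//; last by move=> i j Ei Dj; exact: a0.
rewrite (reindex_esum (E `*`` (fun=> D)) _ (fun x => (x.2, x.1)))//; split=> //=.
- by move=> [i j] [/=].
- by move=> [i1 i2] [j1 j2] /= _ _ [] -> ->.
- by move=> [i1 i2] [Pi1 Qi2] /=; exists (i2, i1).
Qed.

(** Moves the exclusion of the diagonal from the range, which varies with the outer index, into the
    summand, so that two sums can be exchanged. *)
Lemma esum_setD1 (T : choiceType) (D : set T) (z : T) (a : T -> \bar R) :
  \esum_(i in D `\ z) a i = \esum_(i in D) (if i == z then 0 else a i).
Proof.
rewrite setDE esum_mkcondr; apply: eq_esum => i _.
by rewrite in_setC classical_sets.in_set1; case: eqP.
Qed.

Lemma exchange_esum_offdiag (T : choiceType) (D : set T) (a : T -> T -> \bar R) :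
  (forall i j, D i -> D j -> 0 <= a i j) ->
  \esum_(i in D) \esum_(j in D `\ i) a i j =
  \esum_(j in D) \esum_(i in D `\ j) a i j.
Proof.
move=> a0; under eq_esum do rewrite esum_setD1.
rewrite exchange_esum; last by move=> i j Di Dj; case: ifP => // _; exact: a0.
by apply: eq_esum => j Dj; rewrite esum_setD1; apply: eq_esum => i Di; rewrite eq_sym.
Qed.

Lemma esum_nneseries (T : choiceType) (D : set T) (a : T -> nat -> \bar R) :
  (forall i k, D i -> 0 <= a i k) ->
  \esum_(i in D) \sum_(0 <= k <oo) a i k =
  \sum_(0 <= k <oo) \esum_(i in D) a i k.
Proof.
move=> a0; rewrite nneseries_esumT; last by move=> k; apply: esum_ge0 => i /a0.
rewrite exchange_esum; last by move=> k i _ /a0.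
by apply: eq_esum => i Di; rewrite nneseries_esumT// => k; exact: a0.
Qed.

(* A countable sum is a series, which gives access to the measurability and
   monotone convergence results for series. *)
Lemma countable_esum_series (T : pointedType) (D : set T) : countable D ->
  exists (e : nat -> T) (Q : pred nat), (forall k, Q k -> D (e k)) /\
    forall a : T -> \bar R, (forall i, D i -> 0 <= a i) ->
      \esum_(i in D) a i = \sum_(0 <= k <oo) (if Q k then a (e k) else 0).
Proof.
move=> /countable_injP[f injf].
pose e := pinv D f; pose Q := [pred k | k \in f @` D].
have eK : {in D, cancel f e} by exact: pinvKV.
have QD k : Q k -> D (e k).
  by rewrite /Q/= inE => -[x Dx <-]; rewrite eK// inE.
exists e, Q; split=> // a a0.
rewrite (reindex_esum [set k | Q k] D e).
  rewrite -nneseries_esum; last by move=> k /QD/a0.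
  by rewrite eseries_mkcond.
split=> [k /QD//| |x Dx].
  move=> i j; rewrite /Q !inE/= => /set_mem[x Dx <-] /set_mem[y Dy <-].
  by rewrite !eK ?inE// => ->.
by exists (f x); [rewrite /Q/= inE; exists x|rewrite eK// inE].
Qed.

Lemma ge0_emeasurable_esum d (X : measurableType d) (T : pointedType)
    (D : set T) (A : set X) (h : T -> X -> \bar R) : countable D ->
  (forall i x, D i -> A x -> 0 <= h i x) ->
  (forall i, D i -> measurable_fun A (h i)) ->
  measurable_fun A (fun x => \esum_(i in D) h i x).
Proof.
move=> /countable_esum_series[e [Q [QD eE]]] h0 mh.
apply: (eq_measurable_fun
  (fun x => \sum_(0 <= k <oo | k \in xpredT) (if Q k then h (e k) x else 0))).
  by move=> x /set_mem Ax; rewrite [RHS]eE// => i Di; exact: h0.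
apply: ge0_emeasurable_sum => [k x Ax _|k _].
  by case: ifP => // /QD De; exact: h0.
by case: (boolP (Q k)) => [/QD/mh//|_]; exact: measurable_cst.
Qed.

Lemma ge0_integral_esum d (X : measurableType d) (mu : {measure set X -> \bar R})
    (T : pointedType) (D : set T) (A : set X) (h : T -> X -> \bar R) :
  measurable A -> countable D ->
  (forall i x, D i -> A x -> 0 <= h i x) ->
  (forall i, D i -> measurable_fun A (h i)) ->
  \int[mu]_(x in A) (\esum_(i in D) h i x) = \esum_(i in D) \int[mu]_(x in A) h i x.
Proof.
move=> mA /countable_esum_series[e [Q [QD eE]]] h0 mh.
rewrite [RHS]eE; last by move=> i Di; apply: integral_ge0 => x Ax; exact: h0.
transitivity (\int[mu]_(x in A) (\sum_(0 <= k <oo) (if Q k then h (e k) x else 0))).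
  by apply: eq_integral => x /set_mem Ax; rewrite eE// => i Di; exact: h0.
rewrite integral_nneseries//.
- by apply: eq_eseriesr => k _; case: ifP => // _; exact: integral0.
- by move=> k; case: (boolP (Q k)) => [/QD/mh//|_]; exact: measurable_cst.
- by move=> k x Ax; case: ifP => // /QD De; exact: h0.
Qed.

End EsumExtra.

(** * Global balance *)

Section JumpProb.
Context (R : realType) (T : ptopologicalType) (rate : T -> T -> R) (S : set T).
Hypothesis S_countable : countable S.
Hypothesis rate_ge0 : forall z y, S z -> S y -> 0 <= rate z y.
Local Open Scope ereal_scope.

Lemma jump_prob_ge0 k x y t : S y -> 0 <= jump_prob rate S k x y t.
Proof.
elim: k y t => [|k IH] y t Sy /=.
  by rewrite lee_fin mulr_ge0// expR_ge0.
apply: integral_ge0 => s _; apply: esum_ge0 => z [Sz _].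
by rewrite mule_ge0 ?IH// lee_fin mulr_ge0 ?rate_ge0 ?expR_ge0.
Qed.

(** The time is both the upper limit of the integral and a parameter of the integrand. Cutting a
    function of two variables off outside the triangle [0 <= s <= t] turns the integral into a full
    section, measurable by Tonelli. *)
Lemma measurable_jump_prob k x y : S y ->
  measurable_fun [set: R] (jump_prob rate S k x y).
Proof.
elim: k y => [|k IH] y Sy /=.
  apply/measurable_EFinP; apply: measurable_funM => //.
  apply: measurableT_comp => //; exact: measurable_funM.
pose h z := fun p : R * R => jump_prob rate S k x z p.2 *
  (rate z y * expR (- exit_rate rate S y * (p.1 - p.2)))%:E.
pose B := [set p : R * R | (0 <= p.2 <= p.1)%R].
have mB : measurable B.
  rewrite (_ : B = [set p | 0 <= p.2]%R `&` [set p | p.2 <= p.1]%R); last first.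
    by apply/seteqP; split=> p /=; [move=> /andP|move=> H; apply/andP].
  apply: measurableI.
    rewrite -[X in measurable X]setTI.
    by apply: measurable_fun_le => //; exact: measurable_snd.
  rewrite -[X in measurable X]setTI.
  by apply: measurable_fun_le.
have mh z : S z -> measurable_fun setT (h z).
  move=> Sz; apply: emeasurable_funM.
    by apply: measurableT_comp; [exact: IH|exact: measurable_snd].
  apply/measurable_EFinP; apply: measurable_funM => //.
  apply: measurableT_comp => //; apply: measurable_funM => //.
  by apply: measurable_funB => //; exact: measurable_snd.
have h0 z p : S z -> 0 <= h z p.
  move=> Sz; rewrite /h mule_ge0 ?jump_prob_ge0// lee_fin.
  by rewrite mulr_ge0 ?expR_ge0 ?rate_ge0.
pose H : R * R -> \bar R := (fun p => \esum_(z in S `\ y) h z p) \_ B.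
rewrite [X in measurable_fun _ X](_ : _ =
    fubini_F (@lebesgue_measure R) H); last first.
  apply/funext => t; rewrite /fubini_F [LHS]integral_mkcond.
  apply: eq_integral => s _; rewrite /H !patchE.
  have -> // : (s \in [set` `[0%R, t]%R]) = ((t, s) \in B).
  by apply/idP/idP; rewrite !inE /B/= ?in_itv.
apply: measurable_fun_fubini_tonelli_F => [|p].
  apply/(measurable_restrictT _ _).1 => //.
  apply: measurable_funTS.
  apply: ge0_emeasurable_esum.
  - exact: (sub_countable (subset_card_le (@subDsetl _ _ _))).
  - by move=> z p [Sz _] _; exact: h0.
  - by move=> z [Sz _]; exact: mh.
rewrite /H patchE; case: ifPn => // _.
by apply: esum_ge0 => z [Sz _]; exact: h0.
Qed.

Variable pi : T -> R.
Hypothesis pi_ge0 : forall x, (0 <= pi x)%R.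

(** For the chain started from [pi]: the mass at [y] at time [t] after exactly [k] jumps. *)
Let occ k y t := \esum_(x in S) ((pi x)%:E * jump_prob rate S k x y t).

Let occ_ge0 k y t : S y -> 0 <= occ k y t.
Proof.
by move=> Sy; apply: esum_ge0 => x _; rewrite mule_ge0 ?lee_fin// jump_prob_ge0.
Qed.

Let measurable_occ k y : S y -> measurable_fun [set: R] (occ k y).
Proof.
move=> Sy; apply: ge0_emeasurable_esum => // [x t _ _|x _].
  by rewrite mule_ge0 ?lee_fin// jump_prob_ge0.
by apply: measurable_funeM; exact: measurable_jump_prob.
Qed.

Let decay y t s : R := expR (- exit_rate rate S y * (t - s)).

Let measurable_decay y t : measurable_fun [set: R] (decay y t).
Proof.
by apply: measurableT_comp => //; apply: measurable_funM => //; exact: measurable_funB.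
Qed.

Let countableD1 y : countable (S `\ y).
Proof. exact: (sub_countable (subset_card_le (@subDsetl _ _ _))). Qed.

(** The last-jump recursion is linear in the initial law, so by Tonelli it passes to [occ]. *)
Let occS k y t : S y -> occ k.+1 y t =
  \int[lebesgue_measure]_(s in `[0%R, t])
    (\esum_(z in S `\ y) (occ k z s * (rate z y * decay y t s)%:E)).
Proof.
move=> Sy; rewrite /occ /=.
have m1 x z : S z -> measurable_fun `[0%R, t] (fun s =>
    jump_prob rate S k x z s * (rate z y * decay y t s)%:E).
  move=> Sz; apply: measurable_funTS; apply: emeasurable_funM.
    exact: measurable_jump_prob.
  by apply/measurable_EFinP; exact: measurable_funM.
have p1 x z s : S z -> 0 <= jump_prob rate S k x z s * (rate z y * decay y t s)%:E.
  move=> Sz; rewrite mule_ge0 ?jump_prob_ge0// lee_fin.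
  by rewrite mulr_ge0 ?expR_ge0 ?rate_ge0.
have mz x : measurable_fun `[0%R, t] (fun s => \esum_(z in S `\ y)
    (jump_prob rate S k x z s * (rate z y * decay y t s)%:E)).
  apply: ge0_emeasurable_esum => //; first by move=> z s [Sz _] _; exact: p1.
  by move=> z [Sz _]; exact: m1.
transitivity (\esum_(x in S) \int[lebesgue_measure]_(s in `[0%R, t])
    ((pi x)%:E * \esum_(z in S `\ y)
       (jump_prob rate S k x z s * (rate z y * decay y t s)%:E))).
  apply: eq_esum => x Sx; rewrite ge0_integralZl//.
  - exact: mz.
  - by move=> s _; apply: esum_ge0 => z [Sz _]; exact: p1.
  - by rewrite lee_fin.
transitivity (\int[lebesgue_measure]_(s in `[0%R, t])
    (\esum_(x in S) ((pi x)%:E * \esum_(z in S `\ y)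
       (jump_prob rate S k x z s * (rate z y * decay y t s)%:E)))).
  apply/esym/ge0_integral_esum => //.
    move=> x s _ _; rewrite mule_ge0 ?lee_fin//.
    by apply: esum_ge0 => z [Sz _]; exact: p1.
  by move=> x Sx; apply: measurable_funeM; exact: mz.
apply: eq_integral => s _.
transitivity (\esum_(x in S) \esum_(z in S `\ y) ((pi x)%:E *
    (jump_prob rate S k x z s * (rate z y * decay y t s)%:E))).
  by apply: eq_esum => x _; rewrite esumZl// => z [Sz _]; exact: p1.
rewrite exchange_esum; last first.
  by move=> x z _ [Sz _]; rewrite mule_ge0 ?lee_fin ?p1.
apply: eq_esum => z [Sz _]; rewrite muleC -esumZl.
- by apply: eq_esum => x _; rewrite muleA muleC.
- by rewrite mulr_ge0 ?expR_ge0 ?rate_ge0.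
- by move=> x _; rewrite mule_ge0 ?jump_prob_ge0 ?lee_fin.
Qed.

Lemma esum_single (D : set T) (y : T) (a : T -> \bar R) : D y -> 0 <= a y ->
  (forall i, D i -> i != y -> a i = 0) -> \esum_(i in D) a i = a y.
Proof.
move=> Dy ay0 a0; rewrite (esumID [set y]); last first.
  by move=> i Di; have [->//|iy] := eqVneq i y; rewrite a0.
rewrite [X in _ + X]esum1 ?adde0; last by move=> i [Di /eqP]; exact: a0.
by rewrite (_ : D `&` [set y] = [set y]) ?esum_set1//; apply/setIidPr => _ ->.
Qed.

Hypothesis pi_invariant : forall t : R, (0 <= t)%R -> forall y, S y ->
  (pi y)%:E = \esum_(x in S) ((pi x)%:E * transition rate S x y t).

Let occ_sum y (t : R) : S y -> (0 <= t)%R -> \sum_(0 <= k <oo) occ k y t = (pi y)%:E.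
Proof.
move=> Sy t0; rewrite [RHS](pi_invariant t0 Sy) -esum_nneseries; last first.
  by move=> x k _; rewrite mule_ge0 ?lee_fin ?jump_prob_ge0.
apply: eq_esum => x _; rewrite /transition nneseriesZl// => k _.
exact: jump_prob_ge0.
Qed.

Let inflow y := \esum_(z in S `\ y) (pi z * rate z y)%:E.

Let inflow_ge0 y : S y -> 0 <= inflow y.
Proof. by move=> Sy; apply: esum_ge0 => z [Sz _]; rewrite lee_fin mulr_ge0 ?rate_ge0. Qed.

(** The term [k = 0] accounts for no jump in [[0, t]]. In the others, summing over [k] inside the
    integral leaves the law of the chain just before the last jump, which is again [pi] by
    invariance; the inflow therefore does not depend on [s]. *)
Lemma invariant_last_jump y (t : R) : S y -> (0 <= t)%R ->
  (pi y)%:E = (pi y * expR (- exit_rate rate S y * t))%:E +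
    \int[lebesgue_measure]_(s in `[0%R, t]) (inflow y * (decay y t s)%:E).
Proof.
move=> Sy t0; rewrite -[LHS](occ_sum Sy t0) nneseries_recl//; last first.
  by move=> k _; exact: occ_ge0.
congr (_ + _).
  rewrite /occ /= (@esum_single _ y)//; first by rewrite eqxx mul1r -EFinM.
  - by rewrite mule_ge0 ?lee_fin// mulr_ge0 ?expR_ge0.
  - by move=> x _ /negPf ->; rewrite mul0r mule0.
have p1 k z s : S z -> 0 <= occ k z s * (rate z y * decay y t s)%:E.
  move=> Sz; rewrite mule_ge0 ?occ_ge0// lee_fin.
  by rewrite mulr_ge0 ?expR_ge0 ?rate_ge0.
transitivity (\sum_(0 <= k <oo) \int[lebesgue_measure]_(s in `[0%R, t])
    (\esum_(z in S `\ y) (occ k z s * (rate z y * decay y t s)%:E))).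
  rewrite -(@nneseries_addn _ (fun k => occ k y t) 1)//.
    by apply: eq_eseriesr => k _; rewrite addn1 occS.
  by move=> k; exact: occ_ge0.
rewrite -integral_nneseries//; last 2 first.
- move=> k; apply: ge0_emeasurable_esum => //.
    by move=> z s [Sz _] _; exact: p1.
  move=> z [Sz _]; apply: measurable_funTS; apply: emeasurable_funM.
    exact: measurable_occ.
  by apply/measurable_EFinP; apply: measurable_funM => //; exact: measurable_decay.
- by move=> k s _; apply: esum_ge0 => z [Sz _]; exact: p1.
apply: eq_integral => s /set_mem/=; rewrite in_itv/= => /andP[s0 st].
rewrite -esum_nneseries; last by move=> z k [Sz _]; exact: p1.
rewrite [RHS]muleC -esumZl ?expR_ge0//; last first.
  by move=> z [Sz _]; rewrite lee_fin mulr_ge0 ?rate_ge0.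
apply: eq_esum => z [Sz _].
rewrite [in RHS]EFinM -(occ_sum Sz s0) muleC -muleA -EFinM.
rewrite muleC -nneseriesZl; last by move=> k _; exact: occ_ge0.
by apply: eq_eseriesr => k _; rewrite muleC.
Qed.

Let exit_ge0 y : S y -> (0 <= exit_rate rate S y)%R.
Proof.
by move=> Sy; apply: fine_ge0; apply: esum_ge0 => z [Sz _]; rewrite lee_fin rate_ge0.
Qed.

(** The limit [t -> 0] in elementary form, through [a * expR (- q * t) >= a * (1 - q * t)]. *)
Let le_of_expR (a b q : R) : (0 <= a)%R -> (0 <= q)%R ->
  (forall t : R, (0 < t)%R -> (a * expR (- q * t) <= b)%R) -> (a <= b)%R.
Proof.
move=> a0 q0 H; rewrite leNgt; apply/negP => ba.
have [b0|b0] := ltP b 0%R.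
  have := H 1%R ltr01; rewrite leNgt => /negP; apply.
  by rewrite (lt_le_trans b0)// mulr_ge0// expR_ge0.
have agt0 : (0 < a)%R by exact: le_lt_trans ba.
(* This [t] makes [a * q * t] less than half of [a - b]. *)
pose t := ((a - b) / (2 * a * (q + 1)))%R.
have d0 : (0 < 2 * a * (q + 1))%R by rewrite !mulr_gt0// ltr_wpDl.
have t0 : (0 < t)%R by rewrite divr_gt0// subr_gt0.
have := H _ t0; apply/negP; rewrite -ltNge.
apply: (@lt_le_trans _ _ (a * (1 + - q * t))%R); last first.
  by rewrite ler_wpM2l// expR_ge1Dx.
have tE : (t * (2 * a * (q + 1)) = a - b)%R by rewrite divfK// gt_eqF.
suff : (a * q * t < a - b)%R by nra.
rewrite -tE; nra.
Qed.

(** The last-jump identity reads [pi y * (1 - expR (- q * t)) = inflow y * I t] with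
    [t * expR (- q * t) <= I t <= t]; dividing by [t] and letting [t] tend to 0 gives the
    balance. *)
Lemma global_balance y : S y ->
  (pi y * exit_rate rate S y)%:E = \esum_(z in S `\ y) (pi z * rate z y)%:E.
Proof.
move=> Sy; set q := exit_rate rate S y; have q0 : (0 <= q)%R := exit_ge0 Sy.
pose I t := \int[lebesgue_measure]_(s in `[0%R, t]) (decay y t s)%:E.
have mI (t : R) : measurable_fun `[0%R, t] (fun s => (decay y t s)%:E).
  by apply: measurable_funTS; apply/measurable_EFinP; exact: measurable_decay.
have len (t : R) : (0 <= t)%R -> lebesgue_measure (`[0%R, t] : set R) = t%:E.
  by move=> t0; rewrite lebesgue_measure_itv/= lte_fin; case: ltgtP t0 => //= [|<-//]; rewrite oppr0 adde0.
have ci (c t : R) : (0 <= t)%R ->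
    \int[lebesgue_measure]_(s in `[0%R, t]) (cst c%:E s) = (c * t)%:E.
  by move=> t0; rewrite integral_cst// EFinM; congr (_ * _); exact: len.
have I1 (t : R) : (0 <= t)%R -> I t <= t%:E.
  move=> t0; apply: (@le_trans _ _ (\int[lebesgue_measure]_(s in `[0%R, t]) (cst 1%:E s))).
    apply: ge0_le_integral => //.
    - by move=> s _; rewrite lee_fin expR_ge0.
    - exact: mI.
    - move=> s /=; rewrite in_itv/= => /andP[s0 st]; rewrite lee_fin -expR0.
      by rewrite ler_expR mulNr oppr_le0 mulr_ge0// subr_ge0.
  by rewrite ci// mul1r.
have I2 (t : R) : (0 <= t)%R -> (t * expR (- q * t))%:E <= I t.
  move=> t0; apply: (@le_trans _ _ (\int[lebesgue_measure]_(s in `[0%R, t]) (cst (expR (- q * t))%:E s))).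
    by rewrite ci// mulrC.
  apply: ge0_le_integral => //.
  - by move=> s _; rewrite lee_fin expR_ge0.
  - exact: mI.
  - move=> s /=; rewrite in_itv/= => /andP[s0 st]; rewrite lee_fin ler_expR -/q.
    by rewrite !mulNr lerN2 ler_wpM2l// gerBl.
have key (t : R) : (0 <= t)%R -> (pi y)%:E = (pi y * expR (- q * t))%:E + inflow y * I t.
  move=> t0; rewrite [LHS](invariant_last_jump Sy t0); congr (_ + _).
  rewrite ge0_integralZl//; first exact: mI.
    by move=> s _; rewrite lee_fin expR_ge0.
  exact: inflow_ge0.
(* An infinite inflow would make the identity at [t = 1] infinite, as [I 1 > 0]. *)
have Fi : inflow y \is a fin_num.
  rewrite ge0_fin_numE ?inflow_ge0// ltNge leye_eq; apply/negP => /eqP Foo.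
  have := key 1%R ler01; rewrite Foo gt0_mulye//.
  by apply: lt_le_trans (I2 _ ler01); rewrite lte_fin mul1r expR_gt0.
rewrite -/(inflow y) -(fineK Fi); set f := fine _; congr (_%:E).
have f0 : (0 <= f)%R by apply/fine_ge0/inflow_ge0.
have Ifin (t : R) : (0 <= t)%R -> I t \is a fin_num.
  move=> t0; rewrite ge0_fin_numE; last by apply: integral_ge0 => s _; rewrite lee_fin expR_ge0.
  by apply: le_lt_trans (I1 _ t0) _; rewrite ltry.
have key2 (t : R) : (0 <= t)%R -> exists J : R, [/\ (pi y * (1 - expR (- q * t)) = f * J)%R,
    (J <= t)%R & (t * expR (- q * t) <= J)%R].
  move=> t0; exists (fine (I t)); split; last 2 first.
  - by rewrite -lee_fin fineK ?Ifin ?I1.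
  - by rewrite -lee_fin fineK ?Ifin ?I2.
  have := key t t0; rewrite -(fineK Fi) -/f -(fineK (Ifin t t0)) -EFinM -EFinD.
  by move=> H; have E := EFin_inj H; lra.
(* The first inequality combines [J <= t] with [expR (- q * t) * (1 + q * t) <= 1], the second
   [J >= t * expR (- q * t)] with [1 - expR (- q * t) <= q * t]. *)
apply/eqP; rewrite eq_le; apply/andP; split.
  apply: (@le_of_expR _ _ q) => //; first by rewrite mulr_ge0.
  move=> t t0; have [J [E Jt _]] := key2 t (ltW t0).
  rewrite -(ler_pM2r t0) (le_trans _ (ler_wpM2l f0 Jt))// -E -!mulrA.
  rewrite ler_wpM2l// mulNr expRN; set e := expR _.
  have := expR_ge1Dx (q * t)%R; rewrite -/e => e1.
  have e0 : (0 < e^-1)%R by rewrite invr_gt0 expR_gt0.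
  have : (e^-1 * e = 1)%R by rewrite mulVf// gt_eqF// expR_gt0.
  nra.
apply: (@le_of_expR _ _ q) => // t t0; have [J [E _ tJ]] := key2 t (ltW t0).
rewrite -(ler_pM2r t0) -mulrA [(expR _ * t)%R]mulrC (le_trans (ler_wpM2l f0 tJ))//.
rewrite -E -mulrA ler_wpM2l// lerBlDr -lerBlDl.
have := expR_ge1Dx (- q * t)%R; lra.
Qed.

End JumpProb.

(** * Drift inequalities *)

Section Drift.
Context (R : realType) (T : ptopologicalType) (rate : T -> T -> R) (S : set T).
Implicit Types (f g h : T -> R) (s : seq (R * T)) (y z : T).

(* [s] lists the jumps out of [z] with their rates; a target may be repeated. *)
Definition jumps z s :=
  (forall y, S y -> y != z -> rate z y = \sum_(e <- s) e.1 * (e.2 == y)%:R) /\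
  (forall e, e \in s -> 0 <= e.1 /\ (0 < e.1 -> S e.2 /\ e.2 != z)).

(** Entries of rate 0 may have a target equal to [z] or outside [S]; they contribute to neither
    side. *)
Lemma jumps_esum z s f : jumps z s -> (forall y, S y -> 0 <= f y) ->
  (\esum_(y in S `\ z) (rate z y * f y)%:E = (\sum_(e <- s) e.1 * f e.2)%:E)%E.
Proof.
move=> [E H] f0.
transitivity (\esum_(y in S `\ z) \sum_(e <- s | e \in s)
    (e.1 * (e.2 == y)%:R * f y)%:E)%E.
  apply: eq_esum => y [Sy /eqP yz]; rewrite -big_seq E// mulr_suml sumEFin.
  by [].
rewrite esum_sum; last first.
  by move=> y e [Sy _] /H[e0 _]; rewrite lee_fin !mulr_ge0// f0.
rewrite -sumEFin [RHS]big_seq; apply: eq_bigr => e es; have [e0 eS] := H _ es.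
have [e00|eN0] := eqVneq e.1 0.
  by rewrite e00 mul0r esum1// => y _; rewrite !mul0r.
have [Se ez] : S e.2 /\ e.2 != z by apply: eS; rewrite lt_neqAle eq_sym eN0.
rewrite (@esum_single _ _ _ e.2); first by rewrite eqxx mulr1.
- by split=> //; exact/eqP.
- by rewrite eqxx mulr1 lee_fin mulr_ge0// f0.
- by move=> y _ ye; rewrite eq_sym (negPf ye) mulr0 mul0r.
Qed.

Lemma jumps_exit z s : jumps z s -> exit_rate rate S z = \sum_(e <- s) e.1.
Proof.
move=> Hs; have := @jumps_esum z s (cst 1) Hs (fun _ _ => ler01).
rewrite /exit_rate.
under eq_esum do rewrite mulr1.
by move=> ->; apply: eq_bigr => e _; rewrite mulr1.
Qed.

Hypothesis rate_ge0 : forall z y, S z -> S y -> 0 <= rate z y.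
Variable pi : T -> R.
Hypothesis pi_ge0 : forall x, 0 <= pi x.

Definition mean f : \bar R := (\esum_(z in S) (pi z * f z)%:E)%E.

Lemma mean_ge0 f : (forall z, S z -> 0 <= f z) -> (0 <= mean f)%E.
Proof. by move=> f0; apply: esum_ge0 => z Sz; rewrite lee_fin mulr_ge0// f0. Qed.

Lemma le_mean f g : (forall z, S z -> f z <= g z) -> (mean f <= mean g)%E.
Proof. by move=> fg; apply: le_esum => z Sz; rewrite lee_fin ler_wpM2l// fg. Qed.

Lemma meanD f g : (forall z, S z -> 0 <= f z) -> (forall z, S z -> 0 <= g z) ->
  mean (fun z => f z + g z) = (mean f + mean g)%E.
Proof.
move=> f0 g0; rewrite /mean -esumD; last 2 first.
- by move=> z Sz; rewrite lee_fin mulr_ge0// f0.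
- by move=> z Sz; rewrite lee_fin mulr_ge0// g0.
by apply: eq_esum => z _; rewrite -EFinD mulrDr.
Qed.

Lemma meanZ (c : R) f : 0 <= c -> (forall z, S z -> 0 <= f z) ->
  mean (fun z => c * f z) = (c%:E * mean f)%E.
Proof.
move=> c0 f0; rewrite /mean -esumZl//; last first.
  by move=> z Sz; rewrite lee_fin mulr_ge0// f0.
by apply: eq_esum => z _; rewrite -EFinM mulrCA.
Qed.

Hypothesis balance : forall y, S y ->
  ((pi y * exit_rate rate S y)%:E = \esum_(z in S `\ y) (pi z * rate z y)%:E)%E.
Hypothesis has_jumps : forall z, S z -> exists s, jumps z s.

Lemma exit_rate_ge0 z : S z -> 0 <= exit_rate rate S z.
Proof.
move=> /has_jumps[s Hs]; rewrite (jumps_exit Hs) big_seq; apply: sumr_ge0 => e.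
by move=> /(Hs.2 e)[].
Qed.

(* Stationarity of the truncations [(k - f)^+], whose mean outflow is finite. *)
Lemma stationary_drift f g h :
  (forall z, S z -> [/\ 0 <= f z, 0 <= g z & 0 <= h z]) ->
  (forall z, S z -> exists s, jumps z s /\
     \sum_(e <- s) e.1 * (f e.2 - f z) + h z <= g z) ->
  (forall k : R, mean (fun z => exit_rate rate S z * Num.max 0 (k - f z))%R < +oo)%E ->
  (mean h <= mean g)%E.
Proof.
move=> fgh drift fin_exit.
have f0 z : S z -> 0 <= f z by case/fgh.
have g0 z : S z -> 0 <= g z by case/fgh.
have h0 z : S z -> 0 <= h z by case/fgh.
pose phi k z := Num.max 0 (k - f z).
have phi0 k z : 0 <= phi k z by rewrite /phi le_max lexx.
(* [h] is cut off where [f > k], since [phi k] vanishes there and carries no information on the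
   drift. *)
pose hk (k : R) z := h z * (f z <= k)%R%:R.
have hk0 k z : S z -> 0 <= hk k z by move=> Sz; rewrite mulr_ge0// h0.
(* Balance applied to [phi k]: its mean carried away by the jumps equals its mean brought in by
   them. *)
have out (k : R) : mean (fun z => exit_rate rate S z * phi k z) =
    (\esum_(z in S) (pi z)%:E * \esum_(y in S `\ z) (rate z y * phi k y)%:E)%E.
  transitivity (\esum_(z in S) \esum_(y in S `\ z) (pi z * rate z y * phi k y)%:E)%E; last first.
    apply: eq_esum => z Sz; have [s Hs] := has_jumps Sz.
    rewrite -esumZl//.
      by apply: eq_esum => y _; rewrite -EFinM mulrA.
    by move=> y [Sy _]; rewrite lee_fin mulr_ge0// rate_ge0.
  rewrite exchange_esum_offdiag; last first.
    by move=> z y Sz Sy; rewrite lee_fin !mulr_ge0// rate_ge0.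
  apply: eq_esum => y Sy; rewrite mulrA EFinM balance// muleC -esumZl//; last first.
    by move=> z [Sz _]; rewrite lee_fin mulr_ge0// rate_ge0.
  by apply: eq_esum => z _; rewrite -EFinM mulrC.
have trunc (k : R) : (mean (hk k) <= mean g)%E.
  have fe := fin_exit k; rewrite -/(phi k) in fe.
  have e0 : (0 <= mean (fun z => exit_rate rate S z * phi k z)%R)%E.
    by apply: mean_ge0 => z Sz; rewrite mulr_ge0// exit_rate_ge0.
  (* The mean outflow is finite, so it can be added on both sides; once [out] has rewritten the
     right one, the claim holds pointwise in [z]. *)
  rewrite -(@leeD2rE _ (mean (fun z => exit_rate rate S z * phi k z))); last first.
    by rewrite ge0_fin_numE.
  rewrite -meanD; last 2 first.
  - exact: hk0.
  - by move=> z Sz; rewrite mulr_ge0// exit_rate_ge0.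
  rewrite [X in (_ <= _ + X)%E]out -esumD; last 2 first.
  - by move=> z Sz; rewrite lee_fin mulr_ge0// g0.
  - move=> z Sz; rewrite mule_ge0 ?lee_fin//; have [s Hs] := has_jumps Sz.
    by rewrite (jumps_esum Hs)// lee_fin big_seq sumr_ge0// => e /(Hs.2 e)[? _]; rewrite mulr_ge0.
  apply: le_esum => z Sz; have [s [Hs ds]] := drift _ Sz.
  rewrite (jumps_esum Hs)// -EFinM -EFinD lee_fin -mulrDr ler_wpM2l//.
  rewrite (jumps_exit Hs) /hk; have [fk|kf] := leP (f z) k; last first.
    have -> : phi k z = 0 by rewrite /phi max_l// subr_le0 ltW.
    rewrite !mulr0 addr0 addr_ge0 ?g0//.
    by rewrite big_seq sumr_ge0// => e /(Hs.2 e)[? _]; rewrite mulr_ge0.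
  have : (\sum_(e <- s) e.1) * (k - f z) - \sum_(e <- s) e.1 * (f e.2 - f z) <=
      \sum_(e <- s) e.1 * phi k e.2.
    rewrite mulr_suml -sumrB big_seq [leRHS]big_seq; apply: ler_sum => e es.
    have [ege0 _] := Hs.2 e es; rewrite -mulrBr ler_wpM2l// /phi le_max.
    by apply/orP; right; lra.
  have -> : phi k z = k - f z by rewrite /phi max_r// subr_ge0.
  by rewrite mulr1; lra.
(* A finite subset of [S] lies in some [f <= k], where [hk k] is [h]; hence the truncated bounds
   cover all finite sums. *)
rewrite {1}/mean; apply: ge_ereal_sup => _ [F [finF FS] <-].
have [k Hk] : exists k : R, forall z, F z -> f z <= k.
  exists (\sum_(z \in F) f z) => z Fz.
  rewrite (fsbigD1 z)//= lerDl fsumr_ge0// => x [/FS Sx _]; exact: f0.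
apply: (@le_trans _ _ (mean (hk k))) => //; apply: esum_ge; exists F => //.
by apply: lee_fsum => // z Fz; rewrite /hk Hk// mulr1.
Qed.

End Drift.

(** * Occupancy states *)

Section Box.
Context (m : nat).
Implicit Types (p : coords m) (L : nat).

Definition box L : seq (coords m) :=
  [seq (i, j) | i <- enum 'I_m.+1, j <- iota 1 L].

Lemma box_uniq L : uniq (box L).
Proof.
by apply: allpairs_uniq; rewrite ?enum_uniq ?iota_uniq// => -[? ?] [? ?] _ _ [-> ->].
Qed.

Lemma mem_box L p : (p \in box L) = (0 < p.2 <= L)%N.
Proof.
apply/allpairsP/idP => [[q [_ +] ->/=]|Hp]; first by rewrite mem_iota add1n.
by exists p; split=> //; [rewrite mem_enum|rewrite mem_iota add1n|case: p {Hp}].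
Qed.

Lemma box_pos L p : p \in box L -> coord_pos p.
Proof. by rewrite mem_box => /andP[]. Qed.

Lemma fsum_box (V : nmodType) (D : set (coords m)) (F : coords m -> V) L :
  (forall p, D p -> p \notin box L -> F p = 0) ->
  \sum_(p \in D) F p = \sum_(p <- box L | p \in D) F p.
Proof.
move=> H; rewrite (@bigfs _ _ _ _ _ (fun p => p \in D)) ?box_uniq ?set_mem_set//.
by move=> p; rewrite inE; exact: H.
Qed.

Lemma sum_box (V : nmodType) (F : coords m -> V) L :
  \sum_(p <- box L) F p = \sum_i \sum_(1 <= j < L.+1) F (i, j).
Proof. by rewrite big_allpairs big_enum/= /index_iota subn1. Qed.

Lemma above_below p : coord_pos p -> above (below p) = p.
Proof. by case: p => i [|j]. Qed.

Definition tail (J : nat) : set (coords m) := [set p | (J <= p.2)%N].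

End Box.
Arguments box m L : clear implicits.
Arguments tail {m} J.

Section Occupancy.
Context (R : realType) (m : nat).
Local Notation state := (ell1 (coords m) R).
Implicit Types (x y : state) (p : coords m) (D : set (coords m)).

Definition vanishes x L := forall p, (L < p.2)%N -> x p = 0.

Lemma vanishesW x L L' : (L <= L')%N -> vanishes x L -> vanishes x L'.
Proof. by move=> LL' vx p Lp; apply: vx; exact: leq_ltn_trans Lp. Qed.

(** [n * load coord_pos x] is the number of tasks: a pool with [j] tasks is counted once at each of
    the levels 1 to [j]. *)
Definition load D x : R := \sum_(p \in D) x p.

Lemma load_box D x L : D `<=` coord_pos -> vanishes x L ->
  load D x = \sum_(p <- box m L | p \in D) x p.
Proof.
move=> Dpos vx; apply: fsum_box => p /Dpos p0.
by rewrite mem_box; move: p0; rewrite /coord_pos/= => -> /=; rewrite -ltnNge => /vx.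
Qed.

Lemma ell1E x y : (forall p, x p = y p) -> x = y.
Proof. by move=> xy; apply: val_inj; apply/funext. Qed.

Lemma ell1_deltaE p q : ell1_delta R p q = (q == p)%:R. Proof. by []. Qed.

Lemma ell1_addE x y p : (x + y) p = x p + y p. Proof. by []. Qed.
Lemma ell1_scaleE (a : R) x p : (a *: x) p = a * x p. Proof. by []. Qed.
Lemma ell1_oppE x p : (- x) p = - x p. Proof. by []. Qed.

Lemma load_shift D x p (c : R) L : D `<=` coord_pos -> vanishes x L ->
  load D (x + c *: ell1_delta R p) = load D x + c * (p \in D)%:R.
Proof.
move=> Dpos vx; pose M := maxn L p.2.
have vM : vanishes x M by apply: vanishesW vx; exact: leq_maxl.
have vM' : vanishes (x + c *: ell1_delta R p) M.
  move=> q Mq; rewrite ell1_addE ell1_scaleE ell1_deltaE vM// add0r.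
  have -> : q == p = false by apply/negbTE; apply: contraTneq Mq => ->; rewrite -leqNgt leq_maxr.
  by rewrite mulr0.
rewrite (load_box Dpos vM) (load_box Dpos vM').
under eq_bigr do rewrite ell1_addE ell1_scaleE ell1_deltaE.
rewrite big_split/=; congr (_ + _); rewrite -mulr_sumr; congr (_ * _).
have [pD|pD] := boolP (p \in D); last first.
  by rewrite big1// => q qD; case: eqP => // qp; rewrite -qp qD in pD.
rewrite (big_rem p)/=; last first.
  by rewrite mem_box leq_maxr andbT; apply: Dpos; exact: set_mem.
rewrite pD eqxx big1_seq ?addr0// => q /andP[_].
by rewrite mem_rem_uniq ?box_uniq// inE => /andP[/negPf ->].
Qed.

(** As [n * (x p - x (above p))] pools of class [p.1] have exactly [p.2] tasks, [mu * unload D x] is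
    the rate at which departures decrease [load D]. *)
Definition unload D x : R := \sum_(p \in D) p.2%:R * (x p - x (above p)).

Lemma unload_box D x L : D `<=` coord_pos -> vanishes x L ->
  unload D x = \sum_(p <- box m L | p \in D) p.2%:R * (x p - x (above p)).
Proof.
move=> Dpos vx; apply: fsum_box => p /Dpos p0.
rewrite mem_box; move: p0; rewrite /coord_pos/= => -> /=; rewrite -ltnNge => Lp.
by rewrite !vx ?subrr ?mulr0//=; exact: ltnW.
Qed.

Lemma tail_pos J : (0 < J)%N -> tail J `<=` @coord_pos m.
Proof. by move=> J0 p; exact: leq_trans. Qed.

Lemma tail1 : tail 1 = @coord_pos m. Proof. by []. Qed.

Lemma sum_tail_box (F : coords m -> R) J L : (0 < J)%N ->
  \sum_(p <- box m L | p \in tail J) F p = \sum_i \sum_(J <= j < L.+1) F (i, j).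
Proof.
move=> J0; rewrite big_mkcond/= sum_box; apply: eq_bigr => i _.
rewrite -big_mkcond/= [RHS](big_nat_widenl _ 1)//=.
by apply: eq_bigl => j; apply/idP/idP; rewrite inE.
Qed.

Lemma abel_sum (a : nat -> R) J L : (J <= L.+1)%N -> (0 < J)%N ->
  \sum_(J <= j < L.+1) j%:R * (a j - a j.+1) =
  J.-1%:R * a J + \sum_(J <= j < L.+1) a j - L%:R * a L.+1.
Proof.
move=> JL J0; elim: L JL => [|L IH] JL.
  by rewrite (_ : J = 1%N); [rewrite !big_geq//= !mul0r addr0 subrr|apply/eqP; rewrite eqn_leq JL].
move: JL; rewrite leq_eqVlt => /orP[/eqP ->|JL].
  by rewrite !big_geq//= addr0 subrr.
rewrite big_nat_recr//= IH// [in RHS]big_nat_recr//=.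
have -> : L.+1%:R = L%:R + 1 :> R by rewrite -natr1.
lra.
Qed.

(** Summation by parts gives the load plus [J - 1] times the nonnegative entries at level [J]. *)
Lemma unload_tail J x : (0 < J)%N -> (forall p, 0 <= x p) ->
  (exists L, vanishes x L) -> load (tail J) x <= unload (tail J) x.
Proof.
move=> J0 x0 [L0 /(vanishesW (leq_maxl L0 J))]; set L := maxn _ _ => vx.
have JL : (J <= L)%N by exact: leq_maxr.
rewrite (load_box (tail_pos J0) vx) (unload_box (tail_pos J0) vx) !sum_tail_box//.
apply: ler_sum => i _; rewrite /above/= (@abel_sum (fun j => x (i, j)))//; last exact: leqW.
have -> : x (i, L.+1) = 0 by exact: vx.
by rewrite mulr0 subr0 lerDr mulr_ge0.
Qed.

(** The boundary term of the summation by parts has the factor [J - 1 = 0]. *)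
Lemma unload_pos x : (exists L, vanishes x L) -> unload coord_pos x = load coord_pos x.
Proof.
move=> [L vx]; rewrite -tail1.
rewrite (load_box (@tail_pos 1 isT) vx) (unload_box (@tail_pos 1 isT) vx) !sum_tail_box//.
apply: eq_bigr => i _; rewrite /above/= (@abel_sum (fun j => x (i, j)))//.
have -> : x (i, L.+1) = 0 by exact: vx.
by rewrite mulr0 mul0r subr0 add0r.
Qed.

Variables (n : nat) (A : 'I_m.+1 -> nat).
Hypothesis n_gt0 : (0 < n)%N.
Local Notation occ := (occupancy_states n A).

Let n0 : 0 < n%:R :> R. Proof. by rewrite ltr0n. Qed.

Lemma occ_nat x p : occ x -> n%:R * x p \is a Num.nat.
Proof. by case: p => i j /(_ i j)[]. Qed.

Lemma occ_ge0 x p : occ x -> 0 <= x p.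
Proof. by move=> /(@occ_nat _ p)/natr_ge0; rewrite pmulr_rge0. Qed.

Lemma occ_above x p : occ x -> x (above p) <= x p.
Proof. by case: p => i j /(_ i j)[]. Qed.

Lemma occ_below x p : occ x -> coord_pos p -> x p <= x (below p).
Proof. by move=> ox p0; rewrite -{1}(above_below p0) occ_above. Qed.

Lemma occ_frac x i : occ x -> x (i, 0%N) = class_frac R n A i.
Proof. by move=> /(_ i 0%N)[]. Qed.

Lemma occ_le x p : occ x -> x p <= class_frac R n A p.1.
Proof. by case: p => i j ox; rewrite -(occ_frac i ox); case: (ox i j). Qed.

Lemma occ_mono x i j k : occ x -> (j <= k)%N -> x (i, k) <= x (i, j).
Proof.
move=> ox; elim: k => [|k IH]; first by rewrite leqn0 => /eqP ->.
rewrite leq_eqVlt => /orP[/eqP ->//|jk].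
exact: le_trans (occ_above (i, k) ox) (IH jk).
Qed.

Lemma occ_gap x p q : occ x -> x q < x p -> x q + n%:R^-1 <= x p.
Proof.
move=> ox; rewrite -(ltr_pM2l n0) -(ler_pM2l n0) mulrDr mulfV ?gt_eqF//.
by move: (occ_nat p ox) (occ_nat q ox) => /natrP[k ->] /natrP[l ->]; rewrite ltr_nat natr1 ler_nat.
Qed.

(** A class without a zero entry has all entries at least [1 / n], so its sum diverges; past a zero,
    monotonicity keeps the entries at 0. *)
Lemma occ_vanishes x : occ x -> exists L, vanishes x L.
Proof.
move=> ox.
suff H i : exists L, x (i, L) = 0.
  have /choice[f fE] := H; exists (\max_i f i) => -[i j] /= Lj.
  apply/eqP; rewrite eq_le (occ_ge0 _ ox) andbT -(fE i) (occ_mono _ ox)//.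
  by apply: leq_trans (ltnW Lj); exact: leq_bigmax.
apply: contrapT => /forallNP Hi.
have ge j : n%:R^-1 <= x (i, j).
  have xj : 0 < x (i, j) by rewrite lt_neqAle (occ_ge0 _ ox) andbT eq_sym; apply/eqP/Hi.
  move: (occ_nat (i, j) ox) => /natrP[k kE].
  by rewrite -(ler_pM2l n0) mulfV ?gt_eqF// kE ler1n -(ltr_nat R) -kE mulr_gt0.
have := ell1_valP x; rewrite ell1_predE; apply/negP; rewrite -leNgt leye_eq.
(* [k] entries of size [1 / n] already add up to more than [r]. *)
apply/eqP/eqyP => r r0; pose k := (Num.trunc (n%:R * r)).+1.
apply: esum_ge; exists ((fun j => (i, j)) @` `I_k).
  by split=> //; exact: finite_image.
rewrite fsbig_image; last by move=> ? ? _ _ [].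
rewrite -(@fsbig_ord _ _ _ k (fun j => `|(x (i, j))%:E|%E)).
apply: (@le_trans _ _ (\sum_(j < k) (n%:R^-1)%:E)%E); last first.
  by apply: lee_sum => j _; rewrite /= lee_fin ger0_norm ?ge// occ_ge0.
rewrite sumEFin sumr_const card_ord lee_fin -(ler_pM2l n0) -[_ *+ k]mulr_natr mulrA.
by rewrite mulfV ?gt_eqF// mul1r ltW//; exact: truncnS_gt.
Qed.

Lemma nat_num_succ (a : R) : a \is a Num.nat -> a + 1 \is a Num.nat.
Proof. by move=> /natrP[k ->]; rewrite natr1 natr_nat. Qed.

Lemma nat_num_pred (a b : R) : a \is a Num.nat -> b \is a Num.nat -> b < a ->
  a - 1 \is a Num.nat.
Proof.
move=> /natrP[[|k] ->] /natrP[l ->]; first by rewrite ltr_nat.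
by rewrite -natr1 addrK natr_nat.
Qed.

Lemma occ_add x p : occ x -> coord_pos p -> x p < x (below p) -> occ (add_task n x p).
Proof.
move=> ox p0 xp i j.
have valE q : add_task n x p q = x q + n%:R^-1 * (q == p)%:R by [].
have p2 : (p.2 == 0)%N = false by apply/negbTE; rewrite -lt0n.
have zE k : add_task n x p (k, 0%N) = x (k, 0%N).
  rewrite valE; case: eqP => [pE|_]; last by rewrite mulr0 addr0.
  by move: p2; rewrite -pE.
split; last by rewrite zE occ_frac.
- rewrite valE mulrDr mulrA mulfV ?gt_eqF// mul1r.
  by case: eqP => _; rewrite ?addr0 ?nat_num_succ// occ_nat.
- rewrite !valE; case: (eqVneq (i, j.+1) p) => [E|_].
    have -> : (i, j) == p = false by rewrite -E xpair_eqE eqxx/= ltn_eqF.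
    rewrite E mulr1 mulr0 addr0; have -> : (i, j) = below p by rewrite -E.
    exact: occ_gap.
  by rewrite mulr0 addr0 (le_trans (occ_above (i, j) ox))// lerDl mulr_ge0.
- rewrite zE valE; case: (eqVneq (i, j) p) => [E|_]; last first.
    by rewrite mulr0 addr0 occ_mono.
  rewrite E mulr1; apply: le_trans (occ_gap ox xp) _.
  by rewrite -E /below/= occ_mono.
Qed.

Lemma occ_remove x p : occ x -> coord_pos p -> x (above p) < x p ->
  occ (remove_task n x p).
Proof.
move=> ox p0 xp i j.
have valE q : remove_task n x p q = x q - n%:R^-1 * (q == p)%:R by [].
have p2 : (p.2 == 0)%N = false by apply/negbTE; rewrite -lt0n.
have zE k : remove_task n x p (k, 0%N) = x (k, 0%N).
  rewrite valE; case: eqP => [pE|_]; last by rewrite mulr0 subr0.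
  by move: p2; rewrite -pE.
have nle q : remove_task n x p q <= x q.
  by rewrite valE gerBl mulr_ge0.
split; last by rewrite zE occ_frac.
- rewrite valE mulrBr mulrA mulfV ?gt_eqF// mul1r.
  case: eqP => [E|_]; rewrite ?subr0 ?occ_nat//.
  apply: (@nat_num_pred _ (n%:R * x (above p))); rewrite ?occ_nat//.
  by rewrite E ltr_pM2l.
- rewrite [leRHS]valE; case: (eqVneq (i, j) p) => [E|_]; last first.
    by rewrite mulr0 subr0 (le_trans (nle _)) ?(occ_above (i, j)).
  rewrite mulr1 lerBrDr E; apply: le_trans (occ_gap ox xp).
  by rewrite lerD2r (le_trans (nle _))// -E.
- by rewrite zE (le_trans (nle _))// occ_mono.
Qed.

End Occupancy.

(** * Systems of parallel queues *)

Section LoadBalancing.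
Context (R : realType) (m : nat) (T : ptopologicalType).
Local Notation state := (ell1 (coords m) R).
Variables (lam mu : R) (n : nat) (A : 'I_m.+1 -> nat).
Variables (occ : T -> state) (arr : T -> coords m -> R).
Variables (add rem : T -> coords m -> T).
Variables (rate : T -> T -> R) (S : set T).
Implicit Types (z y : T) (p : coords m) (f g h : T -> R).

(* A chain whose state [z] has occupancy [occ z], where an arriving task is
   assigned to [p] with probability [arr z p]. *)
Record load_balancer : Prop := LoadBalancer {
  lb_occ : forall z, S z -> occupancy_states n A (occ z);
  lb_arr_ge0 : forall z p, S z -> 0 <= arr z p;
  lb_arr_adm : forall z p, S z -> arr z p != 0 ->
    coord_pos p /\ occ z p < occ z (below p);
  lb_arr_sum : forall z, S z -> \sum_(p \in coord_pos) arr z p = 1;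
  lb_add : forall z p, occ (add z p) = add_task n (occ z) p;
  lb_rem : forall z p, occ (rem z p) = remove_task n (occ z) p;
  lb_rate : forall z y, S z -> rate z y =
    n%:R * lam * (\sum_(p \in [set p | coord_pos p /\ y = add z p]) arr z p) +
    \sum_(p \in [set p | coord_pos p /\ y = rem z p])
       n%:R * mu * p.2%:R * (occ z p - occ z (above p));
  lb_closed : forall z y, S z -> occupancy_states n A (occ y) ->
    (exists p, [/\ coord_pos p, arr z p != 0 & y = add z p]) \/
    (exists2 p, coord_pos p & y = rem z p) ->
    0 < rate z y -> S y }.

Hypothesis LB : load_balancer.
Hypothesis n_gt0 : (0 < n)%N.
Hypotheses (lam_gt0 : 0 < lam) (mu_gt0 : 0 < mu).

Let n0 : 0 < n%:R :> R. Proof. by rewrite ltr0n. Qed.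

Definition generator f z : R :=
  n%:R * lam * (\sum_(p \in coord_pos) arr z p * (f (add z p) - f z)) +
  n%:R * mu * (\sum_(p \in coord_pos)
     p.2%:R * (occ z p - occ z (above p)) * (f (rem z p) - f z)).

Let dep z p : R := n%:R * mu * p.2%:R * (occ z p - occ z (above p)).

Let dep_ge0 z p : S z -> 0 <= dep z p.
Proof.
by move=> Sz; rewrite !mulr_ge0 ?(ltW n0) ?(ltW mu_gt0)// subr_ge0 (occ_above _ (lb_occ LB Sz)).
Qed.

Lemma lb_vanishes z : S z -> exists L, vanishes (occ z) L.
Proof. by move=> Sz; apply: occ_vanishes (lb_occ LB Sz). Qed.

(** An arrival may open level [L + 1] but none above it, hence the box of height [L + 1]. *)
Lemma arr_out z p L : S z -> vanishes (occ z) L -> p \notin box m L.+1 -> arr z p = 0.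
Proof.
move=> Sz vx; rewrite mem_box => pL; apply/eqP; apply/negP => /negP a0.
have [p0 xp] := lb_arr_adm LB Sz a0; move: p0 pL; rewrite /coord_pos/= => ->/=.
rewrite -ltnNge => Lp; suff v q : (L < q.2)%N -> occ z q = 0.
  by move: xp; rewrite !v ?ltxx//=; [rewrite -ltnS prednK// (leq_ltn_trans _ Lp)|exact: ltnW].
exact: vx.
Qed.

Lemma dep_out z p L : vanishes (occ z) L -> coord_pos p -> p \notin box m L.+1 ->
  occ z p - occ z (above p) = 0.
Proof.
move=> vx; rewrite mem_box /coord_pos/= => ->/=; rewrite -ltnNge => Lp.
by rewrite !vx ?subrr//=; [exact: ltnW (ltnW Lp)|exact: ltnW].
Qed.

Let listed z L : seq (R * T) :=
  [seq (n%:R * lam * arr z p, add z p) | p <- box m L] ++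
  [seq (dep z p, rem z p) | p <- box m L].

Let rate_box z y L : S z -> vanishes (occ z) L ->
  rate z y = \sum_(e <- listed z L.+1) e.1 * (e.2 == y)%:R.
Proof.
move=> Sz vx; rewrite (lb_rate LB)// big_cat/= !big_map/=.
rewrite (fsum_box (L := L.+1)); last by move=> p _; exact: arr_out.
rewrite [X in _ + X](fsum_box (L := L.+1)); last first.
  by move=> p [p0 _] pL; rewrite (dep_out vx)// mulr0.
rewrite big_distrr/=; congr (_ + _).
  rewrite big_mkcond/= big_seq [RHS]big_seq; apply: eq_bigr => p /box_pos p0.
  case: (eqVneq (add z p) y) => [<-|yp]; first by rewrite mulr1 ifT// inE.
  by rewrite mulr0 ifF//; apply/negP; rewrite inE => -[_ E]; rewrite E eqxx in yp.
rewrite big_mkcond/= big_seq [RHS]big_seq; apply: eq_bigr => p /box_pos p0.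
case: (eqVneq (rem z p) y) => [<-|yp]; first by rewrite mulr1 ifT// inE.
by rewrite mulr0 ifF//; apply/negP; rewrite inE => -[_ E]; rewrite E eqxx in yp.
Qed.

Let listed_ge0 z L e : S z -> e \in listed z L -> 0 <= e.1.
Proof.
move=> Sz; rewrite mem_cat => /orP[] /mapP[p _ ->]/=; last exact: dep_ge0.
by rewrite !mulr_ge0 ?(ltW n0) ?(ltW lam_gt0)// (lb_arr_ge0 LB).
Qed.

Lemma lb_rate_ge0 z y : S z -> 0 <= rate z y.
Proof.
move=> Sz; have [L vx] := lb_vanishes Sz.
rewrite (rate_box _ Sz vx) big_seq sumr_ge0// => e /(listed_ge0 Sz) e0.
by rewrite mulr_ge0.
Qed.

Let rate_listed z L e : S z -> vanishes (occ z) L -> e \in listed z L.+1 ->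
  0 < e.1 -> 0 < rate z e.2.
Proof.
move=> Sz vx eL e0; rewrite (rate_box _ Sz vx) (big_rem e)//= eqxx mulr1.
rewrite ltr_wpDr// big_seq sumr_ge0// => e' /mem_rem/(listed_ge0 Sz) ?.
by rewrite mulr_ge0.
Qed.

Let ninv_neq0 p : n%:R^-1 *: ell1_delta R p != 0.
Proof.
apply/eqP => /(congr1 (fun x : state => x p)); rewrite ell1_scaleE ell1_deltaE eqxx mulr1.
by apply/eqP; rewrite invr_eq0 gt_eqF.
Qed.

Definition tasks z : R := n%:R * load coord_pos (occ z).

(** Passes from the chain to sums over coordinates. An entry of positive rate is an admissible
    arrival or departure, so its target has a legitimate occupancy and lies in [S] by closure; it
    differs from [z] because the occupancy changes. *)
Lemma jumps_generator z : S z -> exists s, [/\ jumps rate S z s,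
  \sum_(e <- s) e.1 = n%:R * lam + mu * tasks z &
  forall f, \sum_(e <- s) e.1 * (f e.2 - f z) = generator f z].
Proof.
move=> Sz; have [L vx] := lb_vanishes Sz; exists (listed z L.+1); split; [split| |].
- by move=> y _ _; exact: rate_box.
- move=> e eL; split=> [|e0]; first exact: listed_ge0 eL.
  have re := rate_listed Sz vx eL e0.
  move: eL e0 re; rewrite mem_cat => /orP[] /mapP[p pL ->]/= e0 re.
    have a0 : arr z p != 0 by apply: contraTneq e0 => ->; rewrite mulr0 ltxx.
    have [p0 xp] := lb_arr_adm LB Sz a0; split.
      apply: (lb_closed LB Sz) => //; last by left; exists p.
      by rewrite (lb_add LB); apply: occ_add => //; exact: lb_occ.
    apply/eqP => /(congr1 occ)/esym/eqP; rewrite (lb_add LB) /add_task.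
    by rewrite -subr_eq0 opprD addrA subrr add0r oppr_eq0 (negPf (ninv_neq0 p)).
  have p0 := box_pos pL.
  have xp : occ z (above p) < occ z p.
    rewrite lt_neqAle (occ_above _ (lb_occ LB Sz)) andbT.
    by apply: contraTneq e0 => E; rewrite /dep E subrr mulr0 ltxx.
  split.
    apply: (lb_closed LB Sz) => //; last by right; exists p.
    by rewrite (lb_rem LB); apply: occ_remove => //; exact: lb_occ.
  apply/eqP => /(congr1 occ)/esym/eqP; rewrite (lb_rem LB) /remove_task.
  by rewrite -subr_eq0 opprB addrC subrK (negPf (ninv_neq0 p)).
- rewrite big_cat/= !big_map/= -mulr_sumr; congr (_ + _).
    rewrite -[RHS]mulr1; congr (_ * _); rewrite -(lb_arr_sum LB Sz).
    rewrite (fsum_box (L := L.+1)); last by move=> p _; exact: arr_out.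
    rewrite [RHS]big_mkcond big_seq [RHS]big_seq; apply: eq_bigr => p pL.
    by rewrite ifT// inE; exact: box_pos pL.
  rewrite /tasks -unload_pos; last by exists L.
  rewrite /unload (fsum_box (L := L.+1)); last first.
    by move=> p p0 pL; rewrite (dep_out vx p0 pL) mulr0.
  rewrite !mulr_sumr [RHS]big_mkcond big_seq [RHS]big_seq; apply: eq_bigr => p pL.
  by rewrite ifT; [rewrite /dep; ring|rewrite inE; exact: box_pos pL].
- move=> f; rewrite big_cat/= !big_map/= /generator; congr (_ + _).
    rewrite (fsum_box (L := L.+1)); last first.
      by move=> p _ pL; rewrite (arr_out Sz vx pL) mul0r.
    rewrite big_distrr/= [RHS]big_mkcond big_seq [RHS]big_seq; apply: eq_bigr => p pL.
    by rewrite ifT ?mulrA// inE; exact: box_pos pL.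
  rewrite (fsum_box (L := L.+1)); last first.
    by move=> p p0 pL; rewrite (dep_out vx p0 pL) mulr0 mul0r.
  rewrite big_distrr/= [RHS]big_mkcond big_seq [RHS]big_seq; apply: eq_bigr => p pL.
  by rewrite ifT ?mulrA// inE; exact: box_pos pL.
Qed.

Let fsum_scale (F : coords m -> R) (c : R) :
  \sum_(p \in coord_pos) F p * c = (\sum_(p \in coord_pos) F p) * c.
Proof. by rewrite mulr_fsuml. Qed.

Lemma load_add z D p : S z -> D `<=` coord_pos ->
  load D (occ (add z p)) = load D (occ z) + n%:R^-1 * (p \in D)%:R.
Proof.
move=> Sz Dp; have [L vx] := lb_vanishes Sz.
by rewrite (lb_add LB) /add_task (load_shift _ _ Dp vx).
Qed.

Lemma load_rem z D p : S z -> D `<=` coord_pos ->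
  load D (occ (rem z p)) = load D (occ z) - n%:R^-1 * (p \in D)%:R.
Proof.
move=> Sz Dp; have [L vx] := lb_vanishes Sz.
by rewrite (lb_rem LB) /remove_task -scaleNr (load_shift _ _ Dp vx) mulNr.
Qed.

Lemma tasks_ge0 z : S z -> 0 <= tasks z.
Proof.
by move=> Sz; rewrite mulr_ge0// fsumr_ge0// => p _; exact: occ_ge0 (lb_occ LB Sz).
Qed.

(** Whatever the assignment rule, the number of tasks is a birth-death process with birth rate
    [n * lam] and death rate [mu] per task. *)
Lemma generator_tasks (phi : R -> R) z : S z -> generator (phi \o tasks) z =
  n%:R * lam * (phi (tasks z + 1) - phi (tasks z)) +
  mu * tasks z * (phi (tasks z - 1) - phi (tasks z)).
Proof.
move=> Sz; rewrite /generator /=.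
have tadd p : coord_pos p -> tasks (add z p) = tasks z + 1.
  move=> p0; rewrite /tasks load_add// mem_set// mulr1 mulrDr mulfV//.
  by rewrite gt_eqF.
have trem p : coord_pos p -> tasks (rem z p) = tasks z - 1.
  move=> p0; rewrite /tasks load_rem// mem_set// mulr1 mulrBr mulfV//.
  by rewrite gt_eqF.
congr (_ + _).
  congr (_ * _).
  rewrite (eq_fsbigr (fun p => arr z p * (phi (tasks z + 1) - phi (tasks z)))).
    by rewrite fsum_scale (lb_arr_sum LB Sz) mul1r.
  by move=> p /set_mem p0; rewrite tadd.
rewrite (eq_fsbigr (fun p =>
    p.2%:R * (occ z p - occ z (above p)) * (phi (tasks z - 1) - phi (tasks z)))).
  rewrite fsum_scale -/(unload _ _) unload_pos; last exact: lb_vanishes.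
  by rewrite /tasks; ring.
by move=> p /set_mem p0; rewrite trem.
Qed.

Lemma generator_scale (c : R) f z : generator (fun z => c * f z) z = c * generator f z.
Proof.
by rewrite /generator mulrDr !mulr_fsumr; congr (_ + _); apply: eq_fsbigr => p _; ring.
Qed.

Lemma dep_load D z : S z -> D `<=` coord_pos ->
  n%:R * mu * (\sum_(p \in coord_pos) p.2%:R * (occ z p - occ z (above p)) *
    (load D (occ (rem z p)) - load D (occ z))) = - (mu * unload D (occ z)).
Proof.
move=> Sz Dp; have nz : n%:R != 0 :> R by rewrite gt_eqF.
rewrite (eq_fsbigr (fun p => - n%:R^-1 * (if p \in D then p.2%:R * (occ z p - occ z (above p)) else 0))); last first.
  move=> p _; rewrite load_rem// addrAC subrr add0r.
  by case: ifP => _; rewrite ?mulr1 ?mulr0 ?oppr0 ?mulr0// mulrC.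
rewrite -mulr_fsumr mulrA [n%:R * mu]mulrC mulrN -[mu * _ / _]mulrA mulfV// mulr1 mulNr; congr (- (_ * _)).
rewrite /unload [LHS]fsbig_mkcond [RHS]fsbig_mkcond; apply: eq_fsbigr => p _.
rewrite /patch; case: ifPn; case: ifPn => //.
by move=> /set_mem/Dp/mem_set ->.
Qed.

Lemma generator_load D z : S z -> D `<=` coord_pos -> generator (load D \o occ) z =
  lam * (\sum_(p \in D) arr z p) - mu * unload D (occ z).
Proof.
move=> Sz Dp; rewrite /generator /= dep_load//; have nz : n%:R != 0 :> R by rewrite gt_eqF.
congr (_ - _).
rewrite (eq_fsbigr (fun p => n%:R^-1 * (if p \in D then arr z p else 0))); last first.
  move=> p _; rewrite load_add// addrAC subrr add0r.
  by case: ifP => _; rewrite ?mulr1 ?mulr0// mulrC.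
rewrite -mulr_fsumr mulrA [n%:R * lam]mulrC -[_ * _ / _]mulrA mulfV// mulr1; congr (_ * _).
rewrite [LHS]fsbig_mkcond [RHS]fsbig_mkcond; apply: eq_fsbigr => p _.
rewrite /patch; case: ifPn; case: ifPn => //.
by move=> /set_mem/Dp/mem_set ->.
Qed.

Variable pi : T -> R.
Hypothesis pi_ge0 : forall z, 0 <= pi z.
Hypothesis pi_total : (\esum_(z in S) (pi z)%:E = 1)%E.
Hypothesis pi_balance : forall y, S y ->
  ((pi y * exit_rate rate S y)%:E = \esum_(z in S `\ y) (pi z * rate z y)%:E)%E.
Local Notation mean := (mean S pi).

Lemma mean_cst (c : R) : 0 <= c -> mean (cst c) = c%:E.
Proof.
move=> c0; rewrite /mean; under eq_esum do rewrite mulrC EFinM.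
by rewrite esumZl ?pi_total ?mule1// => z _; rewrite lee_fin.
Qed.

Lemma exit_lb z : S z -> exit_rate rate S z = n%:R * lam + mu * tasks z.
Proof. by move=> /jumps_generator[s [Hs <- _]]; exact: jumps_exit. Qed.

Let has_jumps z : S z -> exists s, jumps rate S z s.
Proof. by move=> /jumps_generator[s []]; exists s. Qed.

Let drift f g h :
  (forall z, S z -> [/\ 0 <= f z, 0 <= g z & 0 <= h z]) ->
  (forall z, S z -> generator f z + h z <= g z) ->
  (forall k : R, mean (fun z => exit_rate rate S z * Num.max 0 (k - f z))%R < +oo)%E ->
  (mean h <= mean g)%E.
Proof.
move=> fgh d; apply: (@stationary_drift _ _ rate S _ pi pi_ge0 pi_balance has_jumps f g h) => //.
  by move=> z y Sz _; exact: lb_rate_ge0.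
by move=> z Sz; have [s [Hs _ E]] := jumps_generator Sz; exists s; rewrite E; split=> //; exact: d.
Qed.

(** The drift of [tasks] is [n * lam - mu * tasks]. *)
Lemma mean_tasks : (mean tasks <= (n%:R * (lam / mu))%:E)%E.
Proof.
have nl0 : 0 <= n%:R * lam by rewrite mulr_ge0 ?ltW.
have : (mean (fun z => mu * tasks z)%R <= mean (cst (n%:R * lam)%R))%E.
  apply: (@drift tasks).
  - move=> z Sz; split; [exact: tasks_ge0|exact: nl0|].
    by rewrite mulr_ge0 ?tasks_ge0 ?(ltW mu_gt0).
  - by move=> z Sz; rewrite (generator_tasks idfun Sz)/=; lra.
  (* Where [k - tasks] is positive the exit rate is at most [n * lam + mu * k], so the condition can
     be checked before the mean exit rate is known to be finite. *)
  - move=> k; apply: (@le_lt_trans _ _ (mean (cst ((n%:R * lam + mu * `|k|) * `|k|)%R))).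
      apply: le_mean => // z Sz; rewrite /= exit_lb//; have t0 := tasks_ge0 Sz.
      have [kt|tk] := leP k (tasks z).
        by rewrite max_l ?subr_le0// mulr0 mulr_ge0 ?addr_ge0 ?mulr_ge0 ?(ltW mu_gt0) ?(ltW lam_gt0).
      have k0 : 0 <= k by rewrite (le_trans t0)// ltW.
      have -> : Num.max 0 (k - tasks z) = k - tasks z by rewrite max_r// subr_ge0 ltW.
      rewrite ger0_norm//; apply: ler_pM; last by rewrite gerBl.
      - by rewrite addr_ge0// mulr_ge0// ltW.
      - by rewrite subr_ge0 ltW.
      - by rewrite lerD2l ler_wpM2l ?ltW.
    by rewrite mean_cst ?ltry// mulr_ge0 ?addr_ge0 ?mulr_ge0 ?(ltW mu_gt0) ?(ltW lam_gt0).
rewrite meanZ ?(ltW mu_gt0)//; last exact: tasks_ge0.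
by rewrite mean_cst// -lee_pdivlMl// -EFinM => /le_trans; apply; rewrite lee_fin mulrC -mulrA.
Qed.

Lemma mean_exit_lty : (mean (exit_rate rate S) < +oo)%E.
Proof.
have nl0 : 0 <= n%:R * lam by rewrite mulr_ge0 ?ltW.
apply: (@le_lt_trans _ _ (mean (fun z => n%:R * lam + mu * tasks z)%R)).
  by apply: le_mean => // z Sz; rewrite exit_lb.
rewrite meanD//; last by move=> z Sz; rewrite mulr_ge0 ?tasks_ge0 ?(ltW mu_gt0).
rewrite [X in (X + _)%E]mean_cst// meanZ ?(ltW mu_gt0)//; last exact: tasks_ge0.
rewrite lte_add_pinfty ?ltry// lte_mul_pinfty ?lee_fin ?(ltW mu_gt0)//.
by apply: le_lt_trans mean_tasks _; rewrite ltry.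
Qed.

(** As [(k - f)^+] is at most [|k|], the finite mean exit rate settles the integrability condition
    for every Lyapunov function. *)
Lemma lb_drift f g h :
  (forall z, S z -> [/\ 0 <= f z, 0 <= g z & 0 <= h z]) ->
  (forall z, S z -> generator f z + h z <= g z) -> (mean h <= mean g)%E.
Proof.
move=> fgh d; apply: (@drift f) => // k.
have e0 z : S z -> 0 <= exit_rate rate S z.
  by move=> Sz; rewrite exit_lb//; apply: addr_ge0; apply: mulr_ge0; rewrite ?tasks_ge0 ?(ltW mu_gt0) ?(ltW lam_gt0).
apply: (@le_lt_trans _ _ (mean (fun z => `|k| * exit_rate rate S z)%R)).
  apply: le_mean => // z Sz; rewrite mulrC ler_wpM2r ?e0// ge_max normr_ge0/=.
  by have [f0 _ _] := fgh z Sz; rewrite (le_trans _ (ler_norm k))// gerBl.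
by rewrite meanZ// lte_mul_pinfty ?lee_fin// mean_exit_lty.
Qed.

Definition prob (B : pred T) : \bar R := mean (fun z => (B z)%:R).

Lemma prob_ge0 B : (0 <= prob B)%E.
Proof. exact: mean_ge0. Qed.

Lemma prob_le1 B : (prob B <= 1)%E.
Proof.
rewrite -(@mean_cst 1 ler01); apply: le_mean => // z _.
by rewrite -[leRHS]/(1%:R) ler_nat; case: (B z).
Qed.

(** Induction with the Lyapunov function [(tasks - k)^+]. An arrival increases it by at most 1, and
    only if [tasks >= k - 1]; a departure decreases it by 1 if [tasks >= k + 1], where departures
    have rate at least [mu * theta]. Hence two more tasks cost a factor [n * (lam / mu) / theta]. *)
Lemma prob_tasks (theta : R) l : 0 < theta ->
  (prob (fun z => (theta + l.*2%:R <= tasks z)%R) <=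
   ((n%:R * (lam / mu) / theta) ^+ l)%:E)%E.
Proof.
move=> th0; elim: l => [|l IH]; first by rewrite expr0 prob_le1.
set B := (fun z => theta + l.*2%:R <= tasks z) in IH *.
set B' := (fun z => _ <= tasks z).
pose k : R := theta + l.*2%:R + 1.
have l0 : 0 <= l.*2%:R :> R by [].
have BE z : B z = (k - 1 <= tasks z) by rewrite /B /k addrK.
have B'E z : B' z = (k + 1 <= tasks z).
  by rewrite /B' /k doubleS -!natr1 !addrA.
have : (mean (fun z => mu * theta * (B' z)%:R)%R <= mean (fun z => n%:R * lam * (B z)%:R)%R)%E.
  apply: (@lb_drift (Num.max 0 \o (fun t => t - k) \o tasks)).
    by move=> z Sz; rewrite /= le_max lexx !mulr_ge0// ltW.
  move=> z Sz; rewrite (@generator_tasks (Num.max 0 \o (fun t => t - k)) z Sz)/=.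
  have t0 := tasks_ge0 Sz; set t := tasks z in t0 *.
  rewrite B'E BE -/t.
  have A1 : Num.max 0 (t + 1 - k) - Num.max 0 (t - k) <= (k - 1 <= t)%R%:R.
    by have [] := leP (k - 1) t; have [] := leP 0 (t + 1 - k); have [] := leP 0 (t - k); rewrite /=; lra.
  have A2 : t * (Num.max 0 (t - 1 - k) - Num.max 0 (t - k)) + theta * (k + 1 <= t)%R%:R <= 0.
    have k1 : theta <= k + 1 by rewrite /k; lra.
    have [] := leP (k + 1) t; have [] := leP 0 (t - 1 - k); have [] := leP 0 (t - k); rewrite /=; nra.
  have nl : 0 <= n%:R * lam by rewrite mulr_ge0 ?ltW.
  have := ler_wpM2l nl A1; have := ler_wpM2l (ltW mu_gt0) A2; lra.
rewrite !meanZ ?mulr_ge0 ?(ltW mu_gt0) ?(ltW lam_gt0) ?(ltW th0)// -/(prob B) -/(prob B') => H.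
have mt : 0 < mu * theta by rewrite mulr_gt0.
move: H; rewrite -lee_pdivlMl// muleA -EFinM => /le_trans; apply.
have -> : (mu * theta)^-1 * (n%:R * lam) = n%:R * (lam / mu) / theta.
  by rewrite invfM; ring.
rewrite exprS [X in (_ <= X)%E]EFinM.
by rewrite lee_pmul// ?prob_ge0// lee_fin !mulr_ge0 ?invr_ge0 ?ltW.
Qed.

(** The Lyapunov function is the load of the tail divided by [mu]: arrivals feed it at rate
    [lam / mu] times the probability of the tail, and by [unload_tail] departures drain at least the
    load itself. *)
Lemma mean_load_tail J : (0 < J)%N ->
  (mean (load (tail J) \o occ) <=
   (lam / mu)%:E * mean (fun z => \sum_(p \in tail J) arr z p)%R)%E.
Proof.
move=> J0; have lm : 0 <= lam / mu by rewrite divr_ge0 ?ltW.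
have l0 z : S z -> 0 <= load (tail J) (occ z).
  by move=> Sz; rewrite fsumr_ge0// => p _; exact: occ_ge0 (lb_occ LB Sz).
have a0 z : S z -> 0 <= \sum_(p \in tail J) arr z p.
  by move=> Sz; rewrite fsumr_ge0// => p _; exact: lb_arr_ge0.
rewrite -meanZ//; apply: le_trans; last first.
  apply: (@lb_drift (fun z => mu^-1 * load (tail J) (occ z))
     (fun z => lam / mu * \sum_(p \in tail J) arr z p) (load (tail J) \o occ)).
    by move=> z Sz; rewrite !mulr_ge0 ?invr_ge0 ?l0 ?a0 ?(ltW mu_gt0)//=; exact: ltW.
  move=> z Sz.
  rewrite (@generator_scale mu^-1 (load (tail J) \o occ)).
  rewrite generator_load//; last exact: tail_pos.
  have := @unload_tail _ _ J (occ z) J0 (fun p => occ_ge0 n_gt0 p (lb_occ LB Sz)) (lb_vanishes Sz).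
  have -> : mu^-1 * (lam * \sum_(p \in tail J) arr z p - mu * unload (tail J) (occ z)) =
     lam / mu * (\sum_(p \in tail J) arr z p) - unload (tail J) (occ z).
    by field; rewrite gt_eqF.
  by rewrite /=; lra.
by [].
Qed.

End LoadBalancing.

(** * Compact sets and tightness *)

Section CompactEll1.
Context (R : realType) (m : nat).
Local Notation state := (ell1 (coords m) R).

(** There are [(m + 1) * J] coordinates of level below [J], each contributing at most [a]; the rest
    is the tail. *)
Lemma ell1_sum_le (h : coords m -> R) J (a b : R) : (0 < J)%N -> 0 <= a ->
  (forall p, (p.2 < J)%N -> `|h p| <= a) ->
  (forall L, \sum_(p <- box m L | p \in tail J) `|h p| <= b) ->
  (ell1_sum h <= ((m.+1 * J)%:R * a + b)%:E)%E.
Proof.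
move=> J0 a0 ha hb; apply: ge_ereal_sup => _ [F [finF _] <-].
rewrite fsbig_finite//= sumEFin lee_fin.
pose L := maxn J (\max_(p <- enum_fset (fset_set F)) p.2).
pose box0 := [seq (i, j) | i <- enum 'I_m.+1, j <- iota 0 L.+1].
have u0 : uniq box0.
  by apply: allpairs_uniq; rewrite ?enum_uniq ?iota_uniq// => -[? ?] [? ?] _ _ [-> ->].
apply: (@le_trans _ _ (\sum_(p <- box0) `|h p|)).
  have sub : {subset fset_set F <= box0}.
    move=> [i j] Fp; apply/allpairsP; exists (i, j); split=> //.
      by rewrite mem_enum.
    rewrite mem_iota add0n /= ltnS /L leq_max; apply/orP; right.
    exact: (@leq_bigmax_seq _ (enum_fset (fset_set F)) predT (fun p => p.2) (i, j)).
  rewrite [leRHS](bigID (mem (fset_set F)) predT)/= -[leLHS]addr0 lerD//; last first.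
    exact: sumr_ge0.
  rewrite -[leRHS]big_filter [leRHS](perm_big (enum_fset (fset_set F)))//.
  apply: uniq_perm; rewrite ?filter_uniq// ?fset_uniq// => p.
  by rewrite mem_filter/= andb_idr// => /sub.
rewrite big_allpairs big_enum/=.
have JL : (J <= L.+1)%N by rewrite leqW// leq_maxl.
have -> : \sum_(i < m.+1) \sum_(j <- 0%N :: iota 1 L) `|h (i, j)| =
   \sum_(i < m.+1) (\sum_(0 <= j < J) `|h (i, j)| + \sum_(J <= j < L.+1) `|h (i, j)|).
  by apply: eq_bigr => i _; rewrite -big_cat_nat.
rewrite big_split/= lerD//; last by rewrite -(@sum_tail_box _ _ (fun p => `|h p|)).
apply: (@le_trans _ _ (\sum_(i < m.+1) \sum_(0 <= j < J) a)).
  apply: ler_sum => i _; rewrite big_nat [leRHS]big_nat.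
  by apply: ler_sum => j /andP[_ jJ]; exact: ha.
under eq_bigr do rewrite sumr_const_nat subn0.
by rewrite sumr_const card_ord -mulrnA [leRHS]mulr_natl mulnC.
Qed.

(* Compactness in [ell1] comes from Tychonoff's theorem: [embed], with junk value
   [0] outside [ell1], is continuous for the product topology on families with
   uniformly small tails. *)
Definition embed (f : coords m -> R) : state :=
  match pselect (f \in @ell1_pred _ R) with left e => Ell1 e | right _ => 0 end.

Lemma embedE f : f \in @ell1_pred _ R -> ell1_val (embed f) = f.
Proof. by rewrite /embed; case: pselect. Qed.

Lemma embedK (x : state) : embed x = x.
Proof. by apply: val_inj; rewrite /= embedE// ell1_valP. Qed.

Variable J : nat -> nat.
Hypothesis J_gt0 : forall s, (0 < J s)%N.

Let pspace : topologicalType := prod_topology (fun _ : coords m => R : topologicalType).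

(** The tail condition is stated through finite partial sums, each continuous in the product
    topology, which makes this a closed subset of a Tychonoff cube. *)
Definition thin : set pspace := [set f | forall p, `[0 : R, 1]%classic (f p)] `&`
  \bigcap_(sL in [set: nat * nat])
    [set f | \sum_(p <- box m sL.2 | p \in tail (J sL.1)) f p <= sL.1.+1%:R^-1].

Let proj_cts p : continuous (fun f : pspace => f p).
Proof. exact: (@proj_continuous _ (fun _ : coords m => R : topologicalType) p). Qed.

Let partial (r : seq (coords m)) (D : set (coords m)) : pspace -> R :=
  fun f => \sum_(p <- r | p \in D) f p.

Let partial_cts r D : continuous (partial r D).
Proof.
elim: r => [|p r IH].
  have -> : partial [::] D = cst 0 by apply/funext => g; rewrite /partial big_nil.
  exact: cst_continuous.
case: (boolP (p \in D)) => pD; last first.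
  have -> : partial (p :: r) D = partial r D.
    by apply/funext => g; rewrite /partial big_cons (negPf pD).
  exact: IH.
have -> : partial (p :: r) D = (fun g => g p + partial r D g).
  by apply/funext => g; rewrite /partial big_cons pD.
move=> f; exact (@cvgD R R pspace (nbhs f) (nbhs_filter f) (fun g => g p)
  (partial r D) (f p) (partial r D f) (@proj_cts p f) (IH f)).
Qed.

Lemma compact_thin : compact thin.
Proof.
apply: compact_closedI.
  exact (@tychonoff _ (fun _ : coords m => R : topologicalType)
    (fun=> `[0 : R, 1]%classic) (fun=> @segment_compact R 0 1)).
apply: closed_bigI => -[s L] _ /=.
apply: (@preimage_closed _ _ (partial (box m L) (tail (J s)))
   [set y | y <= s.+1%:R^-1]); last exact: closed_le.
by move=> f _; exact: partial_cts.
Qed.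

Lemma thin_bound f g : thin f -> thin g -> forall s L,
  \sum_(p <- box m L | p \in tail (J s)) `|f p - g p| <= 2 * s.+1%:R^-1.
Proof.
move=> [f01 ft] [g01 gt] s L.
apply: (@le_trans _ _ (\sum_(p <- box m L | p \in tail (J s)) (f p + g p))).
  apply: ler_sum => p _; have := f01 p; have := g01 p.
  rewrite /= !in_itv/= => /andP[? _] /andP[? _].
  by rewrite (le_trans (ler_normB _ _))// !ger0_norm.
rewrite big_split/= mulr_natl mulr2n; apply: lerD.
  exact: (ft (s, L)).
exact: (gt (s, L)).
Qed.

Lemma thin_ell1 f : thin f -> f \in @ell1_pred _ R.
Proof.
move=> [f01 ft]; rewrite ell1_predE.
apply: (le_lt_trans (@ell1_sum_le f (J 0) 1 1 (J_gt0 0) ler01 _ _)); last by rewrite ltry.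
  move=> p _; have := f01 p; rewrite /= in_itv/= => /andP[? ?].
  by rewrite ger0_norm.
move=> L; have := ft (0%N, L) I; rewrite /= invr1; apply: le_trans.
apply: ler_sum => p _; have := f01 p; rewrite /= in_itv/= => /andP[? ?].
by rewrite ger0_norm.
Qed.

(** On [thin] the tails from level [J s] on are uniformly small; the finitely many lower coordinates
    are controlled by the product topology. *)
Lemma embed_cts : {within thin, continuous (embed : pspace -> state)}.
Proof.
apply/subspace_continuousP => f tf; apply/cvgrPdist_lt => e e0.
(* The tails of two members of [thin] together have mass at most [2 / (s + 1) < e / 2]. *)
pose s := Num.trunc (4 / e).
have se : 2 * s.+1%:R^-1 < e / 2.
  have : 4 / e < s.+1%:R by exact: truncnS_gt.
  rewrite ltr_pdivrMr// => H; rewrite ltr_pdivrMr// mulrAC ltr_pdivlMr//; lra.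
pose k : R := (m.+1 * J s)%:R.
have k0 : 0 <= k by [].
pose d := e / 2 / (k + 1).
have d0 : 0 < d by rewrite !divr_gt0// ltr_wpDl.
have kd : k * d < e / 2.
  by rewrite /d mulrCA gtr_pMr ?divr_gt0// ltr_pdivrMr ?ltr_wpDl// mul1r ltrDl.
have nbh : \forall g \near nbhs (f : pspace),
    forall q : 'I_m.+1 * 'I_(J s), `|f (q.1, val q.2) - g (q.1, val q.2)| < d.
  apply: filter_forall => q.
  by have /cvgrPdist_lt := @proj_cts (q.1, val q.2) f; apply.
rewrite /prop_near1/= /within/=; apply: filterS nbh => g gd tg.
rewrite -[ltLHS]/(ell1_norm _) /ell1_norm.
rewrite -lte_fin fineK; last by rewrite ell1_sum_fin// ell1_valP.
apply: (@le_lt_trans _ _ (k * d + 2 * s.+1%:R^-1)%:E); last by rewrite lte_fin [e in ltRHS]splitr ltrD.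
have E p : ell1_val (embed f - embed g) p = f p - g p.
  by rewrite ell1_addE ell1_oppE !embedE ?thin_ell1.
rewrite /from_subspace; apply: ell1_sum_le => //; first exact: ltW.
  by move=> [i j] jJ; rewrite E; exact/ltW/(gd (i, Ordinal jJ)).
by move=> L; under eq_bigr do rewrite E; exact: thin_bound.
Qed.

Definition envelope : set state := embed @` thin.

Lemma compact_envelope : compact envelope.
Proof. exact: continuous_compact embed_cts compact_thin. Qed.

Lemma in_envelope (x : state) : (forall p, 0 <= x p <= 1) ->
  (forall s L, \sum_(p <- box m L | p \in tail (J s)) x p <= s.+1%:R^-1) -> envelope x.
Proof.
move=> x01 xt; exists (x : coords m -> R); last exact: embedK.
by split=> [p|[s L] _]; [rewrite /= in_itv/=; exact: x01|exact: xt].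
Qed.

End CompactEll1.

(** * Borel laws carried by countable sets *)

Section BorelTightness.
Context (R : realType) (T : ptopologicalType).
Hypothesis hausT : hausdorff_space T.

Lemma measurable_borel_open (U : set T) : open U -> measurable (U : set (borel T)).
Proof. by move=> oU; exact: sub_sigma_algebra. Qed.

Lemma measurable_borel_closed (F : set T) : closed F -> measurable (F : set (borel T)).
Proof.
move=> cF; rewrite -[F]setCK; apply: measurableC.
by apply: measurable_borel_open; exact: closed_openC.
Qed.

Lemma measurable_borel_set1 (x : T) : measurable ([set x] : set (borel T)).
Proof.
apply: measurable_borel_closed; apply: accessible_closed_set1.
exact: hausdorff_accessible.
Qed.

(** The fibres [F k] of an injection into [nat] have at most one point, so that countable additivity
    over [nat] applies. *)
Lemma measure_countable (P : {measure set (borel T) -> \bar R}) (D : set T) :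
  countable D -> P D = (\esum_(x in D) P [set x])%E.
Proof.
move=> /countable_injP[f injf].
pose F k : set (borel T) := [set x | D x /\ f x = k].
have FE x : D x -> F (f x) = [set x].
  move=> Dx; apply/seteqP; split=> y /=; last by move=> ->; split.
  by move=> [Dy fy]; apply: injf fy; exact: mem_set.
have DE : D = \bigcup_(k in f @` D) F k.
  apply/seteqP; split=> [x Dx|x [_ [y Dy <-]] []//].
  by exists (f x); [exists x|rewrite FE].
rewrite [in LHS]DE measure_bigcup.
- rewrite nneseries_esum// set_mem_set (esum_image D f (fun k => P (F k))).
    by apply: eq_esum => x Dx; rewrite FE.
  exact: injf.
- by move=> _ [x Dx <-]; rewrite FE//; exact: measurable_borel_set1.
- apply/trivIsetP => i j _ _ ij; apply/seteqP; split=> x//= [[_ fi] [_ fj]].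
  by move: ij; rewrite -fi -fj eqxx.
Qed.

Lemma measurable_countable (D : set T) : countable D -> measurable (D : set (borel T)).
Proof. by move=> cD; apply: countable_measurable => // x; exact: measurable_borel_set1. Qed.

Definition atom (P : probability (borel T) R) (x : T) : R := fine (P [set x]).

Lemma atom_ge0 (P : probability (borel T) R) x : 0 <= atom P x.
Proof. exact: fine_ge0. Qed.

Lemma atomE (P : probability (borel T) R) x : (atom P x)%:E = P [set x].
Proof. by rewrite /atom fineK// fin_num_measure//; exact: measurable_borel_set1. Qed.

Lemma atom_total (P : probability (borel T) R) (S : set T) : countable S -> P S = 1%E ->
  (\esum_(x in S) (atom P x)%:E = 1)%E.
Proof.
by move=> cS <-; rewrite measure_countable//; apply: eq_esum => x _; rewrite atomE.
Qed.

Lemma carried_outside (P : probability (borel T) R) (S K : set T) :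
  countable S -> P S = 1%E -> measurable (K : set (borel T)) ->
  P (~` K) = prob S (atom P) (fun x => x \notin K).
Proof.
move=> cS PS mK; have mS := measurable_countable cS.
have PSC : P (~` S) = 0%E by rewrite probability_setC// PS subee.
have mKC := measurableC mK.
transitivity (P (~` K `\` S) + P (~` K `&` S))%E; first exact: measureDI.
have -> : P (~` K `\` S) = 0%E.
  apply/eqP; rewrite eq_le measure_ge0 andbT -PSC.
  apply: le_measure; last by move=> x [].
  - by apply: mem_set; exact: measurableD.
  - by apply: mem_set; exact: measurableC.
rewrite add0e measure_countable; last exact: (sub_countable (subset_card_le (@subIsetr _ _ _))).
rewrite esum_mkcondl; apply: eq_esum => x _.
rewrite in_setC /= -atomE; case: (x \in K) => /=; first by rewrite mulr0.
by rewrite mulr1.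
Qed.

(** The total mass 1 is the supremum of the masses of the finite subsets of [S]. *)
Lemma carried_finite (P : probability (borel T) R) (S : set T) (e : R) :
  countable S -> P S = 1%E -> 0 < e ->
  exists F : set T, finite_set F /\ (P (~` F) <= e%:E)%E.
Proof.
move=> cS PS e0.
have : ((1 - e)%:E < \esum_(x in S) (atom P x)%:E)%E.
  by rewrite atom_total// lte_fin ltrBlDr ltrDl.
move=> /ereal_sup_gt[_ [F [finF FS] <-]] eF; exists F; split=> //.
have mF : measurable (F : set (borel T)).
  by apply: measurable_countable; exact: finite_set_countable.
rewrite probability_setC//.
have <- : (\sum_(x \in F) (atom P x)%:E = P F)%E.
  rewrite measure_countable; last exact: finite_set_countable.
  rewrite -(esum_fset finF).
    by apply: eq_esum => x _; rewrite atomE.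
  by move=> x _; rewrite lee_fin atom_ge0.
move: eF; rewrite fsbig_finite//= sumEFin lte_fin -EFinB lee_fin; lra.
Qed.

(** The finitely many laws with [n < n0] are handled by a finite union of finite sets, which is
    compact. *)
Lemma tight_eventually (P : nat -> probability (borel T) R) (S : nat -> set T) n0 :
  (forall n, (0 < n)%N -> countable (S n) /\ P n (S n) = 1%E) ->
  (forall e : R, 0 < e -> exists K : set T, compact K /\
     forall n, (0 < n)%N -> (n0 <= n)%N -> (P n (~` K) <= e%:E)%E) ->
  tight [set n | (0 < n)%N] P.
Proof.
move=> carried ev e e0; have [K [cK HK]] := ev e e0.
have H n : exists F : set T, finite_set F /\ ((0 < n)%N -> (P n (~` F) <= e%:E)%E).
  have [n_gt0|] := ltnP 0 n; last by exists set0.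
  have [cS PS] := carried n n_gt0.
  by have [F [finF HF]] := carried_finite cS PS e0; exists F.
have /choice[F HF] := H.
pose G := \bigcup_(n in `I_n0) F n.
have cG : compact G.
  by apply: finite_compact; apply: bigcup_finite => // n _; case: (HF n).
have mcpt (C : set T) : compact C -> measurable (C : set (borel T)).
  by move=> cC; apply: measurable_borel_closed; exact: compact_closed.
have mono (C D : set T) n : compact C -> compact D -> C `<=` D ->
    (P n (~` D) <= P n (~` C))%E.
  move=> cC cD CD; apply: le_measure; last exact: subsetC.
  - by apply: mem_set; apply: measurableC; exact: mcpt.
  - by apply: mem_set; apply: measurableC; exact: mcpt.
exists (K `|` G); split; first exact: compactU.
move=> n /= n_gt0; have [n0n|nn0] := leqP n0 n.
  by apply: le_trans (HK n n_gt0 n0n); apply: mono => //; exact: compactU.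
apply: le_trans ((HF n).2 n_gt0); apply: mono.
- by apply: finite_compact; case: (HF n).
- exact: compactU.
- by move=> x Fx; right; exists n.
Qed.

End BorelTightness.

(** * The ranking of the coordinates *)

Section Ranking.
Context (R : realType) (m : nat) (u : 'I_m.+1 -> R -> R).
Hypothesis u_concave : forall i, concave_on_nneg (u i).
Implicit Types p q : coords m.

(** Concavity at the midpoint [j + 1] of [j] and [j + 2]. *)
Lemma Delta_nonincr i j : Delta u i j.+1 <= Delta u i j.
Proof.
have h0 : 0 <= 1 / 2 :> R by lra.
have h1 : 1 / 2 <= 1 :> R by lra.
have mem0 k : (k%:R : R^o) \in ([set x | 0 <= x] : set R^o) by apply: mem_set; exact: ler0n.
have := u_concave i (Itv01 h0 h1) (mem0 j) (mem0 j.+2).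
set c : R := (X in u i X); have cE : c = j.+1%:R.
  have -> : c = 1 / 2 * j%:R + (1 - 1 / 2) * j.+2%:R by [].
  have -> : j.+2%:R = j%:R + 2 :> R by rewrite -natrD addn2.
  by have -> : j.+1%:R = j%:R + 1 :> R; [rewrite natr1|lra].
rewrite convRE/= cE /Delta.
rewrite /unstable.onem; lra.
Qed.

Lemma Delta_mono i j k : (j <= k)%N -> Delta u i k <= Delta u i j.
Proof.
elim: k => [|k IH]; first by rewrite leqn0 => /eqP ->.
rewrite leq_eqVlt => /orP[/eqP -> //|jk].
by apply: le_trans (IH _) => //; exact: Delta_nonincr.
Qed.

Local Notation lt := (rank_lt u).

Lemma rank_lt_irr p : ~~ (lt p p).
Proof. by rewrite /rank_lt ltxx eqxx /lex_lt !ltnn andbF. Qed.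

Lemma lex_lt_trans : transitive (@lex_lt m).
Proof.
move=> [b k] [a j] [c l]; rewrite /lex_lt /=.
move=> /orP[ab|/andP[/eqP -> jk]] /orP[bc|/andP[/eqP <- kl]]; apply/orP.
- by left; exact: ltn_trans bc.
- by left.
- by left.
- by right; rewrite eqxx/=; exact: ltn_trans kl.
Qed.

Lemma lex_lt_total p q : p != q -> lex_lt p q || lex_lt q p.
Proof.
case: p q => [a j] [b k] pq; rewrite /lex_lt /=.
case: (ltngtP a b) => ab; rewrite ?orbT //=; have {}ab : a = b by exact: val_inj.
rewrite ab eqxx/=; case: (ltngtP j k) => //= jk.
by rewrite ab jk eqxx in pq.
Qed.

Lemma rank_lt_trans p q r : lt p q -> lt q r -> lt p r.
Proof.
rewrite /rank_lt => /orP[pq|/andP[/eqP -> lpq]] /orP[qr|/andP[/eqP qr lqr]]; apply/orP.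
- by left; exact: lt_trans qr.
- by left; rewrite -qr.
- by left.
- by right; rewrite qr eqxx/=; exact: lex_lt_trans lqr lpq.
Qed.

Lemma rank_lt_total p q : p != q -> lt p q \/ lt q p.
Proof.
move=> pq; rewrite /rank_lt; case: ltgtP => //= _; try by [left|right].
by have /orP[->|->] := lex_lt_total pq; [right|left].
Qed.

(** Marginal utilities do not increase along a class, and the reversed lexicographic tie-break also
    favours the lower level. *)
Lemma rank_lt_class i j k : (0 < j)%N -> (j < k)%N -> lt (i, k) (i, j).
Proof.
move=> j0 jk; rewrite /rank_lt /=.
have := @Delta_mono i j.-1 k.-1; rewrite -ltnS !prednK// ?(ltn_trans j0)// => /(_ (ltnW jk)).
by rewrite le_eqVlt => /orP[/eqP ->|->//]; rewrite eqxx /lex_lt /= ltnn eqxx jk orbT.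
Qed.

Lemma rank_lt_classE i j k : (0 < j)%N -> (0 < k)%N ->
  (lt (i, k) (i, j)) = (j < k)%N.
Proof.
move=> j0 k0; apply/idP/idP; last exact: rank_lt_class.
case: (ltngtP j k) => //= [kj|->]; last by rewrite (negPf (rank_lt_irr _)).
move=> /rank_lt_trans/(_ (rank_lt_class i k0 kj)).
by rewrite (negPf (rank_lt_irr _)).
Qed.

Lemma seq_largest (s : seq (coords m)) p0 : p0 \in s ->
  exists2 p, p \in s & forall q, q \in s -> q = p \/ lt q p.
Proof.
elim: s p0 => // a s IH p0 _.
case: s IH => [_|b s IH]; first by exists a; rewrite ?mem_head// => q; rewrite inE => /eqP ->; left.
have [p ps pmax] := IH b (mem_head _ _).
have [->|ap] := eqVneq a p.
  exists p; first by rewrite inE ps orbT.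
  by move=> q; rewrite inE => /orP[/eqP ->|/pmax//]; left.
have [lap|lpa] := rank_lt_total ap.
  exists p; first by rewrite inE ps orbT.
  by move=> q; rewrite inE => /orP[/eqP ->|/pmax//]; right.
exists a; first exact: mem_head.
move=> q; rewrite inE => /orP[/eqP ->|/pmax[->|qp]]; [by left|by right|right].
exact: rank_lt_trans lpa.
Qed.

(** Within a class the lowest level of [C] ranks highest, which leaves at most [m + 1]
    candidates. *)
Lemma largest_exists (C : set (coords m)) p0 : C `<=` coord_pos -> C p0 ->
  exists p, is_largest u C p.
Proof.
move=> Cpos Cp0.
have H i : exists j, (exists k, C (i, k)) -> C (i, j) /\ forall k, C (i, k) -> (j <= k)%N.
  have [[k Ck]|no] := pselect (exists k, C (i, k)); last by exists 0%N => /no.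
  have ex : exists k, `[< C (i, k) >] by exists k; apply/asboolP.
  exists (ex_minn ex) => _; case: ex_minnP => j /asboolP Cj jmin; split=> // l Cl.
  by apply: jmin; apply/asboolP.
have /choice[f fP] := H.
pose s := [seq (i, f i) | i <- enum 'I_m.+1 & `[< exists k, C (i, k) >]].
have sC p : p \in s -> C p.
  move=> /mapP[i]; rewrite mem_filter => /andP[/asboolP /fP[Ci _] _ ->]; exact: Ci.
have Cs q : C q -> (q.1, f q.1) \in s /\ (f q.1 <= q.2)%N.
  move=> Cq; have ex : exists k, C (q.1, k) by exists q.2; case: q Cq.
  have [Cf fmin] := fP _ ex; split; last by apply: fmin; rewrite -surjective_pairing.
  by apply/mapP; exists q.1 => //; rewrite mem_filter mem_enum andbT; apply/asboolP.
have [p ps pmax] := seq_largest (Cs p0 Cp0).1.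
exists p; split; first exact: sC.
move=> q Cq; have [qs fq] := Cs q Cq.
have le : q = (q.1, f q.1) \/ lt q (q.1, f q.1).
  move: fq; rewrite leq_eqVlt => /orP[/eqP ->|fq]; first by left; case: q {Cq qs}.
  right; case: q Cq qs fq => [i j]/= Cq qs fq; apply: rank_lt_class fq.
  exact: (Cpos _ (sC _ qs)).
have [E|ltp] := pmax _ qs; first by rewrite -E.
by case: le => [->|le]; right=> //; exact: rank_lt_trans ltp.
Qed.

End Ranking.

(** * Tails of stationary laws *)

Section StationaryLaws.
Context (R : realType) (m : nat).
Local Notation state := (ell1 (coords m) R).

(** A state has finite support and entries that are multiples of [1 / n], so a finite list of
    naturals encodes it. *)
Lemma countable_occupancy n (A : 'I_m.+1 -> nat) : (0 < n)%N ->
  countable (occupancy_states n A : set state).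
Proof.
move=> n0.
pose build (s : seq (coords m * nat)) : state :=
  \sum_(e <- s) (e.2%:R / n%:R) *: ell1_delta R e.1.
apply: (@sub_countable _ _ _ (range build)); last first.
  exact: (sub_countable (card_image_le _ _)) (countableP _).
apply: subset_card_le => x ox; have [L vx] := occ_vanishes n0 ox.
pose box0 : seq (coords m) := [seq (i, j) | i <- enum 'I_m.+1, j <- iota 0 L.+1].
have u0 : uniq box0.
  by apply: allpairs_uniq; rewrite ?enum_uniq ?iota_uniq// => -[? ?] [? ?] _ _ [-> ->].
exists [seq (p, Num.trunc (n%:R * x p)) | p <- box0] => //.
apply: ell1E => q; rewrite /build big_map/=.
have -> : ell1_val (\sum_(p <- box0) ((Num.trunc (n%:R * x p))%:R / n%:R) *: ell1_delta R p) q =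
    \sum_(p <- box0) x p * (q == p)%:R.
  elim: box0 {u0} => [|p r IH]; first by rewrite !big_nil.
  rewrite !big_cons ell1_addE ell1_scaleE ell1_deltaE IH; congr (_ * _ + _).
  by rewrite (truncnK (occ_nat p ox)) mulrAC mulfV ?mul1r// pnatr_eq0 -lt0n.
have [qb|qb] := boolP (q \in box0).
  rewrite (big_rem q)//= eqxx mulr1 big1_seq ?addr0// => p /andP[_].
  by rewrite mem_rem_uniq// inE eq_sym => /andP[/negPf -> _]; rewrite mulr0.
rewrite big1_seq => [|p /andP[_ pb]].
  rewrite vx// ltnNge; apply: contra qb => qL; apply/allpairsP; exists q.
  by split; rewrite ?mem_enum ?mem_iota ?add0n//; case: q {qL}.
by case: eqP => [qp|]; rewrite ?mulr0//; rewrite qp pb in qb.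
Qed.

Section OneChain.
Context (T : ptopologicalType) (S : set T) (pi : T -> R).
Hypothesis pi_ge0 : forall x, 0 <= pi x.

(** Markov's inequality and a union bound: on [B] some [f s] is at least 1. *)
Lemma prob_sum_le (B : pred T) (f : nat -> T -> R) (e : nat -> R) (c : R) :
  (forall s z, S z -> 0 <= f s z) ->
  (forall s, (mean S pi (f s) <= (e s)%:E)%E) ->
  (\sum_(0 <= s <oo) (e s)%:E <= c%:E)%E ->
  (forall z, S z -> B z -> exists s, 1 <= f s z) ->
  (prob S pi B <= c%:E)%E.
Proof.
move=> f0 fe ec Bf; apply: le_trans ec.
apply: (@le_trans _ _ (\sum_(0 <= s <oo) mean S pi (f s))%E); last first.
  by apply: lee_nneseries => // s _ _; apply: mean_ge0 => // z; exact: f0.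
rewrite /mean -esum_nneseries; last first.
  by move=> z s Sz; rewrite lee_fin mulr_ge0// f0.
apply: le_esum => z Sz.
have p0 s : (0 <= (pi z * f s z)%:E)%E by rewrite lee_fin mulr_ge0// f0.
case: (boolP (B z)) => Bz; last by rewrite mulr0; exact: nneseries_ge0.
have [s fs] := Bf z Sz Bz.
apply: (@le_trans _ _ (pi z * f s z)%:E); first by rewrite lee_fin ler_wpM2l.
rewrite (@nneseriesD1 _ _ s)//.
by rewrite leeDl//; exact: nneseries_ge0.
Qed.

Variable X : T -> state.

(** The event is covered by the failures of the tail bounds [1 / (s + 1)]; by Markov's inequality
    the failure for [s] has probability at most [e / 2 ^ (s + 1)], and these sum to [e]. *)
Lemma prob_envelope (J : nat -> nat) (e : R) : (forall s, (0 < J s)%N) -> 0 <= e ->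
  (forall z, S z -> (forall p, 0 <= X z p <= 1) /\ exists L, vanishes (X z) L) ->
  (forall s, (mean S pi (load (tail (J s)) \o X) <= (s.+1%:R^-1 * (e / (2 ^ s.+1)%:R))%:E)%E) ->
  (prob S pi (fun z => X z \notin @envelope R m J) <= e%:E)%E.
Proof.
move=> J0 e0 X01 mX.
apply: (@prob_sum_le _ (fun s z => s.+1%:R * load (tail (J s)) (X z))
   (fun s => e / (2 ^ s.+1)%:R)).
- move=> s z Sz; rewrite mulr_ge0// fsumr_ge0// => p _.
  by have [/(_ p)/andP[]] := X01 z Sz.
- move=> s; rewrite meanZ//; last first.
    move=> z Sz; rewrite fsumr_ge0// => p _.
    by have [/(_ p)/andP[]] := X01 z Sz.
  by rewrite muleC -lee_pdivlMr// (le_trans (mX s))// lee_fin mulrC.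
- exact: epsilon_trick0.
- move=> z Sz Xz; apply: contrapT => /forallNP H; move: Xz => /negP; apply.
  apply: mem_set; have [x01 [L vx]] := X01 z Sz; apply: in_envelope => //.
  move=> s L'; have := H s => /negP; rewrite -ltNge => /ltW.
  rewrite mulrC -ler_pdivlMr// div1r; apply: le_trans.
  pose M := maxn L L'; have vM : vanishes (X z) M := vanishesW (leq_maxl _ _) vx.
  rewrite (load_box (tail_pos (J0 s)) vM) !sum_tail_box//.
  apply: ler_sum => i _; have LM : (L'.+1 <= M.+1)%N by rewrite ltnS leq_maxr.
  have [JL|LJ] := leqP (J s) L'.+1.
    rewrite (big_cat_nat JL LM)/= lerDl sumr_ge0// => j _.
    by case/andP: (x01 (i, j)).
  by rewrite big_geq 1?ltnW// sumr_ge0// => j _; case/andP: (x01 (i, j)).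
Qed.

End OneChain.

Section StationaryLB.
Context (T : ptopologicalType) (lam mu : R) (n : nat) (A : 'I_m.+1 -> nat)
  (occ : T -> state) (arr : T -> coords m -> R) (add rem : T -> coords m -> T)
  (rate : T -> T -> R) (S : set T) (P : probability (borel T) R).
Hypothesis LB : load_balancer lam mu n A occ arr add rem rate S.
Hypothesis hausT : hausdorff_space T.
Hypotheses (n_gt0 : (0 < n)%N) (lam_gt0 : 0 < lam) (mu_gt0 : 0 < mu).
Hypothesis countS : countable S.
Hypothesis statP : stationary rate S P.

Lemma lb_balance y : S y ->
  ((atom P y * exit_rate rate S y)%:E =
   \esum_(z in S `\ y) (atom P z * rate z y)%:E)%E.
Proof.
apply: global_balance => //.
- by move=> z x Sz _; exact: (lb_rate_ge0 LB).
- exact: atom_ge0.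
- move=> t t0 x Sx; rewrite (atomE hausT) (statP.2 t t0 x Sx).
  by apply: eq_esum => z _; rewrite (atomE hausT).
Qed.

Lemma lb_occ01 (hA : (\sum_i A i = n)%N) z : S z ->
  (forall p, 0 <= occ z p <= 1) /\ exists L, vanishes (occ z) L.
Proof.
move=> Sz; split; last exact: (lb_vanishes LB).
move=> p; rewrite (occ_ge0 n_gt0 p (lb_occ LB Sz))/=.
apply: le_trans (occ_le p (lb_occ LB Sz)) _.
rewrite ler_pdivrMr ?ltr0n// mul1r ler_nat -hA (bigD1 p.1)//=.
exact: leq_addr.
Qed.

End StationaryLB.
End StationaryLaws.

Lemma fsum_single (I : choiceType) (V : nmodType) (D : set I) (F : I -> V) t :
  D t -> (forall p, D p -> p != t -> F p = 0) -> \sum_(p \in D) F p = F t.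
Proof.
move=> Dt F0; rewrite -(fsbig_widen [set t] D) ?fsbig_set1//; first by move=> _ ->.
by move=> p [Dp /eqP pt]; exact: F0.
Qed.

Section LoadLevels.
Context (R : realType) (m : nat) (n : nat) (A : 'I_m.+1 -> nat).
Hypothesis n_gt0 : (0 < n)%N.
Implicit Type x : ell1 (coords m) R.

(** In class [i] the entries at the levels 1 to [K i] are all at least the one at level [K i]. *)
Lemma load_levels x (K : 'I_m.+1 -> nat) : occupancy_states n A x ->
  \sum_i (K i)%:R * x (i, K i) <= load coord_pos x.
Proof.
move=> ox; have [L vx] := occ_vanishes n_gt0 ox.
pose M := maxn L (\max_i K i).
have vM : vanishes x M := vanishesW (leq_maxl _ _) vx.
rewrite -tail1 (load_box (@tail_pos _ 1 isT) vM) sum_tail_box//.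
apply: ler_sum => i _.
have KM : ((K i).+1 <= M.+1)%N by rewrite ltnS leq_max; apply/orP; right; exact: leq_bigmax.
rewrite (big_cat_nat _ KM)//= -[leLHS]addr0 lerD//; last first.
  by rewrite sumr_ge0// => j _; exact: (occ_ge0 n_gt0 (i, j) ox).
apply: (@le_trans _ _ (\sum_(1 <= j < (K i).+1) x (i, K i))).
  by rewrite sumr_const_nat subn1/= [leLHS]mulr_natl.
by apply: ler_sum_nat => j /andP[_ jK]; exact: (occ_mono _ ox).
Qed.

End LoadLevels.

(** * JLMU *)

Section JLMU.
Context (R : realType) (m : nat) (u : 'I_m.+1 -> R -> R).
Variables (lam mu : R) (n : nat) (A : 'I_m.+1 -> nat).
Hypothesis u_concave : forall i, concave_on_nneg (u i).
Hypotheses (n_gt0 : (0 < n)%N) (lam_gt0 : 0 < lam) (mu_gt0 : 0 < mu).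
Hypothesis A_total : (\sum_i A i = n)%N.
Local Notation state := (ell1 (coords m) R).
Implicit Type x : state.

(** The target is not the default value: the profile of a nonempty class starts positive and ends at
    0, so it drops somewhere. *)
Lemma jlmu_target_largest x : occupancy_states n A x ->
  is_largest u [set p | coord_pos p /\ x p < x (below p)] (jlmu_target u x).
Proof.
move=> ox; have [i Ai] : exists i, (0 < A i)%N.
  apply: contrapT => /forallNP H; move: n_gt0; rewrite -A_total big1// => i _.
  by apply/eqP; rewrite -leqn0 leqNgt; apply/negP/H.
have [j xj] : exists j, x (i, j.+1) < x (i, j).
  apply: contrapT => /forallNP H.
  have xE j : x (i, 0%N) <= x (i, j).
    elim: j => [//|j IH]; apply: le_trans IH _; rewrite leNgt; exact/negP/H.
  have [L vx] := occ_vanishes n_gt0 ox.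
  have := xE L.+1; rewrite (vx (i, L.+1))// (occ_frac _ ox) leNgt => /negP; apply.
  by rewrite divr_gt0// ltr0n.
have [p pl] := @largest_exists _ _ u u_concave [set p | coord_pos p /\ x p < x (below p)]
  (i, j.+1) (fun p => @proj1 _ _) (conj isT xj).
exact: (xgetI _ pl).
Qed.

Definition jlmu_arr x p : R := (p == jlmu_target u x)%:R.

Lemma jlmu_load_balancer : load_balancer lam mu n A (id : state -> state) jlmu_arr
  (add_task n) (remove_task n) (jlmu_rate u lam mu n) (jlmu_states u lam mu n A).
Proof.
have target x : jlmu_states u lam mu n A x -> _ := fun H => jlmu_target_largest H.1.
split=> //.
- by move=> z [].
- by move=> z p /target [tz _]; rewrite /jlmu_arr pnatr_eq0 eqb0 negbK => /eqP ->.
- move=> z /target [[tz _] _]; rewrite (fsum_single tz) /jlmu_arr ?eqxx//.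
  by move=> p _ pt; rewrite /jlmu_arr (negPf pt).
- move=> z y /target [[tz _] _]; rewrite /jlmu_rate; congr (_ * _ + _).
  case: eqP => [yt|yt].
    rewrite (@fsum_single _ _ _ _ (jlmu_target u z)) /jlmu_arr ?eqxx//.
    by move=> p _ pt; rewrite /jlmu_arr (negPf pt).
  rewrite fsbig1// => p [_ yp]; rewrite /jlmu_arr; case: eqP => // pt.
  by rewrite pt in yp.
- move=> z y Sz oy _ zy; split=> //; apply: reachable_step zy; exact: Sz.2.
Qed.

Lemma jlmu_arr_tail x J : \sum_(p \in tail J) jlmu_arr x p = (J <= (jlmu_target u x).2)%N%:R.
Proof.
case: leqP => Jt.
  by rewrite (@fsum_single _ _ _ _ (jlmu_target u x)) /jlmu_arr ?eqxx// => p _ pt; rewrite /jlmu_arr (negPf pt).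
rewrite fsbig1// => p Jp; rewrite /jlmu_arr; case: eqP => // pt.
by move: Jp; rewrite /tail/= pt leqNgt Jt.
Qed.

(** A target of level at least [J] means that all pools of its class hold at least [J - 1] tasks,
    whence the load is at least [(J - 1) * c]. *)
Lemma jlmu_arr_tail_le x J (c : R) : occupancy_states n A x -> (1 < J)%N -> 0 < c ->
  (forall i, c <= class_frac R n A i) ->
  \sum_(p \in tail J) jlmu_arr x p <= (J.-1%:R * c)^-1 * load coord_pos x.
Proof.
move=> ox J1 c0 cA; have J0 : 0 < J.-1%:R * c.
  by rewrite mulr_gt0// ltr0n -subn1 subn_gt0.
rewrite jlmu_arr_tail mulrC ler_pdivlMr//; case: leqP => Jt; last first.
  by rewrite mul0r fsumr_ge0// => p _; exact: (occ_ge0 n_gt0 p ox).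
have [[]] := jlmu_target_largest ox; set t := jlmu_target u x in Jt *.
move=> t0 _ tmax; rewrite mul1r.
pose K i := if i == t.1 then t.2.-1 else 0%N.
apply: le_trans (load_levels n_gt0 K ox).
rewrite (bigD1 t.1)//= -[leLHS]addr0 lerD//; last first.
  by apply: sumr_ge0 => i _; rewrite mulr_ge0// (occ_ge0 n_gt0 _ ox).
rewrite /K eqxx.
(* A drop at a lower level of the same class would rank above the target. *)
have full j : (j < t.2)%N -> x (t.1, 0%N) <= x (t.1, j).
  elim: j => [//|j IH] jt; apply: le_trans (IH (ltnW jt)) _.
  rewrite leNgt; apply/negP => xj.
  have [E|lt] := tmax (t.1, j.+1) (conj isT xj).
    by move: jt; rewrite -[in X in (_ < X)%N]E ltnn.
  by move: lt; rewrite [t in rank_lt _ _ t]surjective_pairing rank_lt_classE// ltnNge (ltnW jt).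
have tt : (t.2.-1 < t.2)%N by rewrite prednK.
rewrite ler_pM//; first exact: ltW.
- by rewrite ler_nat -!subn1 leq_sub2r.
- by apply: le_trans (full _ tt); rewrite (occ_frac _ ox).
Qed.

End JLMU.

(** * Uniform lower bound on the class fractions *)

Section ClassFractions.
Context (R : realType) (m : nat) (A : nat -> 'I_m.+1 -> nat) (alpha : 'I_m.+1 -> R).
Hypothesis alpha_gt0 : forall i, 0 < alpha i.
Hypothesis A_cvg : forall i, class_frac R n (A n) i @[n --> \oo] --> alpha i.

Lemma class_frac_lower : exists2 c : R, 0 < c &
  exists n0, forall n, (n0 <= n)%N -> forall i, c <= class_frac R n (A n) i.
Proof.
(* The inverse of [s] is a positive lower bound of all [alpha i]; halving it leaves room for the
   convergence. *)
pose s := \sum_i (alpha i)^-1.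
have si i : (alpha i)^-1 <= s.
  by rewrite /s (bigD1 i)//= lerDl sumr_ge0// => k _; rewrite invr_ge0 ltW.
have s0 : 0 < s by apply: lt_le_trans (si ord0); rewrite invr_gt0.
have ca i : s^-1 / 2 < alpha i.
  apply: (@lt_le_trans _ _ s^-1); first by rewrite ltr_pdivrMr// ltr_pMr ?invr_gt0// ltr1n.
  by rewrite -[leRHS]invrK lef_pV2 ?posrE ?invr_gt0.
exists (s^-1 / 2); first by rewrite divr_gt0 ?invr_gt0.
have : \forall n \near \oo, forall i, s^-1 / 2 < class_frac R n (A n) i.
  by apply: filter_forall => i; exact: (cvgr_gt _ (@A_cvg i) _ (ca i)).
by move=> [n0 _ H]; exists n0 => n n0n i; exact/ltW/H.
Qed.

End ClassFractions.

(** * From the levels of arrivals to the tails of the occupancy *)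

Section UniformTails.
Context (R : realType) (m : nat) (T : ptopologicalType).
Local Notation state := (ell1 (coords m) R).
Variables (lam mu : R) (A : nat -> 'I_m.+1 -> nat).
Variables (occ : T -> state) (arr : nat -> T -> coords m -> R).
Variables (add rem : nat -> T -> coords m -> T) (rate : nat -> T -> T -> R).
Variables (S : nat -> set T) (P : nat -> probability (borel T) R).
Hypotheses (lam_gt0 : 0 < lam) (mu_gt0 : 0 < mu).
Hypothesis A_total : forall n, (0 < n)%N -> (\sum_i A n i = n)%N.
Hypothesis hausT : hausdorff_space T.
Hypothesis LB : forall n, (0 < n)%N ->
  load_balancer lam mu n (A n) occ (arr n) (add n) (rem n) (rate n) (S n).
Hypothesis countS : forall n, (0 < n)%N -> countable (S n).
Hypothesis statP : forall n, (0 < n)%N -> stationary (rate n) (S n) (P n).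
Variable n0 : nat.
Hypothesis arr_tail : forall d : R, 0 < d -> exists2 J, (0 < J)%N &
  forall n, (0 < n)%N -> (n0 <= n)%N ->
    (mean (S n) (atom (P n)) (fun z => \sum_(p \in tail J) arr n z p)%R <= d%:E)%E.

(** [d s] is the mean tail load that [prob_envelope] allows. Since [mean_load_tail] multiplies the
    arrival probability by [lam / mu], this probability has to be at most [d s / (lam / mu)]. *)
Lemma uniform_tails (e : R) : 0 < e ->
  exists J : nat -> nat, (forall s, (0 < J s)%N) /\
    forall n, (0 < n)%N -> (n0 <= n)%N ->
      (prob (S n) (atom (P n)) (fun z => occ z \notin @envelope R m J) <= e%:E)%E.
Proof.
move=> e0; have rho0 : 0 < lam / mu by rewrite divr_gt0.
pose d s : R := s.+1%:R^-1 * (e / (2 ^ s.+1)%:R).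
have d0 s : 0 < d s by rewrite mulr_gt0 ?divr_gt0 ?invr_gt0 ?ltr0n ?expn_gt0.
have H s : exists J, (0 < J)%N /\ forall n, (0 < n)%N -> (n0 <= n)%N ->
    (mean (S n) (atom (P n)) (fun z => \sum_(p \in tail J) arr n z p)%R <=
     (d s / (lam / mu))%:E)%E.
  have [|J J0 HJ] := arr_tail (d := d s / (lam / mu)); first by rewrite divr_gt0.
  by exists J.
have /choice[J HJ] := H; exists J; split=> [s|n n_gt0 n0n]; first by case: (HJ s).
apply: (@prob_envelope _ _ _ _ _ (@atom_ge0 _ _ _)).
- by move=> s; case: (HJ s).
- exact: ltW.
- by move=> z Sz; exact: (lb_occ01 (LB n_gt0) n_gt0 (A_total n_gt0) Sz).
- move=> s; have [Js Hs] := HJ s.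
  apply: (le_trans (@mean_load_tail _ _ _ _ _ _ _ _ _ _ _ _ _ (LB n_gt0) n_gt0 lam_gt0 mu_gt0 _ (@atom_ge0 _ _ _) (atom_total hausT (countS n_gt0) (statP n_gt0).1) (lb_balance (LB n_gt0) hausT n_gt0 lam_gt0 mu_gt0 (countS n_gt0) (statP n_gt0)) _ Js)).
  apply: (@le_trans _ _ ((lam / mu)%:E * (d s / (lam / mu))%:E)%E).
    by rewrite lee_wpmul2l ?lee_fin ?(ltW rho0)//; exact: Hs.
  by rewrite -EFinM mulrC divfK ?gt_eqF.
Qed.

End UniformTails.

(** * Tightness under JLMU *)

Section JLMUTight.
Context (R : realType) (m : nat) (u : 'I_m.+1 -> R -> R).
Variables (lam mu : R) (A : nat -> 'I_m.+1 -> nat) (alpha : 'I_m.+1 -> R).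
Hypothesis u_concave : forall i, concave_on_nneg (u i).
Hypotheses (lam_gt0 : 0 < lam) (mu_gt0 : 0 < mu).
Hypothesis A_total : forall n, (0 < n)%N -> (\sum_i A n i = n)%N.
Hypothesis alpha_gt0 : forall i, 0 < alpha i.
Hypothesis A_cvg : forall i, class_frac R n (A n) i @[n --> \oo] --> alpha i.
Local Notation state := (ell1 (coords m) R).

Lemma jlmu_tight (P : nat -> probability (borel state) R) :
  (forall n, (0 < n)%N ->
    stationary (jlmu_rate u lam mu n) (jlmu_states u lam mu n (A n)) (P n)) ->
  tight [set n | (0 < n)%N] P.
Proof.
move=> statP; have hausT : hausdorff_space state by exact: norm_hausdorff.
have [c c0 [n0 cA]] := class_frac_lower alpha_gt0 A_cvg.
have countS n : (0 < n)%N -> countable (jlmu_states u lam mu n (A n)).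
  move=> n_gt0; apply: sub_countable (countable_occupancy R (A n) n_gt0).
  by apply: subset_card_le => x [].
have LB n (n_gt0 : (0 < n)%N) :=
  jlmu_load_balancer lam mu u_concave n_gt0 (A_total n_gt0).
apply: (tight_eventually hausT (S := fun n => jlmu_states u lam mu n (A n)) (n0 := n0)).
  by move=> n n_gt0; split; [exact: countS|case: (statP n n_gt0)].
move=> e e0.
have [d d0|J [J0 HJ]] := uniform_tails lam_gt0 mu_gt0 A_total hausT LB countS statP (n0 := n0) _ e0.
  have [k dk] : exists k : nat, lam / mu / (c * d) < k.+1%:R.
    by exists (Num.trunc (lam / mu / (c * d))); exact: truncnS_gt.
  (* For [J = k + 2] and mean load at most [lam / mu], the arrival probability is at most
     [lam / mu / ((k + 1) * c) < d]. *)
  exists k.+2 => // n n_gt0 n0n; set pi := atom (P n).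
  have pi0 : forall x, 0 <= pi x := @atom_ge0 _ _ _.
  have kc : 0 <= (k.+1%:R * c)^-1 by rewrite invr_ge0 mulr_ge0// ltW.
  apply: (@le_trans _ _ (mean (jlmu_states u lam mu n (A n)) pi
      (fun z => (k.+1%:R * c)^-1 * load coord_pos z)%R)).
    apply: le_mean => // z [oz _].
    exact: (jlmu_arr_tail_le u_concave n_gt0 (A_total n_gt0) oz (J := k.+2) isT c0 (cA n n0n)).
  have n1 : 0 < n%:R :> R by rewrite ltr0n.
  have := mean_tasks (LB n n_gt0) n_gt0 lam_gt0 mu_gt0 pi0
    (atom_total hausT (countS n n_gt0) (statP n n_gt0).1)
    (lb_balance (LB n n_gt0) hausT n_gt0 lam_gt0 mu_gt0 (countS n n_gt0) (statP n n_gt0)).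
  have l0 z : jlmu_states u lam mu n (A n) z -> 0 <= load coord_pos z.
    by move=> [oz _]; rewrite fsumr_ge0// => p _; exact: (occ_ge0 n_gt0 p oz).
  rewrite /tasks meanZ ?(ltW n1)// EFinM lee_pmul2l// => H.
  rewrite meanZ//; apply: (@le_trans _ _ ((k.+1%:R * c)^-1%:E * (lam / mu)%:E)%E).
    by rewrite lee_wpmul2l// lee_fin.
  rewrite -EFinM lee_fin mulrC ler_pdivrMr ?mulr_gt0//.
  by move: dk; rewrite ltr_pdivrMr ?mulr_gt0//; nra.
exists (@envelope R m J); split; first exact: compact_envelope.
move=> n n_gt0 n0n; rewrite (carried_outside hausT (countS n n_gt0) (statP n n_gt0).1).
  exact: HJ.
by apply: measurable_borel_closed; apply: compact_closed => //; exact: compact_envelope.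
Qed.

End JLMUTight.

(** * SLTA *)

Section TokenLevels.
Context (R : realType) (m : nat) (u : 'I_m.+1 -> R -> R).
Hypothesis u_concave : forall i, concave_on_nneg (u i).
Implicit Types p q : coords m.

Definition higher p : set (coords m) := [set q | coord_pos q /\ rank_lt u p q].

(** The next coordinate is the largest of those below [p]; the next level in the class of [p] shows
    that there are some. *)
Lemma kth_largest_exists k : exists p, coord_pos p /\ (higher p #= `I_k)%card.
Proof.
elim: k => [|k [p [p0 pk]]].
  have [p [p0 pmax]] := @largest_exists _ _ _ u_concave coord_pos (ord0, 1%N)
    (fun _ => id) isT.
  exists p; split=> //; rewrite II0 card_eq0; apply/eqP/seteqP; split=> // q [q0 pq].
  have [E|qp] := pmax q q0; first by move: pq; rewrite E (negPf (rank_lt_irr _ _)).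
  by have := rank_lt_trans pq qp; rewrite (negPf (rank_lt_irr _ _)).
pose C := [set q | coord_pos q /\ rank_lt u q p].
have Cp : C (p.1, p.2.+1).
  by split=> //; rewrite [p in rank_lt _ _ p]surjective_pairing rank_lt_classE.
have [p' [[p'0 p'p] p'max]] := @largest_exists _ _ _ u_concave C _ (fun q => @proj1 _ _) Cp.
exists p'; split=> //; apply/eq_cardSP; exists p; first by split.
suff -> : higher p' `\ p = higher p by [].
apply/seteqP; split=> q [].
  move=> [q0 p'q] /eqP qp; split=> //.
  have [qlp|//] := rank_lt_total u qp.
  have [E|qp'] := p'max q (conj q0 qlp); first by move: p'q; rewrite E (negPf (rank_lt_irr _ _)).
  by have := rank_lt_trans p'q qp'; rewrite (negPf (rank_lt_irr _ _)).
move=> q0 pq; split; first by split=> //; exact: rank_lt_trans pq.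
by move=> /= E; move: pq; rewrite E (negPf (rank_lt_irr _ _)).
Qed.

Lemma kth_largestP k : coord_pos (kth_largest u k) /\
  (higher (kth_largest u k) #= `I_k.-1)%card.
Proof.
have [p Hp] := kth_largest_exists k.-1.
exact: (xgetI _ (Hp : [set p | coord_pos p /\ (higher p #= `I_k.-1)%card] p)).
Qed.

(** Otherwise the [r - 1] coordinates above rank [r] would all lie among the [r - 2] above rank
    [r - 1]. *)
Lemma kth_largest_lt r : (1 < r)%N -> rank_lt u (kth_largest u r) (kth_largest u r.-1).
Proof.
case: r => // r r1; have r0 : (0 < r)%N by [].
rewrite [r.+1.-1]/=.
have [p0 pc] := kth_largestP r; have [p'0 p'c] := kth_largestP r.+1.
apply: contrapT => nlt.
have sub : higher (kth_largest u r.+1) `<=` higher (kth_largest u r).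
  have [->//|E] := eqVneq (kth_largest u r.+1) (kth_largest u r).
  have [//|lt] := rank_lt_total u E.
  by move=> q [q0 lq]; split=> //; exact: rank_lt_trans lq.
have := subset_card_le sub; rewrite (card_le_eql p'c) (card_le_eqr pc) card_le_II /=.
by rewrite leqNgt prednK// leqnn.
Qed.

Lemma higher_finite r : finite_set (higher (kth_largest u r)).
Proof. by apply/finite_setP; exists r.-1; case: (kth_largestP r). Qed.

Lemma token_level_max i r :
  let L := [set j | j = 0%N \/ coord_pos (i, j) /\ rank_lt u (kth_largest u r) (i, j)] in
  L (token_level u i r) /\ forall j, L j -> (j <= token_level u i r)%N.
Proof.
move=> L; have L0 : exists j, `[< L j >] by exists 0%N; apply/asboolP; left.
have bnd j : `[< L j >] -> (j <= \max_(p <- enum_fset (fset_set (higher (kth_largest u r)))) p.2)%N.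
  move=> /asboolP[->//|Lj].
  apply: (@leq_bigmax_seq _ _ predT (fun p : coords m => p.2) (i, j)) => //.
  by rewrite in_fset_set; [exact: mem_set|exact: higher_finite].
have [k Lk kmax] := ex_maxnP L0 bnd.
have Hk : [set j | L j /\ forall j', L j' -> (j' <= j)%N] k.
  by split; [exact/asboolP|move=> j Lj; apply: kmax; exact/asboolP].
exact: (xgetI _ Hk).
Qed.

Lemma token_levelE i r j : (0 < j)%N ->
  rank_lt u (kth_largest u r) (i, j) = (j <= token_level u i r)%N.
Proof.
move=> j0; have [Ll lmax] := token_level_max i r; apply/idP/idP => [lt|jl].
  by apply: lmax; right.
case: Ll jl => [->|[l0 ltl]]; first by rewrite leqNgt j0.
rewrite leq_eqVlt => /orP[/eqP ->//|jl].
exact: rank_lt_trans ltl (rank_lt_class u_concave i j0 jl).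
Qed.

(** Both sides count the coordinates above rank [r], the left one class by class. *)
Lemma sum_token_level r : (\sum_i token_level u i r = r.-1)%N.
Proof.
pose s : seq (coords m) :=
  [seq (i, j) | i <- enum 'I_m.+1, j <- iota 1 (token_level u i r)].
have us : uniq s.
  apply: allpairs_uniq_dep => [|i _|]; [exact: enum_uniq|exact: iota_uniq|].
  by move=> [i j] [k l] _ _ /= [-> ->].
have E : higher (kth_largest u r) = [set` [fset p | p in s]%fset].
  apply/seteqP; split=> -[i j] /=.
    move=> [j0]; rewrite token_levelE// => jl; rewrite inE; apply/allpairsPdep.
    by exists i, j; rewrite mem_enum mem_iota add1n ltnS j0.
  rewrite inE => /allpairsPdep[i' [j' [_ + [-> ->]]]].
  by rewrite mem_iota add1n ltnS => /andP[j0 jl]; split=> //; rewrite token_levelE.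
have [_] := kth_largestP r; rewrite -/(higher _) E => /card_eq_fsetP <-.
rewrite card_fseq undup_id// size_allpairs_dep sumnE big_map big_enum/=.
by apply: eq_bigr => i _; rewrite size_iota.
Qed.

(** The coordinate of rank [r - 1] belongs to this class and lies above the one of rank [r]. *)
Lemma prev_token_level r : (1 < r)%N -> (0 < token_level u (prev_class u r) r)%N.
Proof.
move=> r1; have [p0 _] := kth_largestP r.-1; apply: leq_trans p0 _.
rewrite -token_levelE; last by case: (kth_largestP r.-1).
by move: (kth_largest_lt r1); rewrite /prev_class; case: (kth_largest u r.-1).
Qed.

Lemma token_level_le i r : (token_level u i r <= r.-1)%N.
Proof. by rewrite -sum_token_level (bigD1 i)//= leq_addr. Qed.

End TokenLevels.

(** * Counting pools *)

Section Pools.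
Context (R : realType) (m : nat) (n : nat) (A : 'I_m.+1 -> nat).
Hypothesis n_gt0 : (0 < n)%N.
Local Notation state := (ell1 (coords m) R).
Implicit Types (x : state) (C : set (coords m)) (D : pred 'I_m.+1) (K : 'I_m.+1 -> nat).

Lemma pools_at_ge0 x p : occupancy_states n A x -> coord_pos p -> 0 <= pools_at n x p.
Proof. by move=> ox p0; rewrite mulr_ge0// subr_ge0 (occ_below ox p0). Qed.

Lemma pools_at_out x p L : vanishes x L -> coord_pos p -> p \notin box m L.+1 ->
  pools_at n x p = 0.
Proof.
move=> vx; rewrite mem_box /coord_pos/= => p0; rewrite p0 /= -ltnNge => Lp.
rewrite /pools_at !vx ?subrr ?mulr0//=; first exact: ltnW.
by rewrite -ltnS prednK.
Qed.

Lemma pools_in_box x C L : C `<=` coord_pos -> vanishes x L ->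
  pools_in n x C = \sum_(p <- box m L.+1 | p \in C) pools_at n x p.
Proof.
by move=> Cpos vx; apply: fsum_box => p /Cpos p0; exact: pools_at_out.
Qed.

(** Common form of [green], [green_in], [green_out] and [yellow]; the number of pools in such a set
    telescopes. *)
Definition below_level D K : set (coords m) :=
  [set p | [/\ coord_pos p, D p.1 & (p.2 <= K p.1)%N]].

Lemma below_level_pos D K : below_level D K `<=` coord_pos.
Proof. by move=> p []. Qed.

Lemma telescope_pools x i J L : (J <= L)%N ->
  \sum_(J.+1 <= j < L.+1) (x (i, j.-1) - x (i, j)) = x (i, J) - x (i, L).
Proof.
move=> JL; rewrite big_add1/= (telescope_sumr_eq (fun j => - x (i, j)))//.
  by rewrite opprK addrC.
by move=> j _; rewrite opprK addrC.
Qed.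

Lemma pools_below_level x D K :
  pools_in n x (below_level D K) =
  n%:R * \sum_(i | D i) (x (i, 0%N) - x (i, K i)).
Proof.
pose M := \max_i K i.
rewrite /pools_in (fsum_box (L := M)); last first.
  move=> p [p0 _ pK]; rewrite mem_box p0 /= => /negP[].
  by apply: leq_trans pK _; exact: leq_bigmax.
rewrite big_mkcond/= sum_box mulr_sumr [RHS]big_mkcond/=; apply: eq_bigr => i _.
rewrite -big_mkcond/=.
have KM : (K i <= M)%N by exact: leq_bigmax.
have [Di|Di] := boolP (D i); last first.
  by rewrite big1// => j /set_mem[_ /= Di']; rewrite Di' in Di.
rewrite -(@telescope_pools x i 0 (K i))// mulr_sumr.
rewrite [RHS](big_nat_widen _ _ M.+1)//= [LHS]big_nat_cond [RHS]big_nat_cond.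
apply: eq_bigl => j; case: (0 < j < M.+1)%N / andP => //= -[j0 _].
by apply/idP/idP => [/set_mem[]//|jK]; apply: mem_set; split.
Qed.

Lemma pools_tail x J : (exists L, vanishes x L) ->
  pools_in n x (tail J.+1) = n%:R * \sum_i x (i, J).
Proof.
move=> [L0 v0]; pose L := maxn L0 J; have vx : vanishes x L := vanishesW (leq_maxl _ _) v0.
rewrite (pools_in_box _ vx); last exact: tail_pos.
rewrite sum_tail_box// mulr_sumr; apply: eq_bigr => i _.
rewrite -mulr_sumr telescope_pools; last by rewrite leqW// leq_maxr.
by rewrite (vx (i, L.+1))// subr0.
Qed.

Lemma pools_coord_pos x : (\sum_i A i = n)%N -> occupancy_states n A x ->
  pools_in n x coord_pos = n%:R.
Proof.
move=> An ox; rewrite -tail1 pools_tail; last exact: occ_vanishes n_gt0 _ ox.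
under eq_bigr do rewrite (occ_frac _ ox).
by rewrite -mulr_suml -natr_sum An mulfV ?mulr1// pnatr_eq0 -lt0n.
Qed.

End Pools.

Section SLTA.
Context (R : realType) (m : nat) (u : 'I_m.+1 -> R -> R).
Variables (lam mu : R) (n : nat) (A : 'I_m.+1 -> nat) (beta : R).
Hypothesis u_concave : forall i, concave_on_nneg (u i).
Hypotheses (n_gt0 : (0 < n)%N) (lam_gt0 : 0 < lam) (mu_gt0 : 0 < mu).
Hypothesis A_total : (\sum_i A i = n)%N.
Local Notation state := (ell1 (coords m) R).
Implicit Types (x : state) (r : nat) (z : state * nat).
Local Notation level r := (fun i => token_level u i r).

Lemma greenE r : green u r = below_level xpredT (level r).
Proof.
apply/seteqP; split=> p /=; rewrite /green /below_level /=.
  by move=> [p0 pl]; split=> //; rewrite -(prednK p0).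
by move=> [p0 _ pl]; split=> //; rewrite prednK.
Qed.

Lemma green_inE r : green_in u r = below_level (pred1 (prev_class u r)) (level r).
Proof.
apply/seteqP; split=> p; rewrite /green_in greenE.
  by move=> [[p0 _ pl] /= /eqP pp].
by move=> [p0 /eqP pp pl].
Qed.

Lemma green_outE r : green_out u r = below_level (predC1 (prev_class u r)) (level r).
Proof.
apply/seteqP; split=> p; rewrite /green_out greenE.
  by move=> [[p0 _ pl] /= /eqP pp].
by move=> [p0 /eqP pp pl].
Qed.

Lemma yellowE r : yellow u r =
  below_level (pred1 (kth_largest u r).1) (fun i => (token_level u i r).+1).
Proof.
apply/seteqP; split=> p /=; rewrite /yellow /below_level /=.
  by move=> [p0 /eqP pp pl]; split=> //; rewrite -(prednK p0) ltnS.
by move=> [p0 /eqP pp pl]; split=> //; rewrite -ltnS prednK.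
Qed.

Lemma candidates_pos x r : slta_candidates u n x r `<=` coord_pos.
Proof.
rewrite /slta_candidates green_outE green_inE yellowE.
by do 3?[case: ifP => _]; try exact: below_level_pos.
Qed.

Lemma pools_greenE x r : pools_in n x (green u r) =
  pools_in n x (green_in u r) + pools_in n x (green_out u r).
Proof.
rewrite greenE green_inE green_outE !pools_below_level -mulrDr; congr (_ * _).
by rewrite (bigID (pred1 (prev_class u r)))/=.
Qed.

(** Makes the denominator of [slta_prob] positive. If there are green pools but none outside class
    [i_(r-1)], then [green_in] holds them all. *)
Lemma candidates_gt0 x r : occupancy_states n A x ->
  0 < pools_in n x (slta_candidates u n x r).
Proof.
move=> ox; rewrite /slta_candidates; case: ifPn => // out0.
case: ifPn => [g0|_]; last first.
  by case: ifPn => // _; rewrite (pools_coord_pos n_gt0 A_total ox) ltr0n.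
by move: g0 out0; rewrite pools_greenE -leNgt; lra.
Qed.

Lemma sum_slta_prob x r C : \sum_(p \in C) slta_prob u n x r p =
  pools_in n x (C `&` slta_candidates u n x r) /
  pools_in n x (slta_candidates u n x r).
Proof.
rewrite /slta_prob -mulr_fsuml; congr (_ / _).
rewrite /pools_in setIC fsbig_mkcondl; apply: eq_fsbigr => p _.
by rewrite indicE; case: ifP; rewrite ?mul1r ?mul0r.
Qed.

Definition slta_add z p : state * nat := (add_task n z.1 p, slta_next u n beta z.1 z.2).
Definition slta_rem z p : state * nat := (remove_task n z.1 p, z.2).

Lemma slta_next_ge1 x r : (0 < r)%N -> (0 < slta_next u n beta x r)%N.
Proof. by move=> r0; rewrite /slta_next; case: ifP => [/and3P[]|_]; [case: r r0 => [|[]]|case: ifP]. Qed.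

Lemma slta_load_balancer : load_balancer lam mu n A (fun z : state * nat => z.1)
  (fun z p => slta_prob u n z.1 z.2 p) slta_add slta_rem
  (slta_rate u lam mu n beta) (slta_states u lam mu n A beta).
Proof.
split=> //.
- by move=> z [].
- move=> z p [oz _ _]; rewrite /slta_prob indicE.
  case: (boolP (p \in _)) => [/set_mem/candidates_pos p0|_]; last by rewrite !mul0r.
  by rewrite mul1r; apply: divr_ge0; [exact: (pools_at_ge0 oz p0)|exact/ltW/candidates_gt0].
- move=> z p [oz _ _]; rewrite /slta_prob indicE.
  case: (boolP (p \in _)) => [/set_mem/candidates_pos p0|_]; last by rewrite !mul0r eqxx.
  rewrite mul1r mulf_eq0 negb_or => /andP[pa _]; split=> //.
  rewrite lt_neqAle (occ_below oz p0) andbT; apply: contraNneq pa => E.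
  by rewrite /pools_at -E subrr mulr0.
- move=> z [oz _ _]; rewrite sum_slta_prob; have /setIidPr -> := @candidates_pos z.1 z.2; rewrite mulfV//.
  by rewrite gt_eqF// candidates_gt0.
- move=> [x r] [y r'] [oz _ _]; rewrite /slta_rate /slta_add /slta_rem /=; congr (_ + _).
    have [->|rr] := eqVneq r' (slta_next u n beta x r).
      rewrite mul1r -mulr_fsumr; congr (_ * _); apply: eq_fsbigl.
      by apply/seteqP; split=> p /= [p0 E]; split=> //; [rewrite E|case: E].
    rewrite mul0r fsbig1 ?mulr0// => p [_ [_ E]].
    by rewrite E eqxx in rr.
  rewrite /departure_rate; have [->|rr] := eqVneq r' r.
    rewrite mul1r; apply: eq_fsbigl.
    by apply/seteqP; split=> p /= [p0 E]; split=> //; [rewrite E|case: E].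
  rewrite mul0r fsbig1// => p [_ [_ E]].
  by rewrite E eqxx in rr.
- move=> z y [oz r1 rz] oy yE zy; split=> //; last exact: reachable_step zy.
  by case: yE => [[p [_ _ ->]]|[p _ ->]] //=; exact: slta_next_ge1.
Qed.

End SLTA.

Section ArrivalMean.
Context (R : realType) (m : nat) (T : ptopologicalType) (lam mu : R) (n : nat)
  (A : 'I_m.+1 -> nat) (occ : T -> ell1 (coords m) R) (arr : T -> coords m -> R)
  (add rem : T -> coords m -> T) (rate : T -> T -> R) (S : set T).
Hypothesis LB : load_balancer lam mu n A occ arr add rem rate S.
Hypothesis n_gt0 : (0 < n)%N.

Lemma arr_mean_le z (F : coords m -> R) (B : R) : S z ->
  (forall p, arr z p != 0 -> F p <= B) ->
  \sum_(p \in coord_pos) arr z p * F p <= B.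
Proof.
move=> Sz FB; have [L vx] := lb_vanishes LB n_gt0 Sz.
rewrite -[leRHS]mul1r -(lb_arr_sum LB Sz) (fsum_box (L := L.+1)); last first.
  by move=> p _ pL; rewrite (arr_out LB Sz vx pL) mul0r.
rewrite (fsum_box (L := L.+1)); last by move=> p _ pL; exact: (arr_out LB Sz vx pL).
rewrite mulr_suml; apply: ler_sum => p _.
have [->|a0] := eqVneq (arr z p) 0; first by rewrite !mul0r.
by rewrite ler_wpM2l ?FB// (lb_arr_ge0 LB).
Qed.

Lemma arr_tail_le1 z J : S z -> (0 < J)%N -> \sum_(p \in tail J) arr z p <= 1.
Proof.
move=> Sz J0; rewrite (_ : \sum_(p \in tail J) arr z p =
    \sum_(p \in coord_pos) arr z p * (p \in tail J)%:R).
  by apply: arr_mean_le => // p _; case: (p \in _).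
rewrite [LHS]fsbig_mkcond [RHS]fsbig_mkcond; apply: eq_fsbigr => p _.
rewrite /patch; case: (boolP (p \in tail J)) => [/set_mem/(tail_pos J0)/mem_set ->|_].
  by rewrite mulr1.
by rewrite mulr0; case: ifP.
Qed.

End ArrivalMean.

Section SingleClass.
Context (R : realType) (m : nat).
Implicit Types (x : ell1 (coords m) R).

Lemma fsum_class (F : coords m -> R) i k :
  \sum_(p \in below_level (pred1 i) (fun=> k)) F p = \sum_(1 <= j < k.+1) F (i, j).
Proof.
rewrite (fsum_box (L := k)); last first.
  by move=> p [p0 _ pk]; rewrite mem_box p0 pk.
rewrite big_mkcond/= sum_box (bigD1 i)//= [X in _ + X]big1 ?addr0 => [|i' ii'].
  rewrite big_nat [RHS]big_nat; apply: eq_bigr => j /andP[j0 jk].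
  by rewrite ifT//; apply: mem_set; split=> //=.
apply: big1_seq => j _; case: ifP => // /set_mem[_ /= /eqP E].
by rewrite E eqxx in ii'.
Qed.

(** The weights [p.2] are at least 1, and the unweighted sum telescopes. *)
Lemma unload_class x i k : (forall j, x (i, j.+1) <= x (i, j)) ->
  x (i, 1%N) - x (i, k.+1) <= unload (below_level (pred1 i) (fun=> k)) x.
Proof.
move=> xd; rewrite /unload fsum_class.
rewrite -(@telescope_pools _ _ x i 1 k.+1)// big_add1/= /above/=.
apply: ler_sum_nat => j /andP[j0 _].
by rewrite -[leLHS]mul1r ler_wpM2r ?subr_ge0// ler1n.
Qed.

End SingleClass.

(** * Drift of the SLTA chain *)

Section SLTADrift.
Context (R : realType) (m : nat) (u : 'I_m.+1 -> R -> R).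
Variables (lam mu : R) (n : nat) (A : 'I_m.+1 -> nat) (beta : R).
Hypothesis u_concave : forall i, concave_on_nneg (u i).
Hypotheses (n_gt0 : (0 < n)%N) (lam_gt0 : 0 < lam) (mu_gt0 : 0 < mu).
Hypothesis A_total : (\sum_i A i = n)%N.
Variable c : R.
Hypotheses (beta_gt0 : 0 < beta) (beta_le : beta <= c / 2) (c_gt0 : 0 < c).
Hypothesis frac_ge : forall i, c <= class_frac R n A i.
Local Notation state := (ell1 (coords m) R).
Implicit Types (x : state) (r : nat) (z : state * nat).

Let n0 : 0 < n%:R :> R. Proof. by rewrite ltr0n. Qed.

(** In each class fewer than [n * beta] pools are short of the token level, and [beta <= c / 2], so
    at least [n * c / 2] pools reach it; the token levels sum to [r - 1]. *)
Lemma few_green x r : occupancy_states n A x ->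
  pools_in n x (green u r) < n%:R * beta ->
  r.-1%:R * (c / 2) <= load coord_pos x.
Proof.
move=> ox; rewrite greenE pools_below_level ltr_pM2l// => few.
apply: le_trans (load_levels n_gt0 (fun i => token_level u i r) ox).
rewrite -(sum_token_level u_concave) natr_sum mulr_suml; apply: ler_sum => i _.
rewrite ler_wpM2l//; have := few; rewrite (bigD1 i)//= => few_i.
have : 0 <= \sum_(j < m.+1 | j != i) (x (j, 0%N) - x (j, token_level u j r)).
  by apply: sumr_ge0 => j _; rewrite subr_ge0 (occ_mono _ ox).
have := frac_ge i; rewrite -(occ_frac i ox); have := beta_le; lra.
Qed.

(** Token counts are integers, so fewer than one means none. *)
Lemma no_green_in x r : occupancy_states n A x ->
  pools_in n x (green_in u r) < 1 ->
  x (prev_class u r, 0%N) <= x (prev_class u r, token_level u (prev_class u r) r).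
Proof.
move=> ox; rewrite green_inE pools_below_level big_pred1_eq => g1.
set i := prev_class u r in g1 *.
rewrite leNgt; apply/negP => gap.
have := occ_gap n_gt0 ox gap; move: g1; rewrite ltNge => /negP g1 H; apply: g1.
by move: H; rewrite -lerBrDl -(ler_pM2l n0) mulfV ?gt_eqF.
Qed.

Lemma slta_next_le x r : (slta_next u n beta x r <= r.+1)%N.
Proof.
rewrite /slta_next; case: ifP => _; first by rewrite (leq_trans (leq_pred r)).
by case: ifP => _.
Qed.

Lemma slta_next_green x r : n%:R * beta <= pools_in n x (green u r) -> (1 < r)%N ->
  slta_next u n beta x r = if 1 <= pools_in n x (green_in u r) then r.-1 else r.
Proof.
move=> g r1; rewrite /slta_next r1 g /=; case: ifP => // _.
by rewrite gt_eqF// (lt_le_trans _ g)// mulr_gt0.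
Qed.

Lemma candidates_green_out x r : occupancy_states n A x ->
  n%:R * beta <= pools_in n x (green u r) -> pools_in n x (green_in u r) < 1 ->
  slta_candidates u n x r = green_out u r.
Proof.
move=> ox g gin; rewrite /slta_candidates ifT//.
have := no_green_in ox gin; move: g; rewrite pools_greenE {1}green_inE.
rewrite pools_below_level big_pred1_eq => g full.
have : 0 < n%:R * beta by rewrite mulr_gt0.
have : n%:R * (x (prev_class u r, 0%N) - x (prev_class u r, token_level u (prev_class u r) r)) <= 0.
  by rewrite pmulr_rle0// subr_le0.
lra.
Qed.

Lemma load_class_le x i k : occupancy_states n A x ->
  load (below_level (pred1 i) (fun=> k)) x <= k%:R.
Proof.
move=> ox; rewrite /load fsum_class.
apply: (@le_trans _ _ (\sum_(1 <= j < k.+1) 1)).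
  apply: ler_sum_nat => j _; apply: le_trans (occ_le (i, j) ox) _.
  rewrite ler_pdivrMr// mul1r ler_nat -A_total (bigD1 i)//=.
  exact: leq_addr.
by rewrite sumr_const_nat subn1/=.
Qed.

Variables (K : R) (k r0 : nat).
Hypothesis K_gt0 : 0 < K.
Hypothesis K_k : K <= k.+1%:R * (c / 2).
Hypothesis K_r0 : K <= r0.-1%:R * (c / 2).

(* The factor [k.+1] makes the decrease of [r] outweigh the second term, which is
   at most [k] but is replaced by the mass of another class when [r] changes. *)
Definition slta_lyapunov z : R := k.+1%:R * (z.2 - r0)%N%:R +
  (r0 < z.2)%N%:R * load (below_level (pred1 (prev_class u z.2)) (fun=> k)) z.1.

(** The smaller of the two decrease rates: at least [lam] from arrivals that lower [r], and
    [mu * (c / 2)] from departures in class [i_(r-1)]. *)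
Let eta := Num.min lam (mu * (c / 2)).

(** The right-hand side pays for loads of at least [K]. For smaller loads and [r >= r0], [few_green]
    yields at least [n * beta] green tokens; whether class [i_(r-1)] has some decides which term of
    the Lyapunov function decreases. *)
Lemma slta_drift z : slta_states u lam mu n A beta z ->
  generator lam mu n (fun z => z.1) (fun z p => slta_prob u n z.1 z.2 p)
    (slta_add u n beta) (slta_rem n) slta_lyapunov z +
  eta * ((r0 < z.2)%N && (load coord_pos z.1 < K))%:R <=
  n%:R * lam * (2 * k.+1%:R) * (K <= load coord_pos z.1)%R%:R.
Proof.
move=> Sz; have LB := slta_load_balancer u lam mu beta n_gt0 A_total.
have ox : occupancy_states n A z.1 by case: Sz.
case: z Sz ox => x r Sz /= ox.
set i := prev_class u r; pose D := below_level (pred1 i) (fun=> k).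
have Dpos : D `<=` coord_pos by exact: below_level_pos.
pose ar (z : state * nat) p := slta_prob u n z.1 z.2 p; pose V := slta_lyapunov.
have r01 : (1 < r0)%N.
  case: (r0) K_r0 => [|[|//]]; rewrite /= mul0r => H;
  by have := lt_le_trans K_gt0 H; rewrite ltxx.
have load0 j (y : state) : occupancy_states n A y -> 0 <= load (below_level (pred1 j) (fun=> k)) y.
  by move=> oy; rewrite fsumr_ge0// => p _; exact: (occ_ge0 n_gt0 p oy).
have oadd p : ar (x, r) p != 0 -> occupancy_states n A (add_task n x p).
  by move=> a0; have [p0 xp] := lb_arr_adm LB Sz a0; exact: occ_add.
pose dn := unload D x.
have dn_ge : x (i, 1%N) - x (i, k.+1) <= dn by apply: unload_class => j; exact: (occ_above (i, j) ox).
have dn0 : 0 <= dn by apply: le_trans dn_ge; rewrite subr_ge0 (occ_mono _ ox).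
have depE : n%:R * mu * (\sum_(p \in coord_pos) p.2%:R * (x p - x (above p)) *
    (V (slta_rem n (x, r) p) - V (x, r))) = - ((r0 < r)%N%:R * (mu * dn)).
  rewrite -mulrN -(dep_load LB n_gt0 Sz Dpos)/= mulrCA; congr (_ * _).
  rewrite mulr_fsumr; apply: eq_fsbigr => p _; rewrite /V /slta_lyapunov /slta_rem /=; ring.
rewrite /generator -/V [X in _ + X + _]depE.
set up := \sum_(p \in coord_pos) _.
have upB B : (forall p, ar (x, r) p != 0 -> V (slta_add u n beta (x, r) p) - V (x, r) <= B) -> up <= B.
  by move=> H; apply: (arr_mean_le LB n_gt0 Sz).
have nl : 0 < n%:R * lam by rewrite mulr_gt0.
have [big|small] := leP K (load coord_pos x).
  rewrite andbF mulr0 addr0 mulr1.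
  (* [r] grows by at most one and the mass in the second term is at most [k], so the increase is at
     most [2 * k + 1]. *)
  have : up <= 2 * k.+1%:R.
    apply: upB => p /oadd oy; rewrite /V /slta_lyapunov /=.
    have := load_class_le (prev_class u (slta_next u n beta x r)) k oy.
    set l1 := load _ (add_task n x p) => l1k.
    have l10 : 0 <= l1 by exact: load0.
    have l20 := load0 (prev_class u r) x ox.
    set l2 := load _ x in l20 *.
    have e1 : (slta_next u n beta x r - r0)%N%:R <= (r - r0)%N%:R + 1 :> R.
      rewrite natr1 ler_nat leq_subLR addnS (leq_trans (slta_next_le x r))//.
      by rewrite ltnS -leq_subLR.
    have e2 : (r0 < slta_next u n beta x r)%N%:R * l1 <= k%:R.
      by case: (r0 < _)%N; rewrite ?mul1r ?mul0r.
    have e3 : 0 <= (r0 < r)%N%:R * l2 by rewrite mulr_ge0.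
    have k1 : k.+1%:R = k%:R + 1 :> R by rewrite natr1.
    have k0 : 0 <= k.+1%:R :> R by [].
    have := ler_wpM2l k0 e1; rewrite mulrDr k1; lra.
  have : 0 <= (r0 < r)%N%:R * (mu * dn) by rewrite !mulr_ge0// ltW.
  by move=> d0 /(ler_wpM2l (ltW nl)); lra.
rewrite mulr0 andbT.
have notfew : (r0 <= r)%N -> n%:R * beta <= pools_in n x (green u r).
  move=> r0r; rewrite leNgt; apply/negP => /(few_green ox) few.
  have := le_lt_trans few small; apply/negP; rewrite -leNgt.
  apply: le_trans K_r0 _; rewrite ler_wpM2r ?divr_ge0 ?(ltW c_gt0)// ler_nat.
  by rewrite -!subn1 leq_sub2r.
(* For [r <= r0] the function is 0 and an arrival keeps it at 0: at [r = r0] the green tokens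
   prevent [r] from growing. *)
have [r0r|rr0] := ltnP r0 r; last first.
  have next_le : (slta_next u n beta x r <= r0)%N.
    have [rlt|] := ltnP r r0; first exact: leq_trans (slta_next_le _ _) _.
    move=> r0r; have rE : r = r0 by apply/eqP; rewrite eqn_leq rr0.
    rewrite slta_next_green ?notfew// rE//.
    by case: ifP => // _; exact: leq_pred.
  have : up <= 0.
    apply: upB => p _; rewrite /V /slta_lyapunov /= ltnNge next_le ltnNge rr0 /= !mul0r.
    have -> : (slta_next u n beta x r - r0 = 0)%N by apply/eqP; rewrite subn_eq0.
    by have -> : (r - r0 = 0)%N; [apply/eqP; rewrite subn_eq0|rewrite mulr0 subrr].
  by move=> /(ler_wpM2l (ltW nl)); rewrite /= mul0r !mulr0 subr0 addr0.
have r1 : (1 < r)%N by exact: ltn_trans r0r.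
have g := notfew (ltnW r0r).
have := slta_next_green g r1.
rewrite !mul1r mulr1; case: ifPn => [gin nextE|].
  (* [r] decreases: the first term loses [k + 1] and the second gains at most [k]. *)
  have : up <= -1.
    apply: upB => p /oadd oy; rewrite /V /slta_lyapunov /= nextE.
    have := load_class_le (prev_class u r.-1) k oy.
    set l1 := load _ (add_task n x p) => l1k.
    have l20 := load0 (prev_class u r) x ox.
    set l2 := load _ x in l20 *.
    have e2 : (r0 < r.-1)%N%:R * l1 <= k%:R by case: (r0 < _)%N; rewrite ?mul1r ?mul0r.
    have e3 : 0 <= (r0 < r)%N%:R * l2 by rewrite mulr_ge0.
    have -> : (r - r0)%N%:R = (r.-1 - r0)%N%:R + 1 :> R.
      by rewrite natr1 -[in LHS](prednK (ltnW r1)) subSn// -ltnS prednK// ltnW.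
    rewrite -[k.+1%:R]natr1; lra.
  move=> /(ler_wpM2l (ltW nl)) upn.
  have : eta <= n%:R * lam.
    by rewrite (le_trans (_ : _ <= lam)) ?ge_min ?lexx// ler_peMl ?(ltW lam_gt0)// ler1n.
  have : 0 <= mu * dn by rewrite mulr_ge0// ltW.
  lra.
rewrite -ltNge => gin nextE.
(* Class [i] has no green token: [r] is kept and the task goes to another class, so an arrival
   changes neither term. *)
have : up <= 0.
  apply: upB => p pa; rewrite /V /slta_lyapunov /= nextE r0r !mul1r.
  have pi : p.1 != i.
    move: pa; rewrite /ar /slta_prob /= (candidates_green_out ox g gin) indicE green_outE.
    by case: (boolP (p \in _)) => [/set_mem[]//|_]; rewrite !mul0r eqxx.
  have [L vx] := occ_vanishes n_gt0 ox.
  rewrite -/i -/D /add_task (load_shift p n%:R^-1 Dpos vx).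
  have -> : p \in D = false by apply/negbTE/negP => /set_mem[_ /= pi' _]; rewrite pi' in pi.
  by rewrite mulr0 addr0 subrr.
move=> /(ler_wpM2l (ltW nl)) upn.
(* All pools of class [i] reach its token level, hence hold a task, while a load below [K] allows at
   most [n * c / 2] of them to hold [k + 1] tasks. Departures thus drain the first [k] levels at
   rate at least [mu * (c / 2)]. *)
have x1 : c <= x (i, 1%N).
  apply: le_trans (occ_mono i ox (prev_token_level u_concave r1)).
  by apply: le_trans (no_green_in ox gin); rewrite (occ_frac _ ox).
have xk : x (i, k.+1) <= c / 2.
  rewrite -(@ler_pM2l _ k.+1%:R)//; apply: le_trans K_k; apply: le_trans (ltW small).
  have := load_levels n_gt0 (fun j => if j == i then k.+1 else 0%N) ox.
  apply: le_trans; rewrite (bigD1 i)//= eqxx lerDl sumr_ge0// => j /negPf ->.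
  by rewrite mul0r.
have : mu * (c / 2) <= mu * dn by rewrite ler_pM2l//; lra.
have : eta <= mu * (c / 2) by rewrite ge_min lexx orbT.
lra.
Qed.

End SLTADrift.

(** Raising [n] by one multiplies the power by at most [1 / 4] and the prefactor by at most 2. This
    absorbs the factor [n] of the arrival rate. *)
Lemma natr_mul_expr_le (R : realFieldType) (y : R) n : 0 <= y <= 1 / 2 -> (0 < n)%N ->
  n%:R * y ^+ n.*2 <= y ^+ 2.
Proof.
move=> /andP[y0 y1]; elim: n => // -[|n] IH _; first by rewrite mul1r.
have := IH isT; rewrite (doubleS n.+1) (exprS y (n.+1.*2).+1) (exprS y n.+1.*2).
set Y := y ^+ n.+1.*2 => H.
have Y0 : 0 <= Y by exact: exprn_ge0.
have e1 : n.+2%:R = n.+1%:R + 1 :> R by rewrite natr1.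
have e2 : 1 <= n.+1%:R :> R by rewrite ler1n.
apply: le_trans H; rewrite e1; set N := n.+1%:R in e2 *.
have : y * y <= 1 / 4 by nra.
have : (N + 1) <= 2 * N by lra.
move=> h1 h2.
have : (N + 1) * (y * y) <= N.
  have : 0 <= y * y by rewrite mulr_ge0.
  nra.
move=> /(ler_wpM2r Y0); apply: le_trans; rewrite -!mulrA; lra.
Qed.

(** * Arrivals to high levels and the tail of [r] *)

Section SLTALevel.
Context (R : realType) (m : nat) (u : 'I_m.+1 -> R -> R).
Variables (lam mu : R) (n : nat) (A : 'I_m.+1 -> nat) (beta : R).
Hypothesis u_concave : forall i, concave_on_nneg (u i).
Hypotheses (n_gt0 : (0 < n)%N) (lam_gt0 : 0 < lam) (mu_gt0 : 0 < mu).
Hypothesis A_total : (\sum_i A i = n)%N.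
Local Notation state := (ell1 (coords m) R).
Implicit Types (x : state) (z : state * nat).
Local Notation S := (slta_states u lam mu n A beta).

(** For [r <= r0], token holders receive tasks at levels at most [r0 < J]. The tail is reached only
    by a uniform draw among all pools, which finds at least [J - 1] tasks with probability at most
    the load divided by [J - 1]. *)
Lemma slta_arr_tail z r0 J : S z -> (r0 < J)%N -> (1 < J)%N ->
  \sum_(p \in tail J) slta_prob u n z.1 z.2 p <=
  (r0 < z.2)%N%:R + J.-1%:R^-1 * load coord_pos z.1.
Proof.
move=> Sz r0J J1; have LB := slta_load_balancer u lam mu beta n_gt0 A_total.
have J0 : (0 < J)%N by exact: ltnW.
case: z Sz => x r Sz /=; have ox : occupancy_states n A x by case: Sz.
have l0 : 0 <= J.-1%:R^-1 * load coord_pos x.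
  by rewrite mulr_ge0 ?invr_ge0// fsumr_ge0// => p _; exact: (occ_ge0 n_gt0 p ox).
have [r0r|rr0] := ltnP r0 r.
  apply: (@le_trans _ _ 1); last by rewrite lerDl.
  exact: (arr_tail_le1 LB n_gt0 Sz J0).
rewrite add0r sum_slta_prob.
have low D (K : 'I_m.+1 -> nat) : (forall i, K i < J)%N -> tail J `&` below_level D K = set0.
  move=> KJ; apply/seteqP; split=> // p [Jp [_ _ pK]].
  by have := leq_ltn_trans (leq_trans Jp pK) (KJ p.1); rewrite ltnn.
have lvl i : (token_level u i r < r.+1)%N.
  by rewrite ltnS (leq_trans (token_level_le u_concave i r))// leq_pred.
rewrite /slta_candidates green_outE green_inE yellowE.
have lvlJ i : (token_level u i r < J)%N.
  have := token_level_le u_concave i r; case: (r) rr0 => [|r'] /= rr0 le.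
    by rewrite (leq_ltn_trans le).
  by rewrite (leq_ltn_trans le)// (leq_ltn_trans _ r0J)// ltnW.
case: ifP => _; first by rewrite low// /pools_in fsbig_set0 mul0r.
case: ifP => _; first by rewrite low// /pools_in fsbig_set0 mul0r.
have [r_eq0|r_gt0] := posnP r.
  by case: Sz => _ /=; rewrite r_eq0.
case: ifP => _.
  rewrite low ?/pools_in ?fsbig_set0 ?mul0r// => i.
  apply: leq_ltn_trans r0J; apply: leq_trans rr0.
  by rewrite -[leqRHS](prednK r_gt0) ltnS token_level_le.
rewrite (setIidl (@tail_pos m J J0)) (pools_coord_pos n_gt0 A_total ox).
rewrite -{1}(prednK J0) pools_tail; last exact: occ_vanishes n_gt0 _ ox.
have J10 : 0 < J.-1%:R :> R by rewrite ltr0n -subn1 subn_gt0.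
rewrite mulrAC mulfV ?mul1r ?pnatr_eq0 -?lt0n// [leRHS]mulrC ler_pdivlMr//.
rewrite mulr_suml; apply: le_trans (load_levels n_gt0 (fun=> J.-1) ox).
by apply: ler_sum => i _; rewrite mulrC.
Qed.

Variable c : R.
Hypotheses (beta_gt0 : 0 < beta) (beta_le : beta <= c / 2) (c_gt0 : 0 < c).
Hypothesis frac_ge : forall i, c <= class_frac R n A i.
Variable P : probability (borel (state * nat)%type) R.
Hypothesis hausT : hausdorff_space (state * nat)%type.
Hypothesis countS : countable S.
Hypothesis statP : stationary (slta_rate u lam mu n beta) S P.
Variables (K kappa : R) (k r0 : nat).
Hypothesis kappa_gt0 : 0 < kappa.
Hypothesis kappa_rho : 2 * (lam / mu) <= kappa.
Hypothesis K_kappa : K = kappa + 4.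
Hypothesis K_k : K <= k.+1%:R * (c / 2).
Hypothesis K_r0 : K <= r0.-1%:R * (c / 2).

Let eta := Num.min lam (mu * (c / 2)).

(** The event is split by whether the load reaches [K]. Below [K], the drift inequality bounds its
    probability by that of a heavy load times a factor of order [n], which the geometric decay
    absorbs. *)
Lemma slta_level_prob :
  (prob S (atom P) (fun z => r0 < z.2)%N <=
   ((lam * (2 * k.+1%:R) / eta + 1) * (lam / mu / kappa) ^+ 2)%:E)%E.
Proof.
have LB := slta_load_balancer u lam mu beta n_gt0 A_total.
have pi0 := @atom_ge0 R _ P.
have tot := atom_total hausT countS statP.1.
have bal := lb_balance LB hausT n_gt0 lam_gt0 mu_gt0 countS statP.
have nn : 0 < n%:R :> R by rewrite ltr0n.
have K0 : 0 < K by rewrite K_kappa addr_gt0.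
have eta0 : 0 < eta by rewrite lt_min lam_gt0 mulr_gt0// divr_gt0.
have rho0 : 0 < lam / mu by rewrite divr_gt0.
pose big z := K <= load coord_pos z.1.
pose w : R := lam * (2 * k.+1%:R).
have w0 : 0 <= w by rewrite mulr_ge0 ?(ltW lam_gt0).
set y := lam / mu / kappa.
have y01 : 0 <= y <= 1 / 2.
  rewrite divr_ge0 ?(ltW rho0) ?(ltW kappa_gt0)//= ler_pdivrMr//.
  by move: kappa_rho; set q := lam / mu => H; lra.
have pbig : (prob S (atom P) big <= (y ^+ n.*2)%:E)%E.
  (* With [theta = n * kappa] and [l = 2 * n], the threshold [theta + 2 * l] is [n * K]. *)
  have := prob_tasks LB n_gt0 lam_gt0 mu_gt0 pi0 tot bal n.*2 (mulr_gt0 nn kappa_gt0).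
  have -> : n%:R * (lam / mu) / (n%:R * kappa) = y.
    by rewrite /y; field; rewrite !gt_eqF.
  apply: le_trans; apply: le_mean => // z _; rewrite /big K_kappa /tasks.
  have -> : n%:R * kappa + n.*2.*2%:R = n%:R * (kappa + 4).
    by rewrite mulrDr -natrM -!muln2 -mulnA.
  by rewrite ler_pM2l.
have nbig : (n%:R%:E * prob S (atom P) big <= (y ^+ 2)%:E)%E.
  apply: (@le_trans _ _ (n%:R%:E * (y ^+ n.*2)%:E)%E).
    by rewrite lee_wpmul2l ?lee_fin// ltW.
  by rewrite -EFinM lee_fin natr_mul_expr_le.
have big2 : (prob S (atom P) big <= (y ^+ 2)%:E)%E.
  apply: le_trans nbig; rewrite -[leLHS]mul1e lee_wpmul2r ?prob_ge0//.
  by rewrite lee_fin ler1n.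
have dr : (mean S (atom P) (fun z => eta * ((r0 < z.2)%N && (load coord_pos z.1 < K))%:R)%R <=
           mean S (atom P) (fun z => (n%:R * w) * (big z)%:R)%R)%E.
  apply: (lb_drift LB n_gt0 lam_gt0 mu_gt0 pi0 tot bal (f := slta_lyapunov u k r0)).
    move=> z Sz; split.
    - rewrite addr_ge0// mulr_ge0// fsumr_ge0// => p _.
      exact: (occ_ge0 n_gt0 p (lb_occ LB Sz)).
    - by rewrite !mulr_ge0// ltW.
    - by rewrite mulr_ge0// ltW.
  move=> z Sz; rewrite /w mulrA.
  exact: (slta_drift u_concave n_gt0 lam_gt0 mu_gt0 A_total beta_gt0 beta_le c_gt0 frac_ge K0 K_k K_r0 Sz).
rewrite !meanZ ?mulr_ge0 ?(ltW eta0) ?(ltW nn) ?(ltW lam_gt0)// -/(prob _ _ big) in dr.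
set q := mean S (atom P) (fun z => ((r0 < z.2)%N && (load coord_pos z.1 < K))%:R) in dr.
have qle : (q <= (w / eta * y ^+ 2)%:E)%E.
  rewrite [w / eta]mulrC -mulrA EFinM lee_pdivlMl//; apply: le_trans dr _.
  rewrite [(n%:R * w)%R]mulrC !EFinM -muleA lee_wpmul2l// lee_fin//.
apply: (@le_trans _ _ (q + prob S (atom P) big)%E); last first.
  by rewrite mulrDl mul1r EFinD leeD.
rewrite /q /prob -meanD//; apply: le_mean => // z _.
rewrite /big; case: (r0 < z.2)%N => /=; last by rewrite addr_ge0.
by have [_|_] := leP K (load coord_pos z.1); rewrite ?addr0 ?add0r.
Qed.

End SLTALevel.

Lemma hausdorff_prod (T U : topologicalType) :
  hausdorff_space T -> hausdorff_space U -> hausdorff_space (T * U)%type.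
Proof.
move=> hT hU [a b] [a' b'] ab; congr (_, _).
  apply: hT => A B aA aB; have [] := ab (A `*` setT) (B `*` setT).
  - by exists (A, setT) => //; split=> //; exact: filterT.
  - by exists (B, setT) => //; split=> //; exact: filterT.
  - by move=> [x y] [[Ax _] [Bx _]]; exists x.
apply: hU => A B bA bB; have [] := ab (setT `*` A) (setT `*` B).
- by exists (setT, A) => //; split=> //; exact: filterT.
- by exists (setT, B) => //; split=> //; exact: filterT.
- by move=> [x y] [[_ Ax] [_ Bx]]; exists y.
Qed.

(** * Tightness under SLTA *)

Section SLTATight.
Context (R : realType) (m : nat) (u : 'I_m.+1 -> R -> R).
Variables (lam mu : R) (A : nat -> 'I_m.+1 -> nat) (alpha : 'I_m.+1 -> R).
Variable beta : nat -> R.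
Hypothesis u_concave : forall i, concave_on_nneg (u i).
Hypotheses (lam_gt0 : 0 < lam) (mu_gt0 : 0 < mu).
Hypothesis A_total : forall n, (0 < n)%N -> (\sum_i A n i = n)%N.
Hypothesis alpha_gt0 : forall i, 0 < alpha i.
Hypothesis A_cvg : forall i, class_frac R n (A n) i @[n --> \oo] --> alpha i.
Hypothesis beta_gt0 : forall n, (0 < n)%N -> 0 < beta n.
Hypothesis beta_cvg : beta @ \oo --> 0.
Local Notation state := (ell1 (coords m) R).
Local Notation S n := (slta_states u lam mu n (A n) (beta n)).

Lemma slta_tight (P : nat -> probability (borel (state * nat)%type) R) :
  (forall n, (0 < n)%N -> stationary (slta_rate u lam mu n (beta n)) (S n) (P n)) ->
  tight [set n | (0 < n)%N] P.
Proof.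
move=> statP; have hausT : hausdorff_space (state * nat)%type.
  by apply: hausdorff_prod; [exact: norm_hausdorff|exact: discrete_hausdorff].
have [c c0 [n1 cA]] := class_frac_lower alpha_gt0 A_cvg.
have [n2 betac] : exists n2, forall n, (n2 <= n)%N -> beta n <= c / 2.
  have c2 : 0 < c / 2 by rewrite divr_gt0.
  have [n2 _ H] := cvgr_le _ beta_cvg _ c2.
  by exists n2.
pose n0 := maxn n1 n2.
have countS n : (0 < n)%N -> countable (S n).
  move=> n_gt0.
  have /countable_injP[f injf] := countable_occupancy R (A n) n_gt0.
  apply/countable_injP; exists (fun z => choice.pickle (f z.1, z.2)).
  move=> [x r] [y s] /set_mem[ox _ _] /set_mem[oy _ _] /(pcan_inj choice.pickleK)[fxy ->].
  by congr (_, _); apply: injf fxy; exact: mem_set.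
have LB n (n_gt0 : (0 < n)%N) :=
  slta_load_balancer u lam mu (beta n) n_gt0 (A_total n_gt0).
have rho0 : 0 < lam / mu by rewrite divr_gt0.
pose eta := Num.min lam (mu * (c / 2)).
have eta0 : 0 < eta by rewrite lt_min lam_gt0 mulr_gt0// divr_gt0.
have levels (d : R) : 0 < d -> exists r0, forall n, (0 < n)%N -> (n0 <= n)%N ->
    (prob (S n) (atom (P n)) (fun z => r0 < z.2)%N <= d%:E)%E.
  (* For [kappa >= 1] one has [K <= 5 * kappa], so the prefactor in [slta_level_prob] is at most
     linear in [kappa], while the squared factor is of order [kappa ^ -2]. The bound becomes
     [C / kappa], and the term [C / d] of [kappa] makes it at most [d]. *)
  move=> d0; pose C := (lam * (20 / c + 2) / eta + 1) * (lam / mu) ^+ 2.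
  have C0 : 0 <= C.
    rewrite mulr_ge0 ?exprn_ge0 ?(ltW rho0)// addr_ge0// divr_ge0 ?(ltW eta0)//.
    by rewrite mulr_ge0 ?(ltW lam_gt0)// addr_ge0// divr_ge0// ltW.
  pose kappa := 1 + 2 * (lam / mu) + C / d.
  have Cd : 0 <= C / d by rewrite divr_ge0// ltW.
  have kappa1 : 1 <= kappa by rewrite /kappa; lra.
  have kappa0 : 0 < kappa by exact: lt_le_trans kappa1.
  pose K := kappa + 4; pose t := Num.trunc (K / (c / 2)).
  have c2 : 0 < c / 2 by rewrite divr_gt0.
  have Kt : K < t.+1%:R * (c / 2) by rewrite -ltr_pdivrMr//; exact: truncnS_gt.
  have tK : t%:R <= K / (c / 2).
    by have /andP[] := truncn_itv (divr_ge0 (addr_ge0 (ltW kappa0) (ler0n R 4)) (ltW c2)).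
  (* With [k = t] and [r0 = t + 2], both [k + 1] and [r0 - 1] equal [t + 1]. *)
  exists t.+2 => n n_gt0 n0n.
  have nn1 : (n1 <= n)%N by exact: leq_trans (leq_maxl _ _) n0n.
  have nn2 : (n2 <= n)%N by exact: leq_trans (leq_maxr _ _) n0n.
  have kr : 2 * (lam / mu) <= kappa by rewrite /kappa; lra.
  apply: (le_trans (slta_level_prob u_concave n_gt0 lam_gt0 mu_gt0 (A_total n_gt0)
    (beta_gt0 n_gt0) (betac n nn2) c0 (cA n nn1) hausT (countS n n_gt0) (statP n n_gt0)
    kappa0 kr (erefl K) (ltW Kt) (r0 := t.+2) (ltW Kt))).
  rewrite lee_fin -/eta.
  have kE : t.+1%:R = t%:R + 1 :> R by rewrite natr1.
  have b1 : 2 * t.+1%:R <= (20 / c + 2) * kappa.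
    have : K / (c / 2) <= 10 / c * kappa.
      have -> : 10 / c * kappa = (5 * kappa) / (c / 2) by field; rewrite gt_eqF.
      by rewrite ler_pM2r ?invr_gt0// /K; lra.
    have -> : 20 / c = 2 * (10 / c) by ring.
    set q := 10 / c; rewrite kE; nra.
  have b2 : lam * (2 * t.+1%:R) / eta + 1 <= (lam * (20 / c + 2) / eta + 1) * kappa.
    have : lam / eta * (2 * t.+1%:R) <= lam / eta * ((20 / c + 2) * kappa).
      by rewrite ler_wpM2l// divr_ge0// ltW.
    have -> : lam * (2 * t.+1%:R) / eta = lam / eta * (2 * t.+1%:R) by ring.
    have -> : lam * (20 / c + 2) / eta = lam / eta * (20 / c + 2) by ring.
    by set a := lam / eta; set b := 20 / c + 2; lra.
  have y2 : 0 <= (lam / mu / kappa) ^+ 2 by rewrite exprn_ge0// divr_ge0 ?(ltW rho0)// ltW.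
  apply: le_trans (ler_wpM2r y2 b2) _.
  have -> : (lam * (20 / c + 2) / eta + 1) * kappa * (lam / mu / kappa) ^+ 2 = C / kappa.
    by rewrite /C; set a := lam * _ / eta; set b := lam / mu; field; rewrite gt_eqF.
  rewrite ler_pdivrMr// mulrC -ler_pdivrMr//.
  by rewrite /kappa; lra.
apply: (tight_eventually hausT (S := fun n => S n) (n0 := n0)).
  by move=> n n_gt0; split; [exact: countS|case: (statP n n_gt0)].
move=> e e0; have e20 : 0 < e / 2 by rewrite divr_gt0.
have [r1 Hr1] := levels _ e20.
have [d d0|J [J0 HJ]] := uniform_tails lam_gt0 mu_gt0 A_total hausT LB countS statP (n0 := n0) _ e20.
  have d20 : 0 < d / 2 by rewrite divr_gt0.
  have [r0 Hr0] := levels _ d20.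
  have [k dk] : exists k : nat, lam / mu / (d / 2) < k.+1%:R.
    by exists (Num.trunc (lam / mu / (d / 2))); exact: truncnS_gt.
  (* [J > r0], and [J - 1 >= k + 1] exceeds [lam / mu / (d / 2)]: the two terms of [slta_arr_tail]
     have mean at most [d / 2] each. *)
  pose J := (maxn r0 k.+1).+1; exists J => // n n_gt0 n0n.
  have r0J : (r0 < J)%N by rewrite ltnS leq_maxl.
  have J1 : (1 < J)%N by rewrite ltnS leq_max orbT.
  have kJ : k.+1%:R <= J.-1%:R :> R by rewrite ler_nat leq_maxr.
  have Jp : 0 < J.-1%:R :> R by apply: lt_le_trans kJ.
  have pi0 : forall x, 0 <= atom (P n) x := @atom_ge0 _ _ _.
  have l0 z : S n z -> 0 <= load coord_pos z.1.
    by move=> [oz _ _]; rewrite fsumr_ge0// => p _; exact: (occ_ge0 n_gt0 p oz).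
  apply: (@le_trans _ _ (mean (S n) (atom (P n)) (fun z =>
      (r0 < z.2)%N%:R + J.-1%:R^-1 * load coord_pos z.1)%R)).
    apply: le_mean => // z Sz.
    exact: (slta_arr_tail u_concave n_gt0 (A_total n_gt0) Sz r0J J1).
  rewrite meanD//; last by move=> z Sz; rewrite mulr_ge0 ?invr_ge0 ?l0.
  have -> : d%:E = ((d / 2)%:E + (d / 2)%:E)%E by rewrite -EFinD -splitr.
  apply: leeD; first exact: Hr0.
  have nn : 0 < n%:R :> R by rewrite ltr0n.
  have := mean_tasks (LB n n_gt0) n_gt0 lam_gt0 mu_gt0 pi0
    (atom_total hausT (countS n n_gt0) (statP n n_gt0).1)
    (lb_balance (LB n n_gt0) hausT n_gt0 lam_gt0 mu_gt0 (countS n n_gt0) (statP n n_gt0)).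
  rewrite /tasks meanZ ?(ltW nn)// EFinM lee_pmul2l// => H.
  rewrite meanZ ?invr_ge0//; apply: (@le_trans _ _ (J.-1%:R^-1%:E * (lam / mu)%:E)%E).
    by rewrite lee_wpmul2l// lee_fin invr_ge0.
  rewrite -EFinM lee_fin mulrC ler_pdivrMr// [leRHS]mulrC -ler_pdivrMr//.
  exact: le_trans (ltW dk) kJ.
pose box1 := @envelope R m J `*` [set r : nat | (r <= r1)%N].
have cbox : compact box1.
  apply: compact_setX; first exact: compact_envelope.
  by apply: finite_compact; apply: sub_finite_set (finite_II r1.+1) => r.
exists box1; split=> // n n_gt0 n0n.
rewrite (carried_outside hausT (countS n n_gt0) (statP n n_gt0).1); last first.
  by apply: measurable_borel_closed; exact: compact_closed.
have pi0 : forall x, 0 <= atom (P n) x := @atom_ge0 _ _ _.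
apply: (@le_trans _ _ (prob (S n) (atom (P n)) (fun z => z.1 \notin @envelope R m J) +
    prob (S n) (atom (P n)) (fun z => r1 < z.2)%N)%E); last first.
  have -> : e%:E = ((e / 2)%:E + (e / 2)%:E)%E by rewrite -EFinD -splitr.
  by apply: leeD; [exact: HJ|exact: Hr1].
(* Outside the box, the occupancy is not in the envelope or [r > r1]. *)
rewrite /prob -meanD//; apply: le_mean => // -[x r] _ /=; rewrite -natrD ler_nat.
have [xe|_] := boolP (x \in @envelope R m J); last first.
  by apply: leq_trans (leq_b1 _) _; rewrite leq_addr.
have [rr1|_] := leqP r r1; last by rewrite leq_b1.
by rewrite mem_set//; split=> //; exact: set_mem.
Qed.

End SLTATight.

Theorem proposition10 (R : realType) (m : nat) (u : 'I_m.+1 -> R -> R)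
    (lam mu : R) (A : nat -> 'I_m.+1 -> nat) (alpha : 'I_m.+1 -> R)
    (hu : forall i, concave_on_nneg (u i))
    (hlam : 0 < lam) (hmu : 0 < mu)
    (hA : forall n, (0 < n)%N -> (\sum_(i < m.+1) A n i = n)%N)
    (halpha : forall i, 0 < alpha i < 1)
    (hcvg : forall i, class_frac R n (A n) i @[n --> \oo] --> alpha i) :
  (forall P : nat -> probability (borel (ell1 (coords m) R)) R,
     (forall n, (0 < n)%N ->
        stationary (jlmu_rate u lam mu n) (jlmu_states u lam mu n (A n)) (P n)) ->
     tight [set n | (0 < n)%N] P)
  /\
  (forall (beta : nat -> R) (sigma_star : coords m) (gamma0 : R),
     (forall n, (0 < n)%N -> 0 < beta n) ->
     is_sigma_star u alpha (lam / mu) sigma_star ->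
     (\esum_(p in [set p | coord_pos p /\ rank_lt u sigma_star p])
        (alpha p.1)%:E < (lam / mu)%:E)%E ->
     0 < gamma0 < 1 / 2 ->
     beta @ \oo --> 0 ->
     (0 < limn_einf (fun n => (n%:R `^ gamma0 * beta n)%:E))%E ->
     forall P : nat -> probability (borel (ell1 (coords m) R * nat)%type) R,
       (forall n, (0 < n)%N ->
          stationary (slta_rate u lam mu n (beta n))
            (slta_states u lam mu n (A n) (beta n)) (P n)) ->
       tight [set n | (0 < n)%N] P).
Proof.
have alpha_gt0 i : 0 < alpha i by have /andP[] := halpha i.
split=> [P statP|beta sigma_star gamma0 beta_gt0 _ _ _ beta_cvg _ P statP].
  exact: (jlmu_tight hu hlam hmu hA alpha_gt0 hcvg).
exact: (slta_tight hu hlam hmu hA alpha_gt0 hcvg beta_gt0 beta_cvg).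
Qed.
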